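(* Let $F:\mathbf{ab}^{op}\to\mathbf{Ab}$ be a reduced polynomial contravariant functor from the category $\mathbf{ab}$ of free abelian groups of finite rank to the category $\mathbf{Ab}$ of abelian groups. There is a natural isomorphism $$\underset{n\in\mathbb{N}}{\mathrm{colim}}\ H_1\big(\mathrm{Aut}(\mathbb{Z}^{*n});F(\mathbb{Z}^n)\big)\simeq F\underset{\mathbf{ab}}{\otimes}\mathrm{Id},$$ where $\mathrm{Aut}(\mathbb{Z}^{*n})$ acts on $F(\mathbb{Z}^n)$ via the projection $\mathrm{Aut}(\mathbb{Z}^{*n})\to GL_n(\mathbb{Z})$ and $\mathrm{Id}:\mathbf{ab}\to\mathbf{Ab}$ denotes the inclusion functor.
   Context: $\mathbb{Z}^{*n}$ is the free group of rank $n$; the projection $\mathrm{Aut}(\mathbb{Z}^{*n})\to GL_n(\mathbb{Z})$ is induced by abelianization. The (left) action of $g\in GL_n(\mathbb{Z})$ on $F(\mathbb{Z}^n)$, $F$ contravariant, is by $F(g^{-1})$. The colimit is taken along the maps induced by $\mathrm{Aut}(\mathbb{Z}^{*n})\to\mathrm{Aut}(\mathbb{Z}^{*n+1})$, $\varphi\mapsto\varphi*\mathrm{id}_{\mathbb{Z}}$, and the equivariant maps $F(\mathbb{Z}^n)\to F(\mathbb{Z}^{n+1})$ induced by the projection $\mathbb{Z}^{n+1}\to\mathbb{Z}^n$ onto the first $n$ coordinates. Reduced: $F(0)=0$. Polynomial: there is $m\geq 1$ such that the $m$-th cross effect vanishes, where $$cr_m(F)(A_1,\dots,A_m)=\ker\Big(F(A_1\oplus\cdots\oplus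 A_m)\to\bigoplus_{i=1}^m F(A_1\oplus\cdots\oplus\widehat{A_i}\oplus\cdots\oplus A_m)\Big)$$ with components induced by the canonical inclusions of the sums omitting $A_i$. For $F:\mathbf{ab}^{op}\to\mathbf{Ab}$ and $G:\mathbf{ab}\to\mathbf{Ab}$, the tensor product $F\otimes_{\mathbf{ab}}G$ is the coend: the quotient of $\bigoplus_{A}F(A)\otimes_{\mathbb{Z}}G(A)$ ($A$ running over a small skeleton of $\mathbf{ab}$) by the relations $F(f)(x)\otimes y= x\otimes G(f)(y)$ for $f:A\to B$ in $\mathbf{ab}$, $x\in F(B)$, $y\in G(A)$. *)

(* Defs.v *)
From HB Require Import structures.
From mathcomp Require Import all_boot all_order all_algebra.
From mathcomp Require Import finmap mathcomp_extra boolp classical_sets.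
From mathcomp Require Import functions cardinality fsbigop.

Set Implicit Arguments.
Unset Strict Implicit.
Unset Printing Implicit Defensive.

Import GRing.Theory.

Local Open Scope ring_scope.
Local Open Scope classical_set_scope.

Lemma additive_eq (U V : zmodType) (f g : {additive U -> V}) : f =1 g -> f = g.
Proof.
case: f g => [f [[hf]]] [g [[hg]]] /= /funext e; subst g.
by rewrite (Prop_irrelevance hf hg).
Qed.

Inductive subgroup_gen (V : zmodType) (S : set V) : V -> Prop :=
| subgroup_gen0 : subgroup_gen S 0
| subgroup_gen_in x : S x -> subgroup_gen S x
| subgroup_genB x y :
    subgroup_gen S x -> subgroup_gen S y -> subgroup_gen S (x - y).

Section Quotient.
Variables (V : zmodType) (S : set V).

Lemma subgroup_genN x : subgroup_gen S x -> subgroup_gen S (- x).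
Proof. by move=> h; rewrite -sub0r; apply: subgroup_genB => //; exact: subgroup_gen0. Qed.

Lemma subgroup_genD x y :
  subgroup_gen S x -> subgroup_gen S y -> subgroup_gen S (x + y).
Proof. by move=> hx /subgroup_genN /(subgroup_genB hx); rewrite opprK. Qed.

Definition quot_rel (x y : V) := `[< subgroup_gen S (x - y) >].

Lemma quot_rel_refl : reflexive quot_rel.
Proof. by move=> x; apply/asboolP; rewrite subrr; exact: subgroup_gen0. Qed.

Lemma quot_rel_sym : symmetric quot_rel.
Proof. by move=> x y; apply/asboolP/asboolP => /subgroup_genN; rewrite opprB. Qed.

Lemma quot_rel_trans : transitive quot_rel.
Proof.
move=> y x z /asboolP h1 /asboolP /(subgroup_genD h1) h.
by apply/asboolP; rewrite -(subrKA y).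
Qed.

Canonical quot_equiv := EquivRel quot_rel quot_rel_refl quot_rel_sym quot_rel_trans.

(** The set [S] need not be a subgroup: the quotient is by the subgroup it
    generates. *)
Definition quot := {eq_quot quot_equiv}%qT.
HB.instance Definition _ := EqQuotient.on quot.
HB.instance Definition _ := Choice.on quot.

Definition quot_pi (x : V) : quot := (\pi_quot x)%qT.

Lemma quot_piP x y : quot_pi x = quot_pi y <-> subgroup_gen S (x - y).
Proof.
split; first by move/eqquotP => /asboolP.
by move=> h; apply/eqquotP/asboolP.
Qed.

Lemma quot_piK (q : quot) : quot_pi (repr q) = q.
Proof. exact: reprK. Qed.

Lemma quot_reprP x : subgroup_gen S (repr (quot_pi x) - x).
Proof. by apply/quot_piP; rewrite quot_piK. Qed.

Definition quot_add (p q : quot) := quot_pi (repr p + repr q).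
Definition quot_opp (p : quot) := quot_pi (- repr p).

Lemma quot_piD x y : quot_pi (x + y) = quot_add (quot_pi x) (quot_pi y).
Proof.
apply/esym/quot_piP; rewrite opprD addrACA.
by apply: subgroup_genD; apply: quot_reprP.
Qed.

Lemma quot_piN x : quot_pi (- x) = quot_opp (quot_pi x).
Proof.
by apply/esym/quot_piP; rewrite -opprD; apply/subgroup_genN/quot_reprP.
Qed.

Lemma quot_addA : associative quot_add.
Proof.
move=> p q r; rewrite -(quot_piK p) -(quot_piK q) -(quot_piK r).
by rewrite -!quot_piD addrA.
Qed.
Lemma quot_addC : commutative quot_add.
Proof. by move=> p q; rewrite /quot_add addrC. Qed.
Lemma quot_add0 : left_id (quot_pi 0) quot_add.
Proof. by move=> p; rewrite -(quot_piK p) -quot_piD add0r. Qed.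
Lemma quot_addN : left_inverse (quot_pi 0) quot_opp quot_add.
Proof. by move=> p; rewrite -(quot_piK p) -quot_piN -quot_piD addNr. Qed.

HB.instance Definition _ :=
  GRing.isZmodule.Build quot quot_addA quot_addC quot_add0 quot_addN.

Lemma quot_pi_is_zmod_morphism : zmod_morphism quot_pi.
Proof. by move=> x y; rewrite quot_piD quot_piN. Qed.
HB.instance Definition _ :=
  GRing.isZmodMorphism.Build V quot quot_pi quot_pi_is_zmod_morphism.

Section Lift.
Variables (W : zmodType) (f : {additive V -> W}) (hf : forall x, S x -> f x = 0).

Lemma subgroup_gen_kills x : subgroup_gen S x -> f x = 0.
Proof.
elim=> [|{}x /hf//|{}x y _ fx _ fy]; first exact: raddf0.
by rewrite raddfB fx fy subrr.
Qed.

Definition quot_lift_fun of forall x, S x -> f x = 0 :=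
  fun q : quot => f (repr q).

Lemma quot_lift_funE x : quot_lift_fun hf (quot_pi x) = f x.
Proof.
by apply/eqP; rewrite -subr_eq0 -raddfB; apply/eqP/subgroup_gen_kills/quot_reprP.
Qed.

Lemma quot_lift_is_zmod_morphism : zmod_morphism (quot_lift_fun hf).
Proof.
move=> p q; rewrite -(quot_piK p) -(quot_piK q) -raddfB.
by rewrite !quot_lift_funE raddfB.
Qed.
HB.instance Definition _ := GRing.isZmodMorphism.Build quot W
  (quot_lift_fun hf) quot_lift_is_zmod_morphism.

Definition quot_lift : {additive quot -> W} := quot_lift_fun hf.

Lemma quot_liftE x : quot_lift (quot_pi x) = f x.
Proof. exact: quot_lift_funE. Qed.

End Lift.
End Quotient.

Section Kernel.
Variables (V W : zmodType) (f : {additive V -> W}).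

Record kernel := Kernel { kernel_val : V; _ : f kernel_val == 0 }.
HB.instance Definition _ := [isSub for kernel_val].
HB.instance Definition _ := [Choice of kernel by <:].

Lemma kernel_zmod_closed : zmod_closed [pred x | f x == 0].
Proof.
split=> [|x y]; rewrite !inE ?raddf0// => /eqP fx /eqP fy.
by rewrite raddfB fx fy subrr.
Qed.
HB.instance Definition _ := GRing.SubChoice_isSubZmodule.Build V _ kernel
  kernel_zmod_closed.

Lemma kernelP (x : kernel) : f (val x) = 0.
Proof. by case: x => x /= /eqP. Qed.

End Kernel.

Section DirectSum.
Variables (I : choiceType) (V : I -> zmodType).

Record dsum := DSum {
  dsum_val :> forall i, V i;
  dsum_fin : finite_set [set i | dsum_val i != 0] }.

HB.instance Definition _ := gen_eqMixin dsum.
HB.instance Definition _ := gen_choiceMixin dsum.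

Lemma dsumP (s t : dsum) : (forall i, s i = t i) -> s = t.
Proof.
case: s t => [s hs] [t ht] /= e.
have {}e : s = t by apply: functional_extensionality_dep.
by subst t; rewrite (Prop_irrelevance hs ht).
Qed.

Lemma dsum0_subproof : finite_set [set i | (fun i => 0 : V i) i != 0].
Proof. by rewrite (_ : [set _ | _] = set0)// -subset0 => i /=; rewrite eqxx. Qed.
Definition dsum_zero := DSum dsum0_subproof.

Lemma dsumN_subproof (s : dsum) : finite_set [set i | - s i != 0].
Proof. by apply: sub_finite_set (dsum_fin s) => i /=; rewrite oppr_eq0. Qed.
Definition dsum_opp s := DSum (dsumN_subproof s).

Lemma dsumD_subproof (s t : dsum) : finite_set [set i | s i + t i != 0].
Proof.
apply: (@sub_finite_set _ _ ([set i | s i != 0] `|` [set i | t i != 0])).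
  move=> i /=; case: (eqVneq (s i) 0) => [->|]; last by left.
  by rewrite add0r; right.
by rewrite finite_setU; split; apply: dsum_fin.
Qed.
Definition dsum_add s t := DSum (dsumD_subproof s t).

Lemma dsum_addA : associative dsum_add.
Proof. by move=> s t u; apply: dsumP => i /=; rewrite addrA. Qed.
Lemma dsum_addC : commutative dsum_add.
Proof. by move=> s t; apply: dsumP => i /=; rewrite addrC. Qed.
Lemma dsum_add0 : left_id dsum_zero dsum_add.
Proof. by move=> s; apply: dsumP => i /=; rewrite add0r. Qed.
Lemma dsum_addN : left_inverse dsum_zero dsum_opp dsum_add.
Proof. by move=> s; apply: dsumP => i /=; rewrite addNr. Qed.

HB.instance Definition _ :=
  GRing.isZmodule.Build dsum dsum_addA dsum_addC dsum_add0 dsum_addN.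

Lemma dsum0E i : (0 : dsum) i = 0. Proof. by []. Qed.
Lemma dsumDE (s t : dsum) i : (s + t) i = s i + t i. Proof. by []. Qed.
Lemma dsumNE (s : dsum) i : (- s) i = - s i. Proof. by []. Qed.
Lemma dsumBE (s t : dsum) i : (s - t) i = s i - t i. Proof. by []. Qed.
Lemma dsum_sumE J (r : seq J) (P : pred J) (s : J -> dsum) i :
  (\sum_(j <- r | P j) s j) i = \sum_(j <- r | P j) s j i.
Proof. by elim/big_rec2: _ => // j x y _ <-. Qed.

Lemma dsum_inj_subproof i (x : V i) :
  finite_set [set j | eqtype.dfwith (fun k => 0 : V k) x j != 0].
Proof.
apply: (@sub_finite_set _ _ [set i]); last exact: finite_set1.
by move=> j /=; case: (eqVneq i j) => // ij; rewrite eqtype.dfwith_out// eqxx.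
Qed.
Definition dsum_inj_fun i (x : V i) := DSum (dsum_inj_subproof x).

Lemma dsum_inj_id i (x : V i) : dsum_inj_fun x i = x.
Proof. exact: eqtype.dfwith_in. Qed.
Lemma dsum_inj_neq i j (x : V i) : i != j -> dsum_inj_fun x j = 0.
Proof. exact: eqtype.dfwith_out. Qed.

Lemma dsum_inj_is_zmod_morphism i : zmod_morphism (@dsum_inj_fun i).
Proof.
move=> x y; apply: dsumP => j; rewrite dsumBE.
have [<-|ij] := eqVneq i j; first by rewrite !dsum_inj_id.
by rewrite !dsum_inj_neq// subr0.
Qed.
HB.instance Definition _ i := GRing.isZmodMorphism.Build (V i) dsum
  (@dsum_inj_fun i) (@dsum_inj_is_zmod_morphism i).

Definition dsum_inj i : {additive V i -> dsum} := @dsum_inj_fun i.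

Section Lift.
Variables (W : zmodType) (f : forall i, {additive V i -> W}).

Definition dsum_lift_fun (s : dsum) : W :=
  \sum_(i \in [set i | s i != 0]) f i (s i).

Lemma dsum_lift_widen (s : dsum) (A : set I) :
  [set i | s i != 0] `<=` A -> dsum_lift_fun s = \sum_(i \in A) f i (s i).
Proof.
move=> sA; rewrite /dsum_lift_fun; apply: fsbig_widen => // i [_ /= /negP].
by rewrite negbK => /eqP ->; rewrite raddf0.
Qed.

Lemma dsum_lift_is_zmod_morphism : zmod_morphism dsum_lift_fun.
Proof.
move=> s t; pose A := [set i | s i != 0] `|` [set i | t i != 0].
have finA : finite_set A by rewrite finite_setU; split; apply: dsum_fin.
rewrite !(@dsum_lift_widen _ A); last 3 first.
- by move=> i; right.
- by move=> i; left.
- move=> i; change (s i - t i != 0 -> A i); case: (eqVneq (s i) 0) => [->|]; last by left.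
  by rewrite sub0r oppr_eq0; right.
rewrite (eq_fsbigr (fun i => f i (s i) - f i (t i))); last first.
  by move=> i _; rewrite dsumBE raddfB.
by rewrite !fsbig_finite//= sumrB.
Qed.
HB.instance Definition _ := GRing.isZmodMorphism.Build dsum W
  dsum_lift_fun dsum_lift_is_zmod_morphism.

Definition dsum_lift : {additive dsum -> W} := dsum_lift_fun.

Lemma dsum_lift_inj i (x : V i) : dsum_lift (dsum_inj i x) = f i x.
Proof.
rewrite /dsum_lift/= (@dsum_lift_widen _ [set i]).
  by rewrite fsbig_set1 dsum_inj_id.
move=> j /=; case: (eqVneq i j) => // ij.
by rewrite eqtype.dfwith_out// eqxx.
Qed.

End Lift.

Lemma dsum_decomp (s : dsum) :
  s = \sum_(i <- fset_set [set i | s i != 0]) dsum_inj i (s i).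
Proof.
apply: dsumP => i; rewrite dsum_sumE.
have [si0|si0] := eqVneq (s i) 0.
  rewrite si0 big1_seq// => j /andP[_ jS].
  have [<-|ji] := eqVneq i j; first by rewrite si0 raddf0.
  by rewrite [LHS]dsum_inj_neq// eq_sym.
rewrite (big_fsetD1 i)/=; last by rewrite in_fset_set ?inE//; apply: dsum_fin.
rewrite [X in X + _]dsum_inj_id big1_seq ?addr0// => j /andP[_].
by rewrite !inE => /andP[ji _]; rewrite [LHS]dsum_inj_neq.
Qed.

Lemma dsum_ext (W : zmodType) (f g : {additive dsum -> W}) :
  (forall i x, f (dsum_inj i x) = g (dsum_inj i x)) -> f =1 g.
Proof.
by move=> e s; rewrite (dsum_decomp s) !raddf_sum; apply: eq_bigr => i _; apply: e.
Qed.

End DirectSum.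

Definition dsum_map (I : choiceType) (V W : I -> zmodType)
    (f : forall i, {additive V i -> W i}) : {additive dsum V -> dsum W} :=
  dsum_lift (fun i => dsum_inj W i \o f i).

Lemma dsum_mapE (I : choiceType) (V W : I -> zmodType)
    (f : forall i, {additive V i -> W i}) i x :
  dsum_map f (dsum_inj V i x) = dsum_inj W i (f i x).
Proof. exact: dsum_lift_inj. Qed.

Section QuotMap.
Variables (V W : zmodType) (S : set V) (T : set W) (f : {additive V -> W}).
Hypothesis fST : forall x, S x -> subgroup_gen T (f x).

Lemma quot_map_subproof x : S x -> (quot_pi T \o f) x = 0.
Proof.
by move=> /fST Tfx; rewrite -(raddf0 (quot_pi T)); apply/quot_piP; rewrite subr0.
Qed.

Definition quot_map : {additive quot S -> quot T} := quot_lift quot_map_subproof.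

Lemma quot_mapE x : quot_map (quot_pi S x) = quot_pi T (f x).
Proof. by rewrite /quot_map quot_liftE. Qed.

End QuotMap.

Section SeqColim.
Variables (V : nat -> zmodType) (t : forall n, {additive V n -> V n.+1}).

Definition seqcolim_rel : set (dsum V) :=
  [set z | exists n (x : V n), z = dsum_inj V n.+1 (t n x) - dsum_inj V n x].

Definition seqcolim : zmodType := quot seqcolim_rel.

End SeqColim.

Section SeqColimMap.
Variables (V W : nat -> zmodType).
Variables (t : forall n, {additive V n -> V n.+1}).
Variables (u : forall n, {additive W n -> W n.+1}).
Variables (f : forall n, {additive V n -> W n}).
Hypothesis ft : forall n x, f n.+1 (t n x) = u n (f n x).

Lemma seqcolim_map_subproof z :
  seqcolim_rel t z -> subgroup_gen (seqcolim_rel u) (dsum_map f z).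
Proof.
move=> [n [x ->]]; rewrite raddfB !dsum_mapE ft.
by apply: subgroup_gen_in; exists n, (f n x).
Qed.

Definition seqcolim_map : {additive seqcolim t -> seqcolim u} :=
  quot_map seqcolim_map_subproof.

End SeqColimMap.

Section Tensor.
Variables A B : zmodType.

Definition tensor_free : zmodType := @dsum (A * B)%type (fun=> int).
Definition tensor_gen (x : A) (y : B) : tensor_free :=
  @dsum_inj (A * B)%type (fun=> int) (x, y) 1.

Definition tensor_rel : set tensor_free :=
  [set z | (exists x x' y,
              z = tensor_gen (x + x') y - (tensor_gen x y + tensor_gen x' y))
        \/ (exists x y y',
              z = tensor_gen x (y + y') - (tensor_gen x y + tensor_gen x y'))].

Definition tensor : zmodType := quot tensor_rel.

Definition tens (x : A) (y : B) : tensor := quot_pi tensor_rel (tensor_gen x y).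

Lemma tensDl x x' y : tens (x + x') y = tens x y + tens x' y.
Proof.
rewrite /tens -raddfD; apply/quot_piP/subgroup_gen_in.
by left; exists x, x', y.
Qed.

Lemma tensDr x y y' : tens x (y + y') = tens x y + tens x y'.
Proof.
rewrite /tens -raddfD; apply/quot_piP/subgroup_gen_in.
by right; exists x, y, y'.
Qed.

End Tensor.

Section TensorMap.
Variables (A A' B B' : zmodType).
Variables (f : {additive A -> A'}) (g : {additive B -> B'}).

Definition tensor_free_map : {additive tensor_free A B -> tensor_free A' B'} :=
  dsum_lift (fun p : A * B =>  *~%R (tensor_gen (f p.1) (g p.2))).

Lemma tensor_free_mapE x y :
  tensor_free_map (tensor_gen x y) = tensor_gen (f x) (g y).
Proof. by rewrite /tensor_free_map dsum_lift_inj; exact: mulr1z. Qed.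

Lemma tensor_map_subproof z : tensor_rel z ->
  subgroup_gen (@tensor_rel A' B') (tensor_free_map z).
Proof.
move=> h; apply: subgroup_gen_in.
case: h => [[x [x' [y ->]]]|[x [y [y' ->]]]];
  rewrite raddfB raddfD !tensor_free_mapE raddfD.
  by left; exists (f x), (f x'), (g y).
by right; exists (f x), (g y), (g y').
Qed.

Definition tensor_map : {additive tensor A B -> tensor A' B'} :=
  quot_map tensor_map_subproof.

Lemma tensor_mapE x y : tensor_map (tens x y) = tens (f x) (g y).
Proof. by rewrite /tensor_map quot_mapE tensor_free_mapE. Qed.

End TensorMap.

HB.mixin Record isFreeAb A of GRing.Zmodule A := {
  freeAb_basis : exists (J : finType) (b : J -> A), forall a : A,
    exists! c : {ffun J -> int}, a = \sum_(j : J) b j *~ c j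
}.

#[short(type="freeAbType")]
HB.structure Definition FreeAb := {A of isFreeAb A & GRing.Zmodule A}.

Lemma rV_freeAb_basis n : exists (J : finType) (b : J -> 'rV[int]_n), forall a,
  exists! c : {ffun J -> int}, a = \sum_(j : J) b j *~ c j.
Proof.
exists 'I_n, (fun j => delta_mx 0 j) => a.
have E (c : {ffun 'I_n -> int}) k :
    (\sum_j delta_mx 0 j *~ c j : 'rV[int]_n) 0 k = c k.
  rewrite (bigD1 k)//= mxE summxE big1 => [|j jk]; last first.
    by rewrite -scaler_int !mxE eqxx eq_sym (negbTE jk) mulr0.
  by rewrite -scaler_int !mxE !eqxx mulr1 addr0 intz.
exists [ffun j => a 0 j]; split.
  by apply/rowP => k; rewrite E ffunE.
by move=> c ac; apply/ffunP => k; rewrite ffunE ac E.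
Qed.
HB.instance Definition _ n := isFreeAb.Build 'rV[int]_n (rV_freeAb_basis n).

Lemma dsum_freeAb_basis (I : finType) (A : I -> freeAbType) :
  exists (J : finType) (b : J -> @dsum I A), forall a,
  exists! c : {ffun J -> int}, a = \sum_(j : J) b j *~ c j.
Proof.
have [J bP] := choice (fun i => @freeAb_basis (A i)).
have {bP} [b bP] : exists b : forall i, J i -> A i, forall i a,
    exists! c : {ffun J i -> int}, a = \sum_(j : J i) b i j *~ c j.
  by exists (fun i => sval (cid (bP i))) => i; exact: svalP (cid (bP i)).
exists {i : I & J i}, (fun p => dsum_inj A (tag p) (b (tag p) (tagged p))) => a.
have E (c : {ffun {i : I & J i} -> int}) k :
    (\sum_p dsum_inj A (tag p) (b (tag p) (tagged p)) *~ c p) k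
    = \sum_(j : J k) b k j *~ c (Tagged J j).
  transitivity ((\sum_i \sum_(j : J i)
      dsum_inj A i (b i j) *~ c (Tagged J j)) k).
    by rewrite sig_big_dep; congr (dsum_val _ k); apply: eq_bigr => -[].
  rewrite dsum_sumE (bigD1 k)//= dsum_sumE [X in _ + X]big1 => [|i ik].
    rewrite addr0; apply: eq_bigr => j _.
    by rewrite -raddfMz [LHS]dsum_inj_id.
  rewrite dsum_sumE big1// => j _.
  by rewrite -raddfMz [LHS]dsum_inj_neq.
pose c i := sval (cid (bP i (a i))).
have cP i : unique (fun d : {ffun J i -> int} => a i = \sum_(j : J i) b i j *~ d j)
                   (c i) := svalP (cid (bP i (a i))).
exists [ffun p => c (tag p) (tagged p)]; split.
  apply: dsumP => i; rewrite E (cP i).1.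
  by apply: eq_bigr => j _; rewrite ffunE.
move=> d ad; apply/ffunP => -[i j]; rewrite ffunE /=.
have -> : c i = [ffun j => d (Tagged J j)].
  apply: (cP i).2; rewrite ad E.
  by apply: eq_bigr => k _; rewrite ffunE.
by rewrite ffunE.
Qed.
HB.instance Definition _ (I : finType) (A : I -> freeAbType) :=
  isFreeAb.Build (@dsum I A) (dsum_freeAb_basis A).

Record contraFunctor := ContraFunctor {
  contra_obj :> freeAbType -> zmodType;
  contra_map : forall A B : freeAbType,
    {additive A -> B} -> {additive contra_obj B -> contra_obj A};
  contra_id : forall (A : freeAbType) (x : contra_obj A),
    contra_map (idfun : {additive A -> A}) x = x;
  contra_comp : forall (A B C : freeAbType) (g : {additive B -> C})
    (f : {additive A -> B}) (x : contra_obj C),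
    contra_map (g \o f : {additive A -> C}) x = contra_map f (contra_map g x)
}.

Record coFunctor := CoFunctor {
  co_obj :> freeAbType -> zmodType;
  co_map : forall A B : freeAbType,
    {additive A -> B} -> {additive co_obj A -> co_obj B};
  co_id : forall (A : freeAbType) (x : co_obj A),
    co_map (idfun : {additive A -> A}) x = x;
  co_comp : forall (A B C : freeAbType) (g : {additive B -> C})
    (f : {additive A -> B}) (x : co_obj A),
    co_map (g \o f : {additive A -> C}) x = co_map g (co_map f x)
}.

Definition inclFunctor : coFunctor := {|
  co_obj := fun A => A;
  co_map := fun A B f => f;
  co_id := fun A x => erefl;
  co_comp := fun A B C g f x => erefl |}.

Record contraNat (F F' : contraFunctor) := ContraNat {
  nat_app :> forall A : freeAbType, {additive F A -> F' A};
  nat_natural : forall (A B : freeAbType) (f : {additive A -> B}) (x : F B),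
    nat_app A (contra_map F f x) = contra_map F' f (nat_app B x)
}.

Definition reduced_functor (F : contraFunctor) : Prop :=
  forall x : F 'rV[int]_0, x = 0.

Section CrossEffect.
Variables (F : contraFunctor) (m : nat) (A : 'I_m -> freeAbType).

Definition omit_incl (i : 'I_m) :
    {additive @dsum {j : 'I_m | j != i} (fun j => A (val j)) -> @dsum 'I_m A} :=
  dsum_lift (fun j => dsum_inj A (val j)).

Definition cross_effect : set (F (@dsum 'I_m A)) :=
  [set x | forall i, contra_map F (omit_incl i) x = 0].

End CrossEffect.

Definition polynomial_functor (F : contraFunctor) : Prop :=
  exists2 m : nat, (1 <= m)%N &
    forall A : 'I_m -> freeAbType, @cross_effect F m A = [set 0].

Section Coend.
Variables (F : contraFunctor) (G : coFunctor).

(** The objects ['rV[int]_n] form a skeleton of the free abelian groups of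
    finite rank, so the coend is taken over [n : nat]. *)
Definition coend_summand (n : nat) : zmodType :=
  tensor (F 'rV[int]_n) (G 'rV[int]_n).

Definition coend_rel : set (dsum coend_summand) :=
  [set z | exists m n (f : {additive 'rV[int]_m -> 'rV[int]_n})
                  (x : F 'rV[int]_n) (y : G 'rV[int]_m),
     z = dsum_inj coend_summand m (tens (contra_map F f x) y)
         - dsum_inj coend_summand n (tens x (co_map G f y))].

Definition coend : zmodType := quot coend_rel.

End Coend.

Section CoendMap.
Variables (F F' : contraFunctor) (eta : contraNat F F') (G : coFunctor).

Definition coend_summand_map n :
    {additive coend_summand F G n -> coend_summand F' G n} :=
  tensor_map (eta 'rV[int]_n) idfun.

Lemma coend_map_subproof z : coend_rel z ->
  subgroup_gen (@coend_rel F' G) (dsum_map coend_summand_map z).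
Proof.
move=> [m [n [f [x [y ->]]]]]; rewrite raddfB !dsum_mapE /coend_summand_map.
rewrite !tensor_mapE nat_natural.
by apply: subgroup_gen_in; exists m, n, f, (eta _ x), y.
Qed.

Definition coend_map : {additive coend F G -> coend F' G} :=
  quot_map coend_map_subproof.

End CoendMap.

Section FreeGroup.
Variable X : choiceType.

(** The letter [(x, false)] is the generator [x], and [(x, true)] is its inverse. *)
Definition fg_letter := (X * bool)%type.
Implicit Types (l : fg_letter).

Definition inv_letter l : fg_letter := (l.1, ~~ l.2).

Lemma inv_letterK : involutive inv_letter.
Proof. by case=> x b; rewrite /inv_letter /= negbK. Qed.

Definition reduced_word (w : seq fg_letter) := sorted (fun l l' => l' != inv_letter l) w.

Definition cons_reduce l (w : seq fg_letter) :=
  if w is l' :: w' then (if l' == inv_letter l then w' else l :: w) else [:: l].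

Lemma cons_reduce_reduced l w : reduced_word w -> reduced_word (cons_reduce l w).
Proof.
case: w => [|l' w]//= pw; case: ifP => [_|/negbT ll' /=]; last by rewrite ll'.
exact: path_sorted pw.
Qed.

Lemma cons_reduceK l w :
  reduced_word w -> cons_reduce (inv_letter l) (cons_reduce l w) = w.
Proof.
case: w => [|l1 w] /=; first by rewrite inv_letterK eqxx.
case: (eqVneq l1 (inv_letter l)) => [->|ne]; last by rewrite /= inv_letterK eqxx.
by case: w => [|l2 w]//= /andP[/negbTE ->].
Qed.

Definition word_mul (u v : seq fg_letter) := foldr cons_reduce v u.

Lemma word_mul_reduced u v : reduced_word v -> reduced_word (word_mul u v).
Proof. by move=> rv; elim: u => //= l u; apply: cons_reduce_reduced. Qed.

Lemma word_mul_cons_reduce l u w : reduced_word u -> reduced_word w ->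
  word_mul (cons_reduce l u) w = cons_reduce l (word_mul u w).
Proof.
case: u => [|l' u]//= ru rw; case: (eqVneq l' (inv_letter l)) => [->|//].
have := cons_reduceK (inv_letter l) (word_mul_reduced u rw).
by rewrite inv_letterK => ->.
Qed.

Lemma word_mulA u v w : reduced_word v -> reduced_word w ->
  word_mul (word_mul u v) w = word_mul u (word_mul v w).
Proof.
move=> rv rw; elim: u => //= l u <-.
by rewrite word_mul_cons_reduce// word_mul_reduced.
Qed.

Lemma word_mulw1 u : reduced_word u -> word_mul u [::] = u.
Proof.
elim: u => //= l u IH pu; rewrite IH; last exact: path_sorted pu.
by case: u pu {IH} => //= l' u /andP[/negbTE ->].
Qed.

Definition word_inv (w : seq fg_letter) := rev (map inv_letter w).

Lemma word_inv_reduced w : reduced_word w -> reduced_word (word_inv w).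
Proof.
rewrite /reduced_word /word_inv rev_sorted sorted_map; apply: sub_sorted => l l' /=.
by rewrite inv_letterK eq_sym.
Qed.

Lemma word_invK : involutive word_inv.
Proof.
by move=> w; rewrite /word_inv map_rev revK -map_comp map_id_in// => l _; apply: inv_letterK.
Qed.

Lemma word_mulVw w : reduced_word w -> word_mul (word_inv w) w = [::].
Proof.
rewrite /word_mul /word_inv; elim: w => //= l w IH pw.
by rewrite rev_cons foldr_rcons /= inv_letterK eqxx IH//; apply: path_sorted pw.
Qed.

Record freeGroup := FreeGroup { fg_word : seq fg_letter; _ : reduced_word fg_word }.
HB.instance Definition _ := [isSub for fg_word].
HB.instance Definition _ := [Choice of freeGroup by <:].

Definition fg_mul (u v : freeGroup) := FreeGroup (word_mul_reduced (val u) (valP v)).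
Definition fg_one := @FreeGroup [::] isT.
Definition fg_inv (u : freeGroup) := FreeGroup (word_inv_reduced (valP u)).

Lemma fg_mulA : associative fg_mul.
Proof. by move=> u v w; apply: val_inj; rewrite /= word_mulA ?valP. Qed.
Lemma fg_mul1w : left_id fg_one fg_mul.
Proof. by move=> u; apply: val_inj. Qed.
Lemma fg_mulw1 : right_id fg_one fg_mul.
Proof. by move=> u; apply: val_inj; apply: word_mulw1 (valP u). Qed.
Lemma fg_mulVw : left_inverse fg_one fg_inv fg_mul.
Proof. by move=> u; apply: val_inj; apply: word_mulVw (valP u). Qed.
Lemma fg_mulwV : right_inverse fg_one fg_inv fg_mul.
Proof.
move=> u; have {1}<- : fg_inv (fg_inv u) = u.
  by apply: val_inj; apply: word_invK.
exact: fg_mulVw.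
Qed.

HB.instance Definition _ :=
  isGroup.Build freeGroup fg_mulA fg_mul1w fg_mulw1 fg_mulVw fg_mulwV.

Definition fg_gen (x : X) : freeGroup := @FreeGroup [:: (x, false)] isT.

Section Lift.
Variables (H : groupType) (f : X -> H).
Local Open Scope group_scope.

Definition eval_letter l : H := if l.2 then (f l.1)^-1 else f l.1.

Definition fg_lift_fun (w : freeGroup) : H := \prod_(l <- val w) eval_letter l.

Lemma eval_inv_letter l : eval_letter (inv_letter l) = (eval_letter l)^-1.
Proof. by case: l => x [] /=; rewrite /eval_letter /= ?invgK. Qed.

Lemma eval_cons_reduce l (w : seq fg_letter) :
  \prod_(k <- cons_reduce l w) eval_letter k
  = eval_letter l * \prod_(k <- w) eval_letter k.
Proof.
case: w => [|l' w]; first by rewrite big_seq1 big_nil mulg1.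
rewrite [cons_reduce _ _]/=; case: eqP => [->|_]; last by rewrite big_cons.
by rewrite big_cons eval_inv_letter mulVKg.
Qed.

Lemma fg_lift_fun_mul : {morph fg_lift_fun : u v / u * v}.
Proof.
move=> u v; rewrite /fg_lift_fun.
change (val (u * v)) with (word_mul (val u) (val v)); rewrite /word_mul.
elim: (val u) => [|l w IH] /=; first by rewrite big_nil mul1g.
by rewrite eval_cons_reduce IH big_cons mulgA.
Qed.
HB.instance Definition _ := isMultiplicative.Build freeGroup H
  fg_lift_fun fg_lift_fun_mul.

Definition fg_lift : {multiplicative freeGroup -> H} := fg_lift_fun.

Lemma fg_lift_gen x : fg_lift (fg_gen x) = f x.
Proof. by rewrite /fg_lift /= /fg_lift_fun /= big_seq1. Qed.

End Lift.

Lemma fg_ind (P : freeGroup -> Prop) : P 1%g ->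
  (forall x w, P w -> P (fg_gen x * w)%g) ->
  (forall x w, P w -> P ((fg_gen x)^-1 * w)%g) -> forall w, P w.
Proof.
move=> P1 Pg Pv [w rw]; elim: w rw => [|l w IH] rlw.
  by rewrite (_ : FreeGroup _ = 1%g)//; apply: val_inj.
have rw : reduced_word w by apply: path_sorted rlw.
have E : word_mul [:: l] w = l :: w.
  by case: (w) rlw => //= l' w' /andP[/negbTE ->].
have := IH rw; case: l rlw E => x [] rlw E Pw.
  rewrite (_ : FreeGroup _ = (fg_gen x)^-1 * FreeGroup rw)%g; first exact: Pv.
  by apply: val_inj; rewrite -[LHS]E.
rewrite (_ : FreeGroup _ = fg_gen x * FreeGroup rw)%g; first exact: Pg.
by apply: val_inj; rewrite -[LHS]E.
Qed.

End FreeGroup.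

Section MultiplicativeTheory.
Variables (G H : groupType) (f : {multiplicative G -> H}).

Lemma mult1 : f 1%g = 1%g.
Proof. by apply: (mulgI (f 1%g)); rewrite -gmulfM !mulg1. Qed.

Lemma multV x : f x^-1%g = (f x)^-1%g.
Proof. by apply: (mulgI (f x)); rewrite -gmulfM !mulgV mult1. Qed.

End MultiplicativeTheory.

Lemma fg_ext (X : choiceType) (H : groupType)
    (f g : {multiplicative freeGroup X -> H}) :
  (forall x, f (fg_gen x) = g (fg_gen x)) -> f =1 g.
Proof.
move=> e; elim/fg_ind => [|x w IH|x w IH]; first by rewrite !mult1.
  by rewrite !gmulfM e IH.
by rewrite !gmulfM !multV e IH.
Qed.

Section Aut.
Variable G : groupType.

Record aut := MkAut {
  aut_fun :> {multiplicative G -> G};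
  aut_inv : {multiplicative G -> G};
  autK : cancel aut_fun aut_inv;
  autVK : cancel aut_inv aut_fun }.

HB.instance Definition _ := gen_eqMixin aut.
HB.instance Definition _ := gen_choiceMixin aut.

Lemma mult_eq (f g : {multiplicative G -> G}) : f =1 g -> f = g.
Proof.
case: f g => [f [[hf]]] [g [[hg]]] /= /funext e; subst g.
by rewrite (Prop_irrelevance hf hg).
Qed.

Lemma autP (a b : aut) : a =1 b -> a = b.
Proof.
move=> e; have ei : aut_inv a =1 aut_inv b.
  by move=> x; rewrite -{1}(autVK b x) -e autK.
move: (mult_eq e) (mult_eq ei); case: a b {e ei} => [f fi fK fVK] [g gi gK gVK] /=.
move=> ? ?; subst g gi.
by rewrite (Prop_irrelevance fK gK) (Prop_irrelevance fVK gVK).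
Qed.

Definition aut_mul (a b : aut) : aut :=
  @MkAut (a \o b) (aut_inv b \o aut_inv a)
    (can_comp (autK a) (autK b)) (can_comp (autVK b) (autVK a)).
Definition aut_one : aut := @MkAut idfun idfun (frefl _) (frefl _).
Definition aut_invg (a : aut) : aut := MkAut (autVK a) (autK a).

Lemma aut_mulA : associative aut_mul. Proof. by move=> a b c; apply: autP. Qed.
Lemma aut_mul1 : left_id aut_one aut_mul. Proof. by move=> a; apply: autP. Qed.
Lemma aut_mulr1 : right_id aut_one aut_mul. Proof. by move=> a; apply: autP. Qed.
Lemma aut_mulV : left_inverse aut_one aut_invg aut_mul.
Proof. by move=> a; apply: autP => x /=; rewrite autK. Qed.
Lemma aut_mulrV : right_inverse aut_one aut_invg aut_mul.
Proof. by move=> a; apply: autP => x /=; rewrite autVK. Qed.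

HB.instance Definition _ :=
  isGroup.Build aut aut_mulA aut_mul1 aut_mulr1 aut_mulV aut_mulrV.

End Aut.

Record gmodule (G : groupType) := GModule {
  gmod_obj :> zmodType;
  gact : G -> {additive gmod_obj -> gmod_obj};
  gact1 : forall x, gact 1%g x = x;
  gactM : forall g h x, gact (g * h)%g x = gact g (gact h x) }.

Section Homology.
Variables (G : groupType) (M : gmodule G).

(** The bar complex computing [Tor^{ZG}(Z, M)] in degrees 2, 1, 0; the left
    module [M] is made a right module by [x g := g^-1 x], so that
    [d (x [g]) = x g - x] and [d (x [g|h]) = (x g) [h] - x [gh] + x [g]]. *)
Definition bar1 : zmodType := @dsum G (fun=> M).
Definition bar2 : zmodType := @dsum (G * G)%type (fun=> M).

Definition bar1_inj (g : G) : {additive M -> bar1} := @dsum_inj G (fun=> M) g.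
Definition bar2_inj (p : G * G) : {additive M -> bar2} :=
  @dsum_inj (G * G)%type (fun=> M) p.

Definition bar_d1 : {additive bar1 -> M} :=
  dsum_lift (fun g : G => gact M g^-1%g \- idfun : {additive M -> M}).

Definition bar_d2 : {additive bar2 -> bar1} :=
  dsum_lift (fun p : G * G =>
    (bar1_inj p.2 \o gact M p.1^-1%g) \- bar1_inj (p.1 * p.2)%g \+ bar1_inj p.1
    : {additive M -> bar1}).

Lemma bar_d1E g x : bar_d1 (bar1_inj g x) = gact M g^-1%g x - x.
Proof. exact: dsum_lift_inj. Qed.

Lemma bar_d2E g h x : bar_d2 (bar2_inj (g, h) x)
  = bar1_inj h (gact M g^-1%g x) - bar1_inj (g * h)%g x + bar1_inj g x.
Proof. exact: dsum_lift_inj. Qed.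

Lemma bar_d1_d2 z : bar_d1 (bar_d2 z) = 0.
Proof.
apply: (dsum_ext (f := bar_d1 \o bar_d2) (g := \0)) => -[g h] x /=.
rewrite bar_d2E raddfD raddfB !bar_d1E invgM gactM.
by rewrite opprB [X in X + _]addrC !subrKA subrr.
Qed.

Definition bar_boundary : set (kernel bar_d1) :=
  [set z | exists c : bar2, val z = bar_d2 c].

Definition H1 : zmodType := quot bar_boundary.

End Homology.

Section HomologyMap.
Variables (G G' : groupType) (M : gmodule G) (M' : gmodule G').
Variables (a : {multiplicative G -> G'}) (f : {additive M -> M'}).
Hypothesis fa : forall g x, f (gact M g x) = gact M' (a g) (f x).

Definition bar1_map : {additive bar1 M -> bar1 M'} :=
  dsum_lift (fun g : G => bar1_inj M' (a g) \o f).
Definition bar2_map : {additive bar2 M -> bar2 M'} :=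
  dsum_lift (fun p : G * G => bar2_inj M' (a p.1, a p.2) \o f).

Lemma bar1_mapE g x : bar1_map (bar1_inj M g x) = bar1_inj M' (a g) (f x).
Proof. exact: dsum_lift_inj. Qed.
Lemma bar2_mapE g h x :
  bar2_map (bar2_inj M (g, h) x) = bar2_inj M' (a g, a h) (f x).
Proof. exact: dsum_lift_inj. Qed.

Lemma bar1_map_d z : bar_d1 M' (bar1_map z) = f (bar_d1 M z).
Proof.
apply: (dsum_ext (f := bar_d1 M' \o bar1_map) (g := f \o bar_d1 M)) => g x /=.
by rewrite bar1_mapE !bar_d1E raddfB fa multV.
Qed.

Lemma bar2_map_d z : bar_d2 M' (bar2_map z) = bar1_map (bar_d2 M z).
Proof.
apply: (dsum_ext (f := bar_d2 M' \o bar2_map) (g := bar1_map \o bar_d2 M)).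
move=> [g h] x /=.
by rewrite bar2_mapE !bar_d2E raddfD raddfB !bar1_mapE fa multV gmulfM.
Qed.

Lemma cycle_map_subproof (z : kernel (bar_d1 M)) :
  bar_d1 M' (bar1_map (val z)) == 0.
Proof. by rewrite bar1_map_d kernelP raddf0. Qed.

Definition cycle_map_fun (z : kernel (bar_d1 M)) : kernel (bar_d1 M') :=
  Kernel (cycle_map_subproof z).
Lemma cycle_map_is_zmod_morphism : zmod_morphism cycle_map_fun.
Proof. by move=> x y; apply: val_inj; rewrite /= !raddfB. Qed.
HB.instance Definition _ := GRing.isZmodMorphism.Build _ _ cycle_map_fun
  cycle_map_is_zmod_morphism.

Lemma H1_map_subproof z : bar_boundary z ->
  subgroup_gen (@bar_boundary G' M') (cycle_map_fun z).
Proof.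
move=> [c zc]; apply: subgroup_gen_in; exists (bar2_map c).
by rewrite bar2_map_d -zc.
Qed.

Definition H1_map : {additive H1 M -> H1 M'} := quot_map H1_map_subproof.

End HomologyMap.

Definition autF (n : nat) : groupType := aut (freeGroup 'I_n).

Section Abelianization.
Variable n : nat.
Implicit Types (w : freeGroup 'I_n) (a b : autF n).

Definition abelianize w : 'rV[int]_n :=
  \sum_(l <- val w) (if l.2 then - delta_mx 0 l.1 else delta_mx 0 l.1).

Lemma abelianize_gen i : abelianize (fg_gen i) = delta_mx 0 i.
Proof. by rewrite /abelianize big_seq1. Qed.

Lemma abelianizeM : {morph abelianize : u v / (u * v)%g >-> u + v}.
Proof.
move=> u v; rewrite /abelianize.
change (val (u * v)%g) with (word_mul (val u) (val v)); rewrite /word_mul.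
elim: (val u) => [|l w IH] /=; first by rewrite big_nil add0r.
rewrite big_cons -addrA -IH; case: (foldr _ _ _) => [|l' w'] /=.
  by rewrite big_seq1 big_nil addr0.
case: eqP => [->|_]; last by rewrite big_cons.
by rewrite big_cons /=; case: l.2; rewrite /= ?addKr ?addNKr.
Qed.

Lemma abelianize1 : abelianize 1%g = 0.
Proof. by rewrite /abelianize big_nil. Qed.

Lemma abelianizeV w : abelianize w^-1%g = - abelianize w.
Proof. by apply/eqP; rewrite -addr_eq0 -abelianizeM mulVg abelianize1. Qed.

(** The matrix, acting on row vectors from the right, of the automorphism of
    [Z^n] induced by [a]. *)
Definition aut_mx a : 'M[int]_n := \matrix_(i < n) abelianize (a (fg_gen i)).

Lemma aut_mxE a w : abelianize (a w) = abelianize w *m aut_mx a.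
Proof.
elim/fg_ind: w => [|i w IH|i w IH]; first by rewrite mult1 abelianize1 mul0mx.
  by rewrite gmulfM !abelianizeM IH mulmxDl abelianize_gen -rowE rowK.
rewrite gmulfM !abelianizeM multV !abelianizeV IH mulmxDl mulNmx.
by rewrite abelianize_gen -rowE rowK.
Qed.

Lemma aut_mx1 : aut_mx 1%g = 1%:M.
Proof. by apply/row_matrixP => i; rewrite rowK abelianize_gen row1. Qed.

Lemma aut_mxM a b : aut_mx (a * b)%g = aut_mx b *m aut_mx a.
Proof. by apply/row_matrixP => i; rewrite row_mul !rowK -aut_mxE. Qed.

Lemma aut_mx_unit a : aut_mx a \in unitmx.
Proof.
have [] // := mulmx1_unit (A := aut_mx a) (B := aut_mx a^-1%g).
by rewrite -aut_mxM mulVg aut_mx1.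
Qed.

Lemma aut_mxV a : aut_mx a^-1%g = invmx (aut_mx a).
Proof.
apply: (can_inj (mulmxK (aut_mx_unit a))).
by rewrite mulVmx ?aut_mx_unit// -aut_mxM mulgV aut_mx1.
Qed.

(** The image of [a] under [Aut(Z^{*n}) -> GL_n(Z)], as an endomorphism of [Z^n]. *)
Definition aut_ab a : {additive 'rV[int]_n -> 'rV[int]_n} := mulmxr (aut_mx a).

Lemma aut_abM a b : aut_ab (a * b)%g = aut_ab a \o aut_ab b.
Proof. by apply: additive_eq => v /=; rewrite aut_mxM mulmxA. Qed.

Lemma aut_ab1 : aut_ab 1%g = idfun.
Proof. by apply: additive_eq => v /=; rewrite aut_mx1 mulmx1. Qed.

Variable F : contraFunctor.

Lemma autF_act1 (x : F 'rV[int]_n) : contra_map F (aut_ab (1 : autF n)^-1%g) x = x.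
Proof. by rewrite invg1 aut_ab1 contra_id. Qed.

Lemma autF_actM a b (x : F 'rV[int]_n) :
  contra_map F (aut_ab (a * b)^-1%g) x
  = contra_map F (aut_ab a^-1%g) (contra_map F (aut_ab b^-1%g) x).
Proof. by rewrite invgM aut_abM contra_comp. Qed.

Definition autF_module : gmodule (autF n) := GModule autF_act1 autF_actM.

End Abelianization.

Section Stabilization.
Variable n : nat.

(** [lift ord_max] embeds ['I_n] in ['I_n.+1] as the first [n] indices. *)
Definition fg_incl : {multiplicative freeGroup 'I_n -> freeGroup 'I_n.+1} :=
  fg_lift (fun i => fg_gen (lift ord_max i)).

(** [f * id_Z], the last generator being fixed. *)
Definition fg_free_id (f : {multiplicative freeGroup 'I_n -> freeGroup 'I_n}) :
    {multiplicative freeGroup 'I_n.+1 -> freeGroup 'I_n.+1} :=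
  fg_lift (fun i => if unlift ord_max i is Some j then fg_incl (f (fg_gen j))
                    else fg_gen ord_max).

Lemma fg_free_id_incl f w : fg_free_id f (fg_incl w) = fg_incl (f w).
Proof.
apply: (fg_ext (f := fg_free_id f \o fg_incl) (g := fg_incl \o f)) => i /=.
by rewrite /fg_incl fg_lift_gen /fg_free_id fg_lift_gen liftK.
Qed.

Lemma fg_free_id_last f : fg_free_id f (fg_gen ord_max) = fg_gen ord_max.
Proof. by rewrite /fg_free_id fg_lift_gen unlift_none. Qed.

Lemma fg_ext_stab (H : groupType) (f g : {multiplicative freeGroup 'I_n.+1 -> H}) :
  (forall w, f (fg_incl w) = g (fg_incl w)) ->
  f (fg_gen ord_max) = g (fg_gen ord_max) -> f =1 g.
Proof.
move=> e em; apply: fg_ext => i; case: (unliftP ord_max i) => [j ->|-> //].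
by have := e (fg_gen j); rewrite /fg_incl fg_lift_gen.
Qed.

Lemma fg_free_idM (f g : {multiplicative freeGroup 'I_n -> freeGroup 'I_n}) :
  fg_free_id (f \o g) =1 fg_free_id f \o fg_free_id g.
Proof.
apply: (fg_ext_stab (g := fg_free_id f \o fg_free_id g)) => [w|].
  apply: etrans (fg_free_id_incl _ w) (esym _).
  exact: etrans (congr1 _ (fg_free_id_incl g w)) (fg_free_id_incl f _).
apply: etrans (fg_free_id_last _) (esym _).
exact: etrans (congr1 _ (fg_free_id_last g)) (fg_free_id_last f).
Qed.

Lemma fg_free_idK (f g : {multiplicative freeGroup 'I_n -> freeGroup 'I_n}) :
  cancel f g -> cancel (fg_free_id f) (fg_free_id g).
Proof.
move=> fK; apply: (fg_ext_stab (f := fg_free_id g \o fg_free_id f) (g := idfun)).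
  move=> w; apply: etrans (congr1 _ (fg_free_id_incl f w)) _.
  by rewrite fg_free_id_incl fK.
exact: etrans (congr1 _ (fg_free_id_last f)) (fg_free_id_last g).
Qed.

Definition aut_stab_fun (a : autF n) : autF n.+1 :=
  MkAut (fg_free_idK (autK a)) (fg_free_idK (autVK a)).

Lemma aut_stabM : {morph aut_stab_fun : a b / (a * b)%g}.
Proof. by move=> a b; apply: autP => w; exact: fg_free_idM. Qed.
HB.instance Definition _ := isMultiplicative.Build (autF n) (autF n.+1)
  aut_stab_fun aut_stabM.

Definition aut_stab : {multiplicative autF n -> autF n.+1} := aut_stab_fun.

(** Removing column [ord_max] keeps the first [n] coordinates. *)
Definition proj_first : {additive 'rV[int]_n.+1 -> 'rV[int]_n} := col' ord_max.

Lemma proj_first_incl w : proj_first (abelianize (fg_incl w)) = abelianize w.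
Proof.
have incl_gen i : fg_incl (fg_gen i) = fg_gen (lift ord_max i).
  by rewrite /fg_incl fg_lift_gen.
have proj_gen i : proj_first (delta_mx 0 (lift ord_max i)) = delta_mx 0 i.
  by apply/rowP => j; rewrite !mxE (inj_eq (@lift_inj _ _)).
elim/fg_ind: w => [|i w IH|i w IH]; first by rewrite mult1 !abelianize1 raddf0.
  by rewrite gmulfM !abelianizeM raddfD IH incl_gen !abelianize_gen proj_gen.
rewrite gmulfM !abelianizeM raddfD IH multV incl_gen !abelianizeV raddfN.
by rewrite !abelianize_gen proj_gen.
Qed.

Lemma proj_first_stab (a : autF n) v :
  proj_first (aut_ab (aut_stab a) v) = aut_ab a (proj_first v).
Proof.
rewrite [v]row_sum_delta !raddf_sum; apply: eq_bigr => i _.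
rewrite -[X in X *: _]intz !scaler_int !raddfMz; congr (_ *~ _).
rewrite -abelianize_gen.
change (proj_first (abelianize (fg_gen i) *m aut_mx (aut_stab a))
        = proj_first (abelianize (fg_gen i)) *m aut_mx a).
rewrite -aut_mxE.
case: (unliftP ord_max i) => [j ->|->].
  have -> : fg_gen (lift ord_max j) = fg_incl (fg_gen j).
    by rewrite /fg_incl fg_lift_gen.
  by rewrite [aut_stab a _]fg_free_id_incl !proj_first_incl -aut_mxE.
rewrite [aut_stab a _]fg_free_id_last.
suff -> : proj_first (abelianize (fg_gen ord_max)) = 0 by rewrite mul0mx.
by apply/rowP => j; rewrite abelianize_gen !mxE eq_sym (negbTE (neq_lift _ _)) andbF.
Qed.

Variable F : contraFunctor.

Lemma stab_equivariant (a : autF n) (x : F 'rV[int]_n) :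
  contra_map F proj_first (gact (autF_module n F) a x)
  = gact (autF_module n.+1 F) (aut_stab a) (contra_map F proj_first x).
Proof.
rewrite /= -!contra_comp -multV; congr (contra_map F _ x).
by apply: additive_eq => v; exact: esym (proj_first_stab _ _).
Qed.

Definition H1_stab :
    {additive H1 (autF_module n F) -> H1 (autF_module n.+1 F)} :=
  @H1_map _ _ (autF_module n F) (autF_module n.+1 F)
    aut_stab (contra_map F proj_first) stab_equivariant.

End Stabilization.

Definition stable_H1 (F : contraFunctor) : zmodType :=
  seqcolim (fun n => H1_stab n F).

Section StableMap.
Variables (F F' : contraFunctor) (eta : contraNat F F').

Lemma autF_nat_equivariant n (a : autF n) (x : F 'rV[int]_n) :
  eta _ (gact (autF_module n F) a x) = gact (autF_module n F') a (eta _ x).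
Proof. exact: nat_natural. Qed.

Definition autF_H1_map n :
    {additive H1 (autF_module n F) -> H1 (autF_module n F')} :=
  @H1_map _ _ (autF_module n F) (autF_module n F')
    idfun (eta _) (@autF_nat_equivariant n).

Lemma bar1_map_nat_stab n (z : bar1 (autF_module n F)) :
  @bar1_map _ _ (autF_module n.+1 F) (autF_module n.+1 F') idfun (eta _)
    (@bar1_map _ _ (autF_module n F) (autF_module n.+1 F) (aut_stab n)
       (contra_map F (proj_first n)) z)
  = @bar1_map _ _ (autF_module n F') (autF_module n.+1 F') (aut_stab n)
      (contra_map F' (proj_first n))
      (@bar1_map _ _ (autF_module n F) (autF_module n F') idfun (eta _) z).
Proof.
set B := @bar1_map _ _ (autF_module n F) (autF_module n.+1 F) _ _.
set D := @bar1_map _ _ (autF_module n F) (autF_module n F') _ _.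
set A := @bar1_map _ _ (autF_module n.+1 F) _ _ _.
set C := @bar1_map _ _ (autF_module n F') _ _ _.
apply: (dsum_ext (V := fun=> F 'rV[int]_n) (f := A \o B) (g := C \o D)) => g y.
change (A (B (bar1_inj (autF_module n F) g y))
        = C (D (bar1_inj (autF_module n F) g y))).
by rewrite /A /B /C /D !bar1_mapE nat_natural.
Qed.

Lemma autF_H1_map_stab n (x : H1 (autF_module n F)) :
  autF_H1_map n.+1 (H1_stab n F x) = H1_stab n F' (autF_H1_map n x).
Proof.
rewrite -(quot_piK x) /autF_H1_map /H1_stab /H1_map !quot_mapE.
by congr (quot_pi _ _); apply: val_inj; exact: bar1_map_nat_stab.
Qed.

Definition stable_H1_map : {additive stable_H1 F -> stable_H1 F'} :=
  seqcolim_map autF_H1_map_stab.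

End StableMap.

(* Main.v *)
(** The comparison map sends a 1-chain [x [g]] to [x (x) k(g)], where [k] is the
    crossed homomorphism from [Aut(F_n)] to [Z^n] given by the determinant of the
    abelianized Fox Jacobian modulo the square of the augmentation ideal. Conversely
    [x (x) v] is sent to the class of [x [c]], where [c] conjugates a new letter by a
    word lifting [v]; polynomiality, applied to the projections of many copies of
    [Z^n], shows that such a class only depends on the restriction of [x] along [v].

    It remains to see that these classes exhaust the stable homology. Let [g] act
    diagonally on [m] copies of its letters. The alternating sum over the subsets
    [S] of [m] of the maps induced by the sum of the projections in [S] vanishes.
    For nonempty [S], a shear between the copies compares the diagonal action with
    the action on a single copy, and so identifies the [S]-term with the given
    cycle up to a defect. The defect is multiplicative in [g] and is a conjugation
    class when [g] is elementary. Finally, every automorphism becomes a product of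
    elementary ones after adding letters, by Stallings' folding of labelled graphs,
    whose vertices are encoded by the extra letters. *)
From HB Require Import structures.
From mathcomp Require Import all_boot all_order all_algebra fingroup perm.
From mathcomp Require Import boolp classical_sets.
From mathcomp Require Import fintype finset.
Require Import Defs.

Set Implicit Arguments.
Unset Strict Implicit.
Unset Printing Implicit Defensive.

Import GRing.Theory.

Local Open Scope ring_scope.

(** * Lattices and polynomial functors *)

(** Homology is replaced by the cokernel [barcoker] of the boundary from degree 2, in which $H_1$ is
    the kernel of [cbd]. A single symbol [bsym g x] is usually not a cycle, so a cycle written in
    elementary automorphisms cannot be treated term by term: renaming the letters is harmless for
    cycles only, since conjugation by [h] adds the term [bsym h (cbd d)]. The defect removes this
    obstacle. [defect g] fixes every coefficient pulled back from the block [s], so each symbol of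
    [defect_map] is a cycle by itself and can be evaluated for one elementary factor at a time; the
    other correction term depends on [cbd] only and dies on cycles. The term of the empty set
    vanishes because [F] is reduced, which leaves the given cycle as a combination of defects.

    Injectivity then rests on one computation: the crossed homomorphism takes the conjugation of one
    letter by another to the basis vector of the conjugating letter. *)

Section Lattice.
Variable X : finType.

(** Arbitrary finite sets of letters are allowed, so that copies and disjoint unions of letters need
    no renumbering. *)
Definition zlat := {ffun X -> int}.
HB.instance Definition _ := GRing.Zmodule.on zlat.

Definition zgen (x : X) : zlat := [ffun y => (x == y)%:Z].

Definition zlift_fun (A : zmodType) (f : X -> A) (v : zlat) : A :=
  \sum_x f x *~ v x.

Lemma zlift_is_zmod_morphism (A : zmodType) f : zmod_morphism (@zlift_fun A f).
Proof. by move=> u v; rewrite -sumrB; apply: eq_bigr => x _; rewrite !ffunE mulrzBr. Qed.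
HB.instance Definition _ (A : zmodType) f :=
  GRing.isZmodMorphism.Build zlat A (@zlift_fun A f) (@zlift_is_zmod_morphism A f).

Definition zlift (A : zmodType) f : {additive zlat -> A} := @zlift_fun A f.

Lemma zlift_gen (A : zmodType) (f : X -> A) x : zlift f (zgen x) = f x.
Proof.
rewrite /zlift [LHS]/= /zlift_fun (bigD1 x)//= ffunE eqxx big1 ?addr0// => y yx.
by rewrite ffunE eq_sym (negbTE yx).
Qed.

Lemma zlift_sum (A : zmodType) (I : finType) (S : {set I}) (f g : X -> A)
    (b : I -> X -> A) v : (forall x, f x = g x + \sum_(i in S) b i x) ->
  zlift f v = zlift g v + \sum_(i in S) zlift (b i) v.
Proof.
move=> fE; rewrite exchange_big/= -big_split/=; apply: eq_bigr => x _.
by rewrite fE mulrzDl -mulrz_suml.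
Qed.

Lemma zlatE (v : zlat) : v = \sum_x zgen x *~ v x.
Proof.
have h (y z : X) : (zgen z *~ v z) y = (z == y)%:Z *~ v z.
  have c_is_add : zmod_morphism (fun u : zlat => u y) by move=> u w; rewrite !ffunE.
  pose c : {additive zlat -> int} :=
    HB.pack (fun u : zlat => u y) (GRing.isZmodMorphism.Build zlat int _ c_is_add).
  by rewrite -[LHS]/(c _) raddfMz /= ffunE.
apply/ffunP => y; rewrite sum_ffunE (bigD1 y)//= h eqxx big1 => [|z /negbTE zy].
  by rewrite addr0 intz.
by rewrite h zy mul0rz.
Qed.

Lemma zlat_ext (A : zmodType) (f g : {additive zlat -> A}) :
  (forall x, f (zgen x) = g (zgen x)) -> f =1 g.
Proof. by move=> e v; rewrite (zlatE v) !raddf_sum; apply: eq_bigr => x _; rewrite !raddfMz e. Qed.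

Lemma zlat_freeAb_basis : exists (J : finType) (b : J -> zlat), forall a : zlat,
    exists! c : {ffun J -> int}, a = \sum_(j : J) b j *~ c j.
Proof.
exists X, zgen => a; exists a; split=> [|c ->]; first exact: zlatE.
by rewrite -zlatE.
Qed.
HB.instance Definition _ := isFreeAb.Build zlat zlat_freeAb_basis.

End Lattice.

Global Opaque zlift.

Section FreeGroupAb.
Variable X : finType.
Implicit Types u v w : freeGroup X.

Definition fg_ab w : zlat X :=
  \sum_(l <- val w) (if l.2 then - zgen l.1 else zgen l.1).

Lemma fg_ab_gen i : fg_ab (fg_gen i) = zgen i.
Proof. by rewrite /fg_ab big_seq1. Qed.

Lemma fg_abM u v : fg_ab (u * v)%g = fg_ab u + fg_ab v.
Proof.
rewrite /fg_ab.
change (val (u * v)%g) with (word_mul (val u) (val v)); rewrite /word_mul.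
elim: (val u) => [|l w IH] /=; first by rewrite big_nil add0r.
rewrite big_cons -addrA -IH; case: (foldr _ _ _) => [|l' w'] /=.
  by rewrite big_seq1 big_nil addr0.
case: eqP => [->|_]; last by rewrite big_cons.
by rewrite big_cons /=; case: l.2; rewrite /= ?addKr ?addNKr.
Qed.

Lemma fg_ab1 : fg_ab 1%g = 0.
Proof. by rewrite /fg_ab big_nil. Qed.

Lemma fg_abV w : fg_ab w^-1%g = - fg_ab w.
Proof. by apply/eqP; rewrite -addr_eq0 -fg_abM mulVg fg_ab1. Qed.

Definition fg_abE := (fg_abM, fg_abV, fg_ab1, fg_ab_gen).

(** Homomorphisms to an abelian group are determined on letters. [g] is a bare function because its
    source is written multiplicatively and its target additively. *)
Lemma fg_ab_natural (A : zmodType) (f : {additive zlat X -> A}) (g : freeGroup X -> A) :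
  {morph g : u v / (u * v)%g >-> u + v} ->
  (forall x, f (zgen x) = g (fg_gen x)) -> forall w, f (fg_ab w) = g w.
Proof.
move=> gM fg; have g1 : g 1%g = 0 by apply: (addrI (g 1%g)); rewrite -gM mulg1 addr0.
have gV w : g w^-1%g = - g w by apply/eqP; rewrite -addr_eq0 -gM mulVg g1.
elim/fg_ind => [|x w IH|x w IH]; rewrite ?fg_abE ?raddf0 ?g1// gM ?gV raddfD IH.
  by rewrite -fg.
by rewrite raddfN fg.
Qed.

End FreeGroupAb.

Section FreeGroupHom.
Variables X Y Z : finType.

Definition ab_map (f : {multiplicative freeGroup X -> freeGroup Y}) :
  {additive zlat X -> zlat Y} := zlift (fun x => fg_ab (f (fg_gen x))).

Lemma ab_map_gen f x : ab_map f (zgen x) = fg_ab (f (fg_gen x)).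
Proof. exact: zlift_gen. Qed.

Lemma ab_mapE f w : ab_map f (fg_ab w) = fg_ab (f w).
Proof.
apply: (fg_ab_natural (g := fun w => fg_ab (f w))) w => [u v|x]; last exact: zlift_gen.
by rewrite gmulfM fg_abM.
Qed.

End FreeGroupHom.

Global Opaque ab_map.

Lemma ab_map_comp (X Y Z : finType) (f : {multiplicative freeGroup Y -> freeGroup Z})
    (g : {multiplicative freeGroup X -> freeGroup Y}) :
  ab_map f \o ab_map g =1 ab_map (f \o g).
Proof.
move=> v; apply: (zlat_ext (f := ab_map f \o ab_map g) (g := ab_map (f \o g))) => x /=.
by rewrite !ab_map_gen ab_mapE.
Qed.

Lemma ab_map_id (X : finType) : ab_map (idfun : {multiplicative freeGroup X -> freeGroup X}) =1 id.
Proof. move=> v; apply: (zlat_ext (f := ab_map idfun) (g := idfun)) => x.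
by rewrite ab_map_gen fg_ab_gen. Qed.

Section Contra.
Variable F : contraFunctor.

Lemma contra_ext (A B : freeAbType) (f g : {additive A -> B}) (x : F B) :
  f =1 g -> contra_map F f x = contra_map F g x.
Proof. by move=> /additive_eq ->. Qed.

Lemma contra_zext (X : finType) (B : freeAbType) (f g : {additive zlat X -> B}) (x : F B) :
  (forall i, f (zgen i) = g (zgen i)) -> contra_map F f x = contra_map F g x.
Proof. by move=> e; apply: contra_ext; apply: zlat_ext. Qed.

Lemma contra_compE (A B C : freeAbType) (f : {additive A -> B}) (g : {additive B -> C})
    (h : {additive A -> C}) (x : F C) :
  g \o f =1 h -> contra_map F f (contra_map F g x) = contra_map F h x.
Proof. by move=> e; rewrite -contra_comp; apply: contra_ext. Qed.

Lemma contra_zcompE (X : finType) (B C : freeAbType) (f : {additive zlat X -> B})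
    (g : {additive B -> C}) (h : {additive zlat X -> C}) (x : F C) :
  (forall i, g (f (zgen i)) = h (zgen i)) ->
  contra_map F f (contra_map F g x) = contra_map F h x.
Proof. by move=> e; apply: contra_compE; apply: (zlat_ext (f := g \o f)). Qed.

Hypothesis rF : reduced_functor F.

(** The zero map factors through ['rV[int]_0], on which [F] vanishes. *)
Lemma reduced_zero (A B : freeAbType) (f : {additive A -> B}) (x : F B) :
  (forall v, f v = 0) -> contra_map F f x = 0.
Proof.
move=> f0; pose z0 : {additive A -> 'rV[int]_0} := \0.
rewrite -(contra_compE (f := z0) (g := (\0 : {additive 'rV[int]_0 -> B}))) => [|v].
  by rewrite (rF (contra_map F (\0 : {additive 'rV[int]_0 -> B}) x)) raddf0.
by rewrite f0.
Qed.

End Contra.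

(** Adding [i0] to a subset reverses the sign and keeps the value, so the subsets cancel in
    pairs. *)
Lemma sum_sign_sets (m : nat) (i0 : 'I_m) (V : zmodType) (f : {set 'I_m} -> V) :
  (forall S, f (i0 |: S) = f (S :\ i0)) -> \sum_(S : {set 'I_m}) f S *~ (-1) ^+ #|S| = 0.
Proof.
move=> fi; rewrite (bigID (fun S : {set 'I_m} => i0 \in S))/=.
rewrite (reindex_onto (fun S : {set 'I_m} => i0 |: S) (fun S => S :\ i0))/=; last first.
  by move=> S iS; rewrite setD1K.
rewrite (eq_bigl (fun S : {set 'I_m} => i0 \notin S)); last first.
  move=> S; rewrite setU11 andTb; apply/eqP/idP => [<-|iS]; first by rewrite !inE eqxx.
  by rewrite setU1K.
rewrite -big_split/= big1// => S iS; rewrite cardsU1 iS/= exprS mulN1r mulrNz.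
by rewrite fi (setDidPl _) ?addNr// disjoint_sym disjoints1.
Qed.

(** The alternating sum comes from an element of the cross effect of the [m]-th
    power of [P]: when the [i]-th factor is omitted, the terms of [S] and of its
    symmetric difference with [{i}] cancel. This is not disturbed by [c], which is
    carried by the factor [0]. *)
Lemma polynomial_deviation (F : contraFunctor) (pF : polynomial_functor F) :
  exists2 m : nat, (0 < m)%N &
  forall (P Q : freeAbType) (c : {additive P -> Q}) (b : 'I_m -> {additive P -> Q})
    (q : {set 'I_m} -> {additive P -> Q}) (x : F Q),
  (forall S v, q S v = c v + \sum_(i in S) b i v) ->
  \sum_(S : {set 'I_m}) contra_map F (q S) x *~ (-1) ^+ #|S| = 0.
Proof.
case: pF => m m0 cr; exists m => // P Q c b q x qE.
pose i0 := Ordinal m0.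
pose D : zmodType := @dsum 'I_m (fun=> P).
pose al (S : {set 'I_m}) : {additive @dsum 'I_m (fun=> P) -> Q} :=
  dsum_lift (fun i => (if i == i0 then c else \0) \+ (if i \in S then b i else \0)
    : {additive P -> Q}).
have alE S i v : al S (dsum_inj (fun=> P) i v)
    = (if i == i0 then c v else 0) + (if i \in S then b i v else 0).
  by rewrite /al dsum_lift_inj /=; case: (i == i0); case: (i \in S).
clearbody al.
pose y := \sum_(S : {set 'I_m}) contra_map F (al S) x *~ (-1) ^+ #|S|.
have : y = 0.
  suff : @cross_effect F m (fun=> P) y by rewrite cr.
  move=> i; rewrite raddf_sum/=.
  under eq_bigr do rewrite raddfMz /=.
  apply: (sum_sign_sets (i0 := i)
    (f := fun S => contra_map F (omit_incl (fun=> P) i) (contra_map F (al S) x))) => S.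
  rewrite -!contra_comp; apply: contra_ext.
  apply: (dsum_ext (f := al (i |: S) \o omit_incl (fun=> P) i)
    (g := al (S :\ i) \o omit_incl (fun=> P) i)) => -[j ji] v.
  change (al (i |: S) (omit_incl (fun=> P) i (dsum_inj _ (exist _ j ji) v))
        = al (S :\ i) (omit_incl (fun=> P) i (dsum_inj _ (exist _ j ji) v))).
  by rewrite /omit_incl !dsum_lift_inj /= !alE !inE ji (negbTE ji).
(* [dl] is the diagonal of [P]; composing with it turns [al S] into [q S], so restricting [y = 0]
   along it gives the claim. *)
have dl_is_add : zmod_morphism (fun v => \sum_(i : 'I_m) dsum_inj (fun=> P) i v).
  by move=> u v; rewrite -sumrB; apply: eq_bigr => i _; rewrite raddfB.
pose dl : {additive P -> @dsum 'I_m (fun=> P)} :=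
  HB.pack (fun v => \sum_(i : 'I_m) dsum_inj (fun=> P) i v)
    (GRing.isZmodMorphism.Build P (@dsum 'I_m (fun=> P)) _ dl_is_add).
move=> /(congr1 (contra_map F dl)); rewrite raddf0 raddf_sum/= => e; apply: etrans e.
apply: eq_bigr => S _; rewrite raddfMz /=; congr (_ *~ _).
rewrite -contra_comp; apply: contra_ext => v; apply: esym.
rewrite [LHS]raddf_sum qE (eq_bigr _ (fun i _ => alE S i v)).
rewrite big_split/= -!big_mkcond/=; congr (_ + _).
by rewrite big_pred1_eq.
Qed.

(** * Chains modulo boundaries *)

Lemma autM_E (G : groupType) (a b : aut G) x : (a * b)%g x = a (b x).
Proof. by []. Qed.

Lemma autKg (G : groupType) (a : aut G) : cancel a a^-1%g.
Proof. by move=> x; rewrite -autM_E mulVg. Qed.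

Lemma autVKg (G : groupType) (a : aut G) : cancel a^-1%g a.
Proof. by move=> x; rewrite -autM_E mulgV. Qed.

Notation autfg X := (aut (freeGroup X)).

Section FreeGroupAut.
Variables (X : choiceType).
Implicit Types a b : autfg X.

Lemma aut_gen_ext a b : (forall x, a (fg_gen x) = b (fg_gen x)) -> a = b.
Proof. by move=> e; apply: autP; apply: fg_ext. Qed.

Variables (f g : X -> freeGroup X).
Hypothesis (fK : forall x, fg_lift g (f x) = fg_gen x).
Hypothesis (gK : forall x, fg_lift f (g x) = fg_gen x).

Lemma fg_lift_gensK (f' g' : X -> freeGroup X) :
  (forall x, fg_lift g' (f' x) = fg_gen x) -> cancel (fg_lift f') (fg_lift g').
Proof.
move=> h; apply: (fg_ext (f := fg_lift g' \o fg_lift f') (g := idfun)) => x.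
by apply: etrans (h x); congr (fg_lift g' _); exact: fg_lift_gen.
Qed.

Definition fg_aut : autfg X := MkAut (fg_lift_gensK fK) (fg_lift_gensK gK).

Lemma fg_autE x : fg_aut (fg_gen x) = f x.
Proof. exact: fg_lift_gen. Qed.

End FreeGroupAut.
Global Opaque aut_mul aut_invg aut_one.

Definition fg_map (X Y : choiceType) (s : X -> Y) :
  {multiplicative freeGroup X -> freeGroup Y} := fg_lift (fun x => fg_gen (s x)).

Lemma fg_map_gen (X Y : choiceType) (s : X -> Y) x : fg_map s (fg_gen x) = fg_gen (s x).
Proof. exact: fg_lift_gen. Qed.

Lemma fg_mapE (X Y : choiceType) (s : X -> Y) w :
  fg_map s w = (\prod_(l <- val w) eval_letter (fun x => fg_gen (s x)) l)%g.
Proof. by []. Qed.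

Lemma fg_incl_map n w : @fg_incl n w = fg_map (lift ord_max) w.
Proof. by []. Qed.

Lemma eq_fg_map (X Y : choiceType) (s t : X -> Y) : s =1 t -> fg_map s =1 fg_map t.
Proof.
by move=> e; apply: (fg_ext (f := fg_map s) (g := fg_map t)) => x; rewrite !fg_map_gen e.
Qed.

Lemma fg_map_comp (X Y Z : choiceType) (s : X -> Y) (t : Y -> Z) w :
  fg_map t (fg_map s w) = fg_map (t \o s) w.
Proof.
apply: (fg_ext (f := fg_map t \o fg_map s) (g := fg_map (t \o s))) => x.
by apply: etrans (congr1 _ (fg_map_gen s x)) _; rewrite !fg_map_gen.
Qed.

Global Opaque fg_map.

(** * Extension of automorphisms by the identity along an injection of letters *)

Section Extension.
Variables (X Y : finType) (s : X -> Y).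

(** Retraction killing the letters outside the image of [s]. As [F] is contravariant, coefficients
    are extended by pulling back along it. *)
Definition proj_inj : {additive zlat Y -> zlat X} :=
  zlift (fun y => if [pick x | s x == y] is Some x then zgen x else 0).

Definition ext_fun (f : {multiplicative freeGroup X -> freeGroup X}) :
    {multiplicative freeGroup Y -> freeGroup Y} :=
  fg_lift (fun y => if [pick x | s x == y] is Some x then fg_map s (f (fg_gen x))
                    else fg_gen y).

Hypothesis s_inj : injective s.

Lemma pick_inj x : [pick x' | s x' == s x] = Some x.
Proof. by case: pickP => [x' /eqP/s_inj -> //|/(_ x)]; rewrite eqxx. Qed.

Lemma pick_notin y : y \notin codom s -> [pick x | s x == y] = None.
Proof. by case: pickP => // x /eqP <-; rewrite codom_f. Qed.

Lemma proj_inj_gen x : proj_inj (zgen (s x)) = zgen x.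
Proof. by rewrite /proj_inj zlift_gen pick_inj. Qed.

Lemma proj_inj_notin y : y \notin codom s -> proj_inj (zgen y) = 0.
Proof. by move=> ?; rewrite /proj_inj zlift_gen pick_notin. Qed.

Lemma proj_inj_map w : proj_inj (fg_ab (fg_map s w)) = fg_ab w.
Proof.
rewrite -ab_mapE; move: (fg_ab w).
apply: (zlat_ext (f := proj_inj \o ab_map (fg_map s)) (g := idfun)) => x.
apply: etrans (congr1 _ (ab_map_gen _ x)) _.
by rewrite fg_map_gen fg_ab_gen proj_inj_gen.
Qed.

Lemma ext_fun_gen f x : ext_fun f (fg_gen (s x)) = fg_map s (f (fg_gen x)).
Proof. by rewrite /ext_fun fg_lift_gen pick_inj. Qed.

Lemma ext_fun_notin f y : y \notin codom s -> ext_fun f (fg_gen y) = fg_gen y.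
Proof. by move=> ?; rewrite /ext_fun fg_lift_gen pick_notin. Qed.

Lemma ext_fun_map f w : ext_fun f (fg_map s w) = fg_map s (f w).
Proof.
apply: (fg_ext (f := ext_fun f \o fg_map s) (g := fg_map s \o f)) => x.
by apply: etrans (congr1 _ (fg_map_gen s x)) _; rewrite ext_fun_gen.
Qed.

Lemma ext_funK (f g : {multiplicative freeGroup X -> freeGroup X}) : cancel f g -> cancel (ext_fun f) (ext_fun g).
Proof.
move=> fK; apply: (fg_ext (f := ext_fun g \o ext_fun f) (g := idfun)) => y.
have [/codomP[x ->]|ys] := boolP (y \in codom s).
  by apply: etrans (congr1 _ (ext_fun_gen f x)) _; rewrite ext_fun_map fK fg_map_gen.
by apply: etrans (congr1 _ (ext_fun_notin f ys)) _; rewrite ext_fun_notin.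
Qed.

Definition aut_ext (a : autfg X) : autfg Y :=
  MkAut (ext_funK (autK a)) (ext_funK (autVK a)).

Lemma aut_ext_gen (a : autfg X) x : aut_ext a (fg_gen (s x)) = fg_map s (a (fg_gen x)).
Proof. exact: ext_fun_gen. Qed.

Lemma aut_ext_notin (a : autfg X) y : y \notin codom s -> aut_ext a (fg_gen y) = fg_gen y.
Proof. exact: ext_fun_notin. Qed.

Lemma aut_ext_map (a : autfg X) w : aut_ext a (fg_map s w) = fg_map s (a w).
Proof. exact: ext_fun_map. Qed.

Lemma aut_extP (a : autfg X) (b : autfg Y) :
  (forall x, b (fg_gen (s x)) = fg_map s (a (fg_gen x))) ->
  (forall y, y \notin codom s -> b (fg_gen y) = fg_gen y) -> aut_ext a = b.
Proof.
move=> bs bn; apply: aut_gen_ext => y.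
have [/codomP[x ->]|ys] := boolP (y \in codom s); first by rewrite bs aut_ext_gen.
by rewrite bn// aut_ext_notin.
Qed.

Lemma aut_extM (a b : autfg X) : aut_ext (a * b)%g = (aut_ext a * aut_ext b)%g.
Proof.
apply: aut_extP => [x|y ys].
  by rewrite autM_E aut_ext_gen aut_ext_map.
by rewrite autM_E !aut_ext_notin.
Qed.

Lemma proj_inj_ext (a : autfg X) v : proj_inj (ab_map (aut_ext a) v) = ab_map a (proj_inj v).
Proof.
apply: (zlat_ext (f := proj_inj \o ab_map (aut_ext a)) (g := ab_map a \o proj_inj)) => y /=.
have [/codomP[x ->]|ys] := boolP (y \in codom s).
  by rewrite ab_map_gen aut_ext_gen proj_inj_map proj_inj_gen ab_map_gen.
by rewrite ab_map_gen aut_ext_notin// fg_ab_gen !proj_inj_notin ?raddf0.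
Qed.

End Extension.
Global Opaque proj_inj aut_ext.

Lemma aut_ext_comp (X Y Z : finType) (s : X -> Y) (t : Y -> Z) (si : injective s)
    (ti : injective t) (tsi : injective (t \o s)) (a : autfg X) :
  aut_ext ti (aut_ext si a) = aut_ext tsi a.
Proof.
apply/esym/aut_extP => [x|z zs].
  by rewrite aut_ext_gen aut_ext_gen fg_map_comp.
have [/codomP[y zy]|zt] := boolP (z \in codom t); last by rewrite aut_ext_notin.
rewrite zy aut_ext_gen aut_ext_notin ?fg_map_gen//.
by apply: contra zs => /codomP[x yx]; apply/codomP; exists x; rewrite zy yx.
Qed.

Lemma proj_inj_comp (X Y Z : finType) (s : X -> Y) (t : Y -> Z) (si : injective s)
    (ti : injective t) : proj_inj s \o proj_inj t =1 proj_inj (t \o s).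
Proof.
have tsi := inj_comp ti si => v.
apply: (zlat_ext (f := proj_inj s \o proj_inj t) (g := proj_inj (t \o s))) => z.
change (proj_inj s (proj_inj t (zgen z)) = proj_inj (t \o s) (zgen z)).
have [/codomP[y ->]|zt] := boolP (z \in codom t); last first.
  rewrite !proj_inj_notin ?raddf0//; apply: contra zt => /codomP[x ->].
  exact: (codom_f t).
rewrite proj_inj_gen//; have [/codomP[x ->]|ys] := boolP (y \in codom s).
  by rewrite proj_inj_gen// (proj_inj_gen (s := t \o s)).
rewrite !proj_inj_notin//; apply: contra ys => /codomP[x /ti ->].
exact: codom_f.
Qed.

(** * Symbols in the cokernel of the bar complex *)

Section Chains.
Variable F : contraFunctor.

Section Fixed.
Variable X : finType.
Implicit Types (g h : autfg X) (x : F (zlat X)).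

(** A right action, since [F] is contravariant; it is the right module structure used by the bar
    complex. *)
Definition ract g : {additive F (zlat X) -> F (zlat X)} := contra_map F (ab_map g).

Lemma ractE g x : ract g x = contra_map F (ab_map g) x.
Proof. by []. Qed.

Lemma ractM g h x : ract (g * h)%g x = ract h (ract g x).
Proof. by rewrite /ract -contra_comp; apply: contra_ext => v; rewrite [RHS]ab_map_comp. Qed.

Lemma ract1 x : ract 1%g x = x.
Proof. by rewrite -[RHS]contra_id; apply: contra_ext => v; apply: ab_map_id. Qed.

Lemma ractK g x : ract g^-1%g (ract g x) = x.
Proof. by rewrite -ractM mulgV ract1. Qed.

Lemma ractVK g x : ract g (ract g^-1%g x) = x.
Proof. by rewrite -ractM mulVg ract1. Qed.

Definition chain1 : zmodType := @dsum (autfg X) (fun=> F (zlat X)).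
Definition chain1_inj g : {additive F (zlat X) -> chain1} :=
  @dsum_inj (autfg X) (fun=> F (zlat X)) g.

Definition chain1_rel : set chain1 := fun z => exists g h x,
  z = chain1_inj h (ract g x) - chain1_inj (g * h)%g x + chain1_inj g x.

(** The cokernel of the boundary map from degree [2] to degree [1] of the bar
    complex of [Aut(F_X)] with coefficients in [F(Z^X)]. *)
Definition barcoker : zmodType := quot chain1_rel.

Definition bsym g : {additive F (zlat X) -> barcoker} :=
  quot_pi chain1_rel \o chain1_inj g.

Lemma bsymE g x : bsym g x = quot_pi chain1_rel (chain1_inj g x).
Proof. by []. Qed.

Lemma bsymM g h x : bsym (g * h)%g x = bsym g x + bsym h (ract g x).
Proof.
change (quot_pi chain1_rel (chain1_inj (g * h)%g x)
  = quot_pi chain1_rel (chain1_inj g x) + quot_pi chain1_rel (chain1_inj h (ract g x))).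
rewrite -raddfD; apply/quot_piP; rewrite -opprB.
apply/subgroup_genN/subgroup_gen_in; exists g, h, x.
by rewrite -addrA addrC.
Qed.

Lemma barcoker_ext (W : zmodType) (f f' : {additive barcoker -> W}) :
  (forall g x, f (bsym g x) = f' (bsym g x)) -> f =1 f'.
Proof.
move=> e d; rewrite -(quot_piK d).
exact: (dsum_ext (f := f \o quot_pi chain1_rel) (g := f' \o quot_pi chain1_rel)).
Qed.

Section Lift.
Variables (W : zmodType) (f : autfg X -> {additive F (zlat X) -> W}).
Hypothesis fM : forall g h x, f (g * h)%g x = f g x + f h (ract g x).

Lemma barcoker_lift_subproof z : chain1_rel z ->
  dsum_lift f z = 0.
Proof.
move=> [g [h [x ->]]]; rewrite raddfD raddfB /chain1_inj !dsum_lift_inj fM.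
by rewrite opprD (addrC (- f g x)) addrA subrr sub0r addNr.
Qed.

Definition barcoker_lift : {additive barcoker -> W} := quot_lift barcoker_lift_subproof.

Lemma barcoker_liftE g x : barcoker_lift (bsym g x) = f g x.
Proof. by rewrite [LHS]quot_liftE /chain1_inj dsum_lift_inj. Qed.

End Lift.
Global Opaque barcoker_lift.

Lemma bsym1 x : bsym 1%g x = 0.
Proof. by apply: (addrI (bsym 1%g x)); rewrite -{2}(ract1 x) -bsymM mulg1 addr0. Qed.

(** The chain homotopy by which inner automorphisms act trivially on homology: conjugation by [h] is
    the identity plus [bsym h] of the boundary. *)
Lemma bsymJ g h x : bsym (h^-1 * g * h)%g (ract h x) = bsym g x + bsym h (ract g x - x).
Proof.
have hV : bsym h^-1%g (ract h x) = - bsym h x.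
  by apply/eqP; rewrite -addr_eq0 addrC -bsymM mulgV bsym1.
by rewrite raddfB -mulgA bsymM ractK bsymM hV addrA [RHS]addrC addrC addrA.
Qed.

Lemma bsymJ_fixed g h x : ract g x = x -> bsym (h^-1 * g * h)%g (ract h x) = bsym g x.
Proof. by move=> gx; rewrite bsymJ gx subrr raddf0 addr0. Qed.

Lemma cbd_subproof g h x :
  (ract (g * h)%g \- idfun : {additive _ -> _}) x
  = (ract g \- idfun : {additive _ -> _}) x + (ract h \- idfun : {additive _ -> _}) (ract g x).
Proof. by rewrite /= ractM [RHS]addrC subrKA. Qed.

(** The boundary to degree 0 of the bar complex; its kernel consists of the homology classes. *)
Definition cbd : {additive barcoker -> F (zlat X)} := barcoker_lift cbd_subproof.

Lemma cbdE g x : cbd (bsym g x) = ract g x - x.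
Proof. by rewrite [LHS]barcoker_liftE. Qed.

End Fixed.
Arguments cbd {X}.
Global Opaque bsym ract cbd.

Section Functoriality.
Variables (X Y : finType) (q : {additive zlat Y -> zlat X}) (a : autfg X -> autfg Y).
Hypothesis aM : forall g h, a (g * h)%g = (a g * a h)%g.
Hypothesis qa : forall g v, q (ab_map (a g) v) = ab_map g (q v).

Lemma ract_map g x : ract (a g) (contra_map F q x) = contra_map F q (ract g x).
Proof.
by rewrite !ractE -!contra_comp; apply: contra_ext => v; apply: qa.
Qed.

Lemma barcoker_map_subproof g h (x : F (zlat X)) :
  (bsym (a (g * h)%g) \o contra_map F q) x
  = (bsym (a g) \o contra_map F q) x + (bsym (a h) \o contra_map F q) (ract g x).
Proof. by rewrite /= aM bsymM ract_map. Qed.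

Definition barcoker_map : {additive barcoker X -> barcoker Y} :=
  barcoker_lift barcoker_map_subproof.

Lemma barcoker_mapE g x : barcoker_map (bsym g x) = bsym (a g) (contra_map F q x).
Proof. by rewrite [LHS]barcoker_liftE. Qed.

Lemma cbd_map d : cbd (barcoker_map d) = contra_map F q (cbd d).
Proof.
apply: (barcoker_ext (f := cbd \o barcoker_map) (f' := contra_map F q \o cbd)) => g x.
change (cbd (barcoker_map (bsym g x)) = contra_map F q (cbd (bsym g x))).
by rewrite barcoker_mapE !cbdE ract_map raddfB.
Qed.

End Functoriality.
Global Opaque barcoker_map.

Definition stab_map (X Y : finType) (s : X -> Y) (si : injective s) :
    {additive barcoker X -> barcoker Y} :=
  barcoker_map (aut_extM si) (proj_inj_ext si).

Lemma stab_mapE (X Y : finType) (s : X -> Y) (si : injective s) g x :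
  stab_map si (bsym g x) = bsym (aut_ext si g) (contra_map F (proj_inj s) x).
Proof. exact: barcoker_mapE. Qed.

Lemma stab_map_cbd (X Y : finType) (s : X -> Y) (si : injective s) d :
  cbd (stab_map si d) = contra_map F (proj_inj s) (cbd d).
Proof. exact: cbd_map. Qed.

Lemma stab_map_comp (X Y Z : finType) (s : X -> Y) (t : Y -> Z) (si : injective s)
    (ti : injective t) (tsi : injective (t \o s)) d :
  stab_map ti (stab_map si d) = stab_map tsi d.
Proof.
apply: (barcoker_ext (f := stab_map ti \o stab_map si) (f' := stab_map tsi)) => g x.
change (stab_map ti (stab_map si (bsym g x)) = stab_map tsi (bsym g x)).
rewrite !stab_mapE (aut_ext_comp si ti tsi) -contra_comp; congr (bsym _ _).
by apply: contra_ext; apply: proj_inj_comp.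
Qed.

End Chains.
Arguments cbd {F X}.

Local Opaque dsum_inj.

(** * Elements of sequential colimits *)

Section SeqColimTheory.
Variables (V : nat -> zmodType) (t : forall n, {additive V n -> V n.+1}).

Definition seqcolim_inj n : {additive V n -> seqcolim t} :=
  quot_pi (seqcolim_rel t) \o dsum_inj V n.

Lemma seqcolim_inj_step n x : seqcolim_inj n.+1 (t n x) = seqcolim_inj n x.
Proof.
apply/quot_piP/subgroup_gen_in; by exists n, x.
Qed.

(** Pushing all components forward to stage [n], which vanishes for large [n]
    exactly on the relations. *)
Fixpoint push_sum (z : dsum V) n : V n :=
  if n is m.+1 then t m (push_sum z m) + z m.+1 else z 0%N.

Lemma push_sumB z z' n : push_sum (z - z') n = push_sum z n - push_sum z' n.
Proof. by elim: n => //= n ->; rewrite raddfB opprD addrACA. Qed.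

Lemma push_sum_eq0 z n0 :
  push_sum z n0 = 0 -> (forall n, (n0 < n)%N -> z n = 0) ->
  forall n, (n0 <= n)%N -> push_sum z n = 0.
Proof.
move=> h0 h; elim=> [|n IH]; first by rewrite leqn0 => /eqP n00; rewrite n00 in h0.
rewrite leq_eqVlt => /predU1P[<-//|n0n] /=.
by rewrite IH// raddf0 add0r h.
Qed.

Lemma dsum_inj_eq n (x : V n) : dsum_inj V n x n = x.
Proof. exact: dsum_inj_id. Qed.

Lemma dsum_inj_ne n m (x : V n) : n != m -> dsum_inj V n x m = 0.
Proof. exact: dsum_inj_neq. Qed.

Lemma push_sum_lt n (x : V n) m : (m < n)%N -> push_sum (dsum_inj V n x) m = 0.
Proof.
elim: m => [|m IH] mn /=; first by rewrite dsum_inj_ne// gtn_eqF.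
by rewrite IH ?raddf0 ?add0r ?dsum_inj_ne ?gtn_eqF// ltnW.
Qed.

Lemma push_sum_inj n (x : V n) : push_sum (dsum_inj V n x) n = x.
Proof.
case: n x => [|n] x /=; first exact: dsum_inj_eq.
by rewrite push_sum_lt// raddf0 add0r dsum_inj_eq.
Qed.

Lemma push_sum_rel z : subgroup_gen (seqcolim_rel t) z ->
  exists n0, forall n, (n0 <= n)%N -> push_sum z n = 0.
Proof.
elim=> [|_ [n [x ->]]|z1 z2 _ [n0 h] _ [n1 h']].
- by exists 0%N; elim=> //= n IH _; rewrite IH// raddf0 addr0.
- exists n.+1; apply: push_sum_eq0; last first.
    move=> m nm; rewrite dsumBE !dsum_inj_ne ?subr0//.
      by rewrite ltn_eqF// (ltn_trans _ nm).
    by rewrite ltn_eqF.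
  rewrite push_sumB push_sum_inj /= push_sum_inj dsum_inj_ne ?addr0 ?subrr//.
  by rewrite ltn_eqF.
exists (maxn n0 n1) => n; rewrite geq_max => /andP[/h hn /h' hn'].
by rewrite push_sumB hn hn' subrr.
Qed.

Lemma seqcolim_inj_eq0 n (x : V n) : seqcolim_inj n x = 0 ->
  exists n0, forall m, (n0 <= m)%N -> push_sum (dsum_inj V n x) m = 0.
Proof.
rewrite -(raddf0 (quot_pi (seqcolim_rel t))) => /quot_piP; rewrite subr0.
exact: push_sum_rel.
Qed.

Local Opaque seqcolim_inj.

Lemma seqcolim_inj_push n (x : V n) m : (n <= m)%N ->
  seqcolim_inj m (push_sum (dsum_inj V n x) m) = seqcolim_inj n x.
Proof.
elim: m => [|m IH]; first by rewrite leqn0 => /eqP n0; subst n; rewrite push_sum_inj.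
rewrite leq_eqVlt => /predU1P[nm|nm]; first by subst n; rewrite push_sum_inj.
rewrite /= dsum_inj_ne ?ltn_eqF// addr0 seqcolim_inj_step.
exact: IH.
Qed.

Lemma seqcolim_surj d : exists n (x : V n), d = seqcolim_inj n x.
Proof.
rewrite -(quot_piK d); set z := (X in quot_pi _ X); rewrite (dsum_decomp z) {1}/z.
elim/big_ind: _ => [|z1 z2 [n1 [x1 e1]] [n2 [x2 e2]]|n _].
- by exists 0%N, 0; rewrite !raddf0.
- exists (maxn n1 n2), (push_sum (dsum_inj V n1 x1) (maxn n1 n2)
    + push_sum (dsum_inj V n2 x2) (maxn n1 n2)).
  rewrite [RHS]raddfD !seqcolim_inj_push ?leq_maxl ?leq_maxr// -e1 -e2; exact: raddfD.
by exists n, (z n).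
Qed.

Section Lift.
Variables (W : zmodType) (f : forall n, {additive V n -> W}).
Hypothesis ft : forall n x, f n.+1 (t n x) = f n x.

Lemma seqcolim_lift_subproof z : seqcolim_rel t z -> dsum_lift f z = 0.
Proof. by move=> [n [x ->]]; rewrite raddfB !dsum_lift_inj ft subrr. Qed.

Definition seqcolim_lift : {additive seqcolim t -> W} := quot_lift seqcolim_lift_subproof.

Lemma seqcolim_liftE n x : seqcolim_lift (seqcolim_inj n x) = f n x.
Proof. by rewrite [LHS]quot_liftE dsum_lift_inj. Qed.

End Lift.
Global Opaque seqcolim_lift.

End SeqColimTheory.

Lemma seqcolim_map_inj (V W : nat -> zmodType) (t : forall n, {additive V n -> V n.+1})
    (u : forall n, {additive W n -> W n.+1}) (f : forall n, {additive V n -> W n})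
    (ft : forall n x, f n.+1 (t n x) = u n (f n x)) n x :
  seqcolim_map ft (seqcolim_inj t n x) = seqcolim_inj u n (f n x).
Proof.
change (quot_map (seqcolim_map_subproof ft) (quot_pi (seqcolim_rel t) (dsum_inj V n x))
  = quot_pi (seqcolim_rel u) (dsum_inj W n (f n x))).
by rewrite quot_mapE dsum_mapE.
Qed.
Global Opaque seqcolim_inj.

(** * Independence of the stable class from the naming of the letters *)

Section PermAut.
Variable X : finType.

Lemma perm_aut_subproof (p q : X -> X) x : cancel p q ->
  fg_lift (fun x => fg_gen (q x)) (fg_gen (p x)) = fg_gen x.
Proof. by move=> pK; rewrite fg_lift_gen pK. Qed.

Definition perm_aut (p : {perm X}) : autfg X :=
  fg_aut (fun x => perm_aut_subproof x (permK p)) (fun x => perm_aut_subproof x (permKV p)).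

Lemma perm_autE p x : perm_aut p (fg_gen x) = fg_gen (p x).
Proof. exact: fg_autE. Qed.

Lemma perm_autV p : (perm_aut p)^-1%g = perm_aut p^-1%g.
Proof. by apply: aut_gen_ext => x; rewrite perm_autE. Qed.

Lemma perm_aut_map p w : perm_aut p w = fg_map p w.
Proof. by apply: (fg_ext (f := perm_aut p) (g := fg_map p)) => x; rewrite perm_autE. Qed.

Local Opaque perm_aut.

(** Along a bijection, [stab_map] is conjugation by a permutation of the letters, and conjugation
    changes [d] only by a symbol of [cbd d]. *)
Lemma stab_map_perm F (s : X -> X) (si : injective s) (d : barcoker F X) :
  cbd d = 0 -> stab_map F si d = d.
Proof.
pose h := perm_aut (perm si)^-1%g.
suff -> : stab_map F si d = d + bsym F h (cbd d) by move=> ->; rewrite raddf0 addr0.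
move: d; apply: (barcoker_ext (f := stab_map F si) (f' := idfun \+ (bsym F h \o cbd))) => g x.
rewrite stab_mapE [RHS]/= cbdE -bsymJ; congr (bsym F _ _).
  apply: aut_extP => [y|y]; last by rewrite -(permKV (perm si) y) permE codom_f.
  rewrite /h perm_autV invgK !autM_E perm_autE -(permE si) permK perm_aut_map.
  by apply: eq_fg_map => z; rewrite permE.
rewrite ractE; apply: contra_zext => y; rewrite ab_map_gen.
by rewrite -{1}(permKV (perm si) y) permE proj_inj_gen// perm_autE fg_ab_gen.
Qed.

End PermAut.
Global Opaque perm_aut.

Section StableClass.
Variable F : contraFunctor.

Definition stable_barcoker : zmodType :=
  seqcolim (V := fun n => barcoker F 'I_n) (fun n => stab_map F (@lift_inj n.+1 ord_max)).

Definition stable_inj n : {additive barcoker F 'I_n -> stable_barcoker} :=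
  seqcolim_inj (V := fun n => barcoker F 'I_n) (fun n => stab_map F (@lift_inj n.+1 ord_max)) n.

Lemma stab_map_eq (X Y : finType) (s s' : X -> Y) (si : injective s) (si' : injective s') d :
  s =1 s' -> stab_map F si d = stab_map F si' d.
Proof. by move=> /funext e; subst s'; rewrite (Prop_irrelevance si si'). Qed.

Lemma stable_injE n d : stable_inj n d =
  seqcolim_inj (V := fun n => barcoker F 'I_n) (fun n => stab_map F (@lift_inj n.+1 ord_max)) n d.
Proof. by []. Qed.

Lemma stable_inj_lift n d : stable_inj n.+1 (stab_map F (@lift_inj n.+1 ord_max) d) = stable_inj n d.
Proof. exact: seqcolim_inj_step. Qed.

(** If [s] misses a letter, a transposition moves that letter to the end, and [s] then factors
    through the standard inclusion, to which the induction on [N] applies. Otherwise [s] is a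
    permutation. *)
Lemma stable_inj_ord n N (s : 'I_n -> 'I_N) (si : injective s) (d : barcoker F 'I_n) :
  cbd d = 0 -> stable_inj N (stab_map F si d) = stable_inj n d.
Proof.
elim: N n s si d => [|N IH] n s si d d0.
  have n0 : n = 0%N by case: n s {si d d0} => // n s; case: (s ord0).
  by subst n; rewrite stab_map_perm.
have [/eqP nN|nN] := boolP (n == N.+1); first by subst n; rewrite stab_map_perm.
have [j js] : exists j, j \notin codom s.
  apply/existsP; apply: contraR nN; rewrite negb_exists => /forallP sj.
  have := leq_card s si; rewrite !card_ord eqn_leq => -> /=.
  rewrite -[X in (X <= _)%N](card_ord N.+1) -[X in (_ <= X)%N](card_ord n) -(card_codom si).
  by apply: subset_leq_card; apply/subsetP => j _; have := sj j; rewrite negbK.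
pose p := tperm j ord_max.
have pi : injective p by exact: perm_inj.
have ps i : p (s i) != ord_max.
  apply/eqP => e; have : s i = j by rewrite -(permK p (s i)) e tpermV tpermR.
  by move=> e'; move: js; rewrite -e' codom_f.
have [s' s'E] : exists s' : 'I_n -> 'I_N, forall i, p (s i) = lift ord_max (s' i).
  apply: (fin_all_exists (P := fun i k => p (s i) = lift ord_max k)) => i.
  by case: (unlift_some (contra_neqN (fun e => esym (eqP e)) (ps i))) => k -> _; exists k.
have si' : injective s'.
  by move=> i i' e; apply/si/pi; rewrite !s'E e.
rewrite -(stab_map_perm pi (d := stab_map F si d)); last by rewrite stab_map_cbd d0 raddf0.
rewrite (stab_map_comp si pi (inj_comp pi si)) -(IH _ _ si')// -[RHS]stable_inj_lift.
rewrite (stab_map_comp si' (@lift_inj N.+1 ord_max) (inj_comp (@lift_inj N.+1 ord_max) si')).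
congr (stable_inj _ _); exact: stab_map_eq.
Qed.

(** The numbering by [enum_rank] is an arbitrary choice; [bclass_stab] shows that it does not matter
    on cycles. *)
Definition bclass (X : finType) : {additive barcoker F X -> stable_barcoker} :=
  stable_inj #|X| \o stab_map F (@enum_rank_inj X).

Lemma bclassE (X : finType) d : bclass X d = stable_inj #|X| (stab_map F (@enum_rank_inj X) d).
Proof. by []. Qed.

Lemma bclass_stab (X Y : finType) (s : X -> Y) (si : injective s) (d : barcoker F X) :
  cbd d = 0 -> bclass Y (stab_map F si d) = bclass X d.
Proof.
move=> d0.
change (stable_inj #|Y| (stab_map F (@enum_rank_inj Y) (stab_map F si d))
        = stable_inj #|X| (stab_map F (@enum_rank_inj X) d)).
rewrite (stab_map_comp si (@enum_rank_inj Y) (inj_comp (@enum_rank_inj Y) si)).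
pose r : 'I_#|X| -> 'I_#|Y| := enum_rank \o s \o enum_val.
have ri : injective r by apply: inj_comp (enum_val_inj); apply: inj_comp si; exact: enum_rank_inj.
rewrite -(stable_inj_ord ri); last by rewrite stab_map_cbd d0 raddf0.
rewrite (stab_map_comp (@enum_rank_inj X) ri (inj_comp ri (@enum_rank_inj X))).
by congr (stable_inj _ _); apply: stab_map_eq => x; apply: esym; exact: (congr1 (enum_rank \o s) (enum_rankK x)).
Qed.

Lemma bclass_ord n (d : barcoker F 'I_n) : cbd d = 0 -> bclass 'I_n d = stable_inj n d.
Proof. exact: stable_inj_ord. Qed.


End StableClass.
Global Opaque bclass stable_inj.

(** * Classes of inner automorphisms *)

Section Multipliers.
Variables (X : choiceType).
Implicit Types (u w : freeGroup X).

(** [w] is a word in the letters outside [P]. *)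
Definition avoids (P : pred X) w := forall f : {multiplicative freeGroup X -> freeGroup X},
  (forall x, ~~ P x -> f (fg_gen x) = fg_gen x) -> f w = w.

Lemma avoids1 (P : pred X) : avoids P 1%g.
Proof. by move=> f _; rewrite mult1. Qed.

Lemma avoidsM (P : pred X) u w : avoids P u -> avoids P w -> avoids P (u * w)%g.
Proof. by move=> hu hw f hf; rewrite gmulfM hu ?hw. Qed.

Lemma avoidsV (P : pred X) w : avoids P w -> avoids P w^-1%g.
Proof. by move=> hw f hf; rewrite multV hw. Qed.

Lemma avoids_gen (P : pred X) x : ~~ P x -> avoids P (fg_gen x).
Proof. by move=> Px f; apply. Qed.

Lemma avoids_map (Y : choiceType) (s : Y -> X) (P : pred X) (w : freeGroup Y) :
  (forall y, ~~ P (s y)) -> avoids P (fg_map s w).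
Proof.
move=> Ps f hf; apply: (fg_ext (f := f \o fg_map s) (g := fg_map s)) => y.
by apply: etrans (congr1 f (fg_map_gen s y)) _; rewrite hf// fg_map_gen.
Qed.

Lemma avoids_sub (P : pred X) (Q : pred X) w : (forall x, Q x -> P x) -> avoids P w -> avoids Q w.
Proof. by move=> QP h f hf; apply: h => x Px; apply: hf; apply: contra Px; apply: QP. Qed.

Variable P : pred X.

Definition mult_fun (l r : X -> freeGroup X) x := if P x then (l x * fg_gen x * r x)%g else fg_gen x.

Lemma mult_fun_out (l r : X -> freeGroup X) x : ~~ P x -> fg_lift (mult_fun l r) (fg_gen x) = fg_gen x.
Proof. by move=> Px; rewrite fg_lift_gen /mult_fun (negbTE Px). Qed.

Variables (l r : X -> freeGroup X).
Hypotheses (Hl : forall x, P x -> avoids P (l x)) (Hr : forall x, P x -> avoids P (r x)).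

Lemma mult_funK x : fg_lift (mult_fun (fun x => (l x)^-1%g) (fun x => (r x)^-1%g))
  (mult_fun l r x) = fg_gen x.
Proof.
rewrite {2}/mult_fun; case: ifPn => Px; last exact: mult_fun_out.
rewrite !gmulfM (Hl Px) ?(Hr Px); try by move=> y Py; exact: mult_fun_out.
by rewrite fg_lift_gen /mult_fun Px !mulgA mulgV mul1g mulgKV.
Qed.

Lemma mult_funVK x : fg_lift (mult_fun l r)
  (mult_fun (fun x => (l x)^-1%g) (fun x => (r x)^-1%g) x) = fg_gen x.
Proof.
rewrite {2}/mult_fun; case: ifPn => Px; last exact: mult_fun_out.
rewrite !gmulfM !multV (Hl Px) ?(Hr Px); try by move=> y Py; exact: mult_fun_out.
by rewrite fg_lift_gen /mult_fun Px !mulgA mulVg mul1g mulgK.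
Qed.

(** The multipliers are words in the letters outside [P], hence fixed, which gives the inverse at
    once. Transvections, shears and conjugations of letters are all of this form. *)
Definition mult_aut : autfg X := fg_aut mult_funK mult_funVK.

Lemma mult_aut_in x : P x -> mult_aut (fg_gen x) = (l x * fg_gen x * r x)%g.
Proof. by move=> Px; rewrite fg_autE /mult_fun Px. Qed.

Lemma mult_aut_out x : ~~ P x -> mult_aut (fg_gen x) = fg_gen x.
Proof. by move=> Px; rewrite fg_autE /mult_fun (negbTE Px). Qed.

Lemma mult_aut_avoid w : avoids P w -> mult_aut w = w.
Proof. by apply; exact: mult_aut_out. Qed.

End Multipliers.
Global Opaque mult_aut.

Section Conjugators.
Variables (X : choiceType) (P : pred X).
Implicit Types u : X -> freeGroup X.

(** The endomorphism [k] killing the letters in [P] fixes [w], and after composition with [k] both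
    maps agree on all letters. *)
Lemma avoids_eq (H : groupType) (f g : {multiplicative freeGroup X -> H}) (w : freeGroup X) :
  avoids P w -> (forall x, ~~ P x -> f (fg_gen x) = g (fg_gen x)) -> f w = g w.
Proof.
move=> Pw fg; pose k := fg_lift (fun x => if P x then 1%g else fg_gen x : freeGroup X).
have kE x : k (fg_gen x) = if P x then 1%g else fg_gen x by exact: fg_lift_gen.
rewrite -(Pw k) => [|x Px]; last by rewrite kE (negbTE Px).
apply: (fg_ext (f := f \o k) (g := g \o k)) => x.
change (f (k (fg_gen x)) = g (k (fg_gen x))).
by rewrite kE; case: ifPn => [_|/fg//]; rewrite !mult1.
Qed.

Definition conj_aut u (Hu : forall x, P x -> avoids P (u x)) : autfg X :=
  mult_aut Hu (fun x Px => avoidsV (Hu x Px)).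

Variables (u : X -> freeGroup X) (Hu : forall x, P x -> avoids P (u x)).

Lemma conj_aut_in x : P x -> conj_aut Hu (fg_gen x) = (u x * fg_gen x * (u x)^-1)%g.
Proof. exact: mult_aut_in. Qed.

Lemma conj_aut_out x : ~~ P x -> conj_aut Hu (fg_gen x) = fg_gen x.
Proof. exact: mult_aut_out. Qed.

Lemma conj_aut_avoid (w : freeGroup X) : avoids P w -> conj_aut Hu w = w.
Proof. exact: mult_aut_avoid. Qed.

End Conjugators.
Global Opaque conj_aut.

Lemma ract_conj_aut (F : contraFunctor) (X : finType) (P : pred X) (u : X -> freeGroup X)
    (Hu : forall x, P x -> avoids P (u x)) (x : F (zlat X)) : ract F (conj_aut Hu) x = x.
Proof.
rewrite ractE -[RHS](contra_id (A := zlat X)); apply: contra_zext => i.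
rewrite ab_map_gen; have [Pi|Pi] := boolP (P i); last by rewrite conj_aut_out ?fg_ab_gen.
by rewrite conj_aut_in// !fg_abE addrAC subrr add0r.
Qed.


Section FixedClasses.
Variable F : contraFunctor.

Lemma cbd_fixed (X : finType) (g : autfg X) (x : F (zlat X)) :
  ract F g x = x -> cbd (bsym F g x) = 0.
Proof. by move=> gx; rewrite cbdE gx subrr. Qed.

Lemma bclass_ext (X Y : finType) (s : X -> Y) (si : injective s) (g : autfg X)
    (x : F (zlat X)) : ract F g x = x ->
  bclass F Y (bsym F (aut_ext si g) (contra_map F (proj_inj s) x)) = bclass F X (bsym F g x).
Proof. by move=> gx; rewrite -stab_mapE bclass_stab// cbd_fixed. Qed.

Lemma ract_contra (X : finType) (B : freeAbType) (g : autfg X) (q q' : {additive zlat X -> B})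
    (x : F B) : (forall i, q (fg_ab (g (fg_gen i))) = q' (zgen i)) ->
  ract F g (contra_map F q x) = contra_map F q' x.
Proof. by move=> qg; rewrite ractE; apply: contra_zcompE => i; rewrite ab_map_gen. Qed.

Lemma bsymM_fixed (X : finType) (g h : autfg X) (x : F (zlat X)) :
  ract F g x = x -> bsym F (g * h)%g x = bsym F g x + bsym F h x.
Proof. by move=> gx; rewrite bsymM gx. Qed.

End FixedClasses.

(** The alternating sum of the constant [b] over all subsets vanishes as well; subtracting it
    expresses the term of the empty set by differences that lie in the subgroup [P]. *)
Lemma alternating_sum_sub (m : nat) (V : zmodType) (P : V -> Prop)
    (f : {set 'I_m} -> V) (b : V) : (0 < m)%N -> P 0 ->
  (forall v w, P v -> P w -> P (v - w)) ->
  \sum_(S : {set 'I_m}) f S *~ (-1) ^+ #|S| = 0 ->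
  (forall S, S != set0 -> P (f S - b)) -> P (f set0 - b).
Proof.
move=> m0 P0 PB f0 fP; pose i0 := Ordinal m0.
have PN v : P v -> P (- v) by move=> Pv; rewrite -sub0r; exact: PB.
have PD v w : P v -> P w -> P (v + w) by move=> Pv /PN Pw; rewrite -(opprK w); exact: PB.
have PZ v n : P v -> P (v *~ n).
  move=> Pv; have Pn k : P (v *+ k) by elim: k => // k IH; rewrite mulrS; exact: PD.
  by case: n => n; rewrite ?NegzE ?mulrNz; [|apply: PN]; exact: Pn.
have : \sum_(S : {set 'I_m}) (f S - b) *~ (-1) ^+ #|S| = 0.
  rewrite (eq_bigr _ (fun S _ => mulrzBl _ _ _)) sumrB f0.
  by rewrite (sum_sign_sets (i0 := i0) (f := fun=> b)) ?subrr.
rewrite (bigD1 set0)//= cards0 expr0 mulr1z => /eqP; rewrite addr_eq0 => /eqP ->.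
apply: PN; elim/big_ind: _ => // S S0; apply: PZ; exact: fP.
Qed.

Lemma alternating_sum_const (m : nat) (V : zmodType) (f : {set 'I_m} -> V) (b : V) :
  (0 < m)%N -> \sum_(S : {set 'I_m}) f S *~ (-1) ^+ #|S| = 0 ->
  (forall S, S != set0 -> f S = b) -> f set0 = b.
Proof.
move=> m0 f0 fb; apply/eqP; rewrite -subr_eq0; apply/eqP.
apply: (alternating_sum_sub (P := fun v => v = 0) m0) f0 _ => [//|v w -> ->|S S0].
  by rewrite subrr.
by rewrite fb// subrr.
Qed.

Section Sums.
Variables X Z : finType.

Definition copair (A : zmodType) (f : {additive zlat X -> A}) (c : {additive zlat Z -> A}) :
    {additive zlat (X + Z)%type -> A} :=
  zlift (fun y => match y with inl i => f (zgen i) | inr z => c (zgen z) end).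

Lemma copair_inl (A : zmodType) (f : {additive zlat X -> A}) c i :
  copair f c (zgen (inl i)) = f (zgen i).
Proof. exact: zlift_gen. Qed.

Lemma copair_inr (A : zmodType) (f : {additive zlat X -> A}) c z :
  copair f c (zgen (inr z)) = c (zgen z).
Proof. exact: zlift_gen. Qed.

Lemma copair_map_inl (A : zmodType) (f : {additive zlat X -> A}) c w :
  copair f c (fg_ab (fg_map inl w)) = f (fg_ab w).
Proof.
rewrite -ab_mapE; move: (fg_ab w).
apply: (zlat_ext (f := copair f c \o ab_map (fg_map inl))) => i.
change (copair f c (ab_map (fg_map inl) (zgen i)) = f (zgen i)).
by rewrite ab_map_gen fg_map_gen fg_ab_gen copair_inl.
Qed.

Lemma copair_map_inr (A : zmodType) (f : {additive zlat X -> A}) c w :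
  copair f c (fg_ab (fg_map inr w)) = c (fg_ab w).
Proof.
rewrite -ab_mapE; move: (fg_ab w).
apply: (zlat_ext (f := copair f c \o ab_map (fg_map inr))) => i.
change (copair f c (ab_map (fg_map inr) (zgen i)) = c (zgen i)).
by rewrite ab_map_gen fg_map_gen fg_ab_gen copair_inr.
Qed.

Lemma inl_notin_inr (x : X) : (inl x : X + Z) \notin codom (inr : Z -> X + Z).
Proof. by apply/codomP => -[]. Qed.

Lemma inr_notin_inl (z : Z) : (inr z : X + Z) \notin codom (inl : X -> X + Z).
Proof. by apply/codomP => -[]. Qed.

End Sums.
Global Opaque copair.

(** * Absorption of letters by polynomiality *)

Section Absorption.
Variables (F : contraFunctor) (pF : polynomial_functor F).
Variables X Z : finType.

(** Replace [X] by [m] copies of itself, and the projection to [X] by the sum of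
    the projections of the copies in [S]. The class is the same for all nonempty
    [S], because shears between copies commute with [G]; by polynomiality it is
    then also the class for [S] empty. *)
Lemma bclass_absorb (c : {additive zlat Z -> zlat X}) (G : autfg Z) (x : F (zlat X)) :
  (forall z, c (fg_ab (G (fg_gen z))) = c (zgen z)) ->
  bclass F (X + Z)%type
    (bsym F (aut_ext (@inr_inj X Z) G) (contra_map F (copair idfun c) x))
  = bclass F Z (bsym F G (contra_map F c x)).
Proof.
move=> cG; have [m m0 dev] := polynomial_deviation pF.
pose Y := ((X * 'I_m) + Z)%type.
pose qf (S : {set 'I_m}) (y : Y) : zlat X :=
  match y with inl p => if p.2 \in S then zgen p.1 else 0 | inr z => c (zgen z) end.
pose q S : {additive zlat Y -> zlat X} := zlift (qf S).
have qE S y : q S (zgen y) = qf S y by rewrite zlift_gen.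
pose bf (s : 'I_m) (y : Y) : zlat X :=
  if y is inl p then if p.2 == s then zgen p.1 else 0 else 0.
have qS S v : q S v = q set0 v + \sum_(s in S) zlift (bf s) v.
  apply: zlift_sum => -[[i s]|z] /=; last by rewrite big1 ?addr0.
  rewrite inE add0r; case: ifP => [sS|sS].
    rewrite (bigD1 s)//= eqxx big1 ?addr0// => s' /andP[_ ss'].
    by rewrite eq_sym (negbTE ss').
  by rewrite big1// => s' s'S; case: eqP => // e; rewrite e s'S in sS.
clearbody q.
have qinr S w : q S (fg_ab (fg_map inr w)) = c (fg_ab w).
  rewrite -ab_mapE; move: (fg_ab w).
  apply: (zlat_ext (f := q S \o ab_map (fg_map inr))) => i.
  change (q S (ab_map (fg_map inr) (zgen i)) = c (zgen i)).
  by rewrite ab_map_gen fg_map_gen fg_ab_gen qE.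
pose G' : autfg Y := aut_ext (@inr_inj (X * 'I_m) Z) G.
have G'inl p : G' (fg_gen (inl p)) = fg_gen (inl p).
  by rewrite aut_ext_notin// inl_notin_inr.
have G'inr z : G' (fg_gen (inr z)) = fg_map inr (G (fg_gen z)) by rewrite aut_ext_gen.
have G'q S : ract F G' (contra_map F (q S) x) = contra_map F (q S) x.
  apply: ract_contra => -[p|z]; first by rewrite G'inl fg_ab_gen.
  by rewrite G'inr qinr cG qE.
pose ell S := bclass F Y (bsym F G' (contra_map F (q S) x)).
have ell_sum : \sum_(S : {set 'I_m}) ell S *~ (-1) ^+ #|S| = 0.
  have := dev _ _ (q set0) (fun s => zlift (bf s)) q x qS.
  move=> /(congr1 (bclass F Y \o bsym F G')).
  rewrite raddf_sum raddf0 => e; apply: etrans e.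
  by apply: eq_bigr => S _; rewrite raddfMz.
have <- : ell set0 = bclass F Z (bsym F G (contra_map F c x)).
  rewrite -(bclass_ext (@inr_inj (X * 'I_m) Z)).
    congr (bclass F Y (bsym F _ _)); rewrite -contra_comp; apply: contra_zext => -[[i s]|z].
      by rewrite /= proj_inj_notin ?inl_notin_inr// raddf0 qE /= inE.
    by rewrite /= (proj_inj_gen (@inr_inj _ _)) qE.
  by apply: ract_contra.
symmetry; apply: (alternating_sum_const m0 ell_sum) => S /set0Pn[s sS].
(* The shear [h] multiplies the letters of the copies in [S] other than [s] by their counterparts in
   copy [s]. It pulls [q [set s]] back to [q S], and commutes with [G'], which fixes all copies of
   [X]. *)
pose P (y : Y) := if y is inl p then (p.2 \in S) && (p.2 != s) else false.
pose r (y : Y) : freeGroup Y := if y is inl p then fg_gen (inl (p.1, s)) else 1%g.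
have Hr y : P y -> avoids P (r y).
  by case: y => [[i s']|z] //= _; apply: avoids_gen => /=; rewrite eqxx andbF.
pose h := mult_aut (fun _ _ => @avoids1 _ P) Hr.
have hG : (h^-1 * G' * h)%g = G'.
  rewrite -mulgA; apply: (mulgI h); rewrite !mulgA mulgV mul1g.
  apply: aut_gen_ext => -[[i s']|z]; rewrite !autM_E.
    rewrite G'inl; have [hi|hi] := boolP (P (inl (i, s'))); last by rewrite mult_aut_out.
    by rewrite mult_aut_in// mul1g gmulfM !G'inl.
  rewrite G'inr mult_aut_out// G'inr mult_aut_avoid//.
  by apply: avoids_map.
have qh : ract F h (contra_map F (q [set s]) x) = contra_map F (q S) x.
  apply: ract_contra => -[[i s']|z]; last by rewrite mult_aut_out// fg_ab_gen !qE.
  have [hi|hi] := boolP (P (inl (i, s'))).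
    rewrite mult_aut_in// !fg_abE.
    by rewrite add0r raddfD !qE /= !inE eqxx; case/andP: hi => /= -> /negbTE ->; rewrite add0r.
  rewrite mult_aut_out// fg_ab_gen !qE /= inE; move: hi; rewrite /= negb_and negbK.
  by case: eqP => [->|_]; rewrite ?sS// orbF => /negbTE ->.
rewrite /ell -qh -{1}hG bsymJ_fixed ?G'q//.
pose sg (y : X + Z) : Y := match y with inl i => inl (i, s) | inr z => inr z end.
have sgi : injective sg by case=> [i|z] [i'|z'] //= [->].
rewrite -(bclass_ext sgi); last first.
  apply: ract_contra => -[i|z]; first by rewrite aut_ext_notin ?inl_notin_inr// fg_ab_gen.
  by rewrite aut_ext_gen copair_map_inr cG copair_inr.
rewrite (aut_ext_comp (@inr_inj X Z) sgi (@inr_inj (X * 'I_m) Z)).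
congr (bclass F Y (bsym F _ _)); apply: esym; apply: contra_zcompE => -[[i s']|z]; last first.
  by rewrite (proj_inj_gen sgi (inr z)) copair_inr qE.
rewrite qE /= inE; case: eqP => [->|ss']; first by rewrite (proj_inj_gen sgi (inl i)) copair_inl.
by rewrite proj_inj_notin ?raddf0//; apply/codomP => -[[i'|z']]//= [_ /ss'].
Qed.

End Absorption.

(** * Conjugations of a single letter *)

Section InnerClasses.
Variables (F : contraFunctor) (rF : reduced_functor F) (pF : polynomial_functor F).

Definition point (A : zmodType) (v : A) : {additive zlat unit -> A} := zlift (fun=> v).

Lemma point_gen (A : zmodType) (v : A) i : point v (zgen i) = v.
Proof. exact: zlift_gen. Qed.

Lemma avoids_pred1 (X : choiceType) (t : X) (u : freeGroup X) :
  avoids (pred1 t) u -> forall x, pred1 t x -> avoids (pred1 t) ((fun=> u) x).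
Proof. by []. Qed.

Definition conj1 (X : choiceType) (t : X) (u : freeGroup X) (Hu : avoids (pred1 t) u) :=
  conj_aut (avoids_pred1 Hu).

Lemma conj1E (X : choiceType) (t : X) (u : freeGroup X) (Hu : avoids (pred1 t) u) x :
  conj1 Hu (fg_gen x) = if x == t then (u * fg_gen x * u^-1)%g else fg_gen x.
Proof. by case: ifPn => xt; [exact: conj_aut_in | exact: conj_aut_out]. Qed.

Lemma conj1_avoid (X : choiceType) (t : X) (u w : freeGroup X) (Hu : avoids (pred1 t) u) :
  avoids (pred1 t) w -> conj1 Hu w = w.
Proof. exact: conj_aut_avoid. Qed.

Lemma conj1M (X : choiceType) (t : X) (u w : freeGroup X) (Hu : avoids (pred1 t) u)
    (Hw : avoids (pred1 t) w) (Huw : avoids (pred1 t) (u * w)%g) :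
  conj1 Huw = (conj1 Hw * conj1 Hu)%g.
Proof.
apply: aut_gen_ext => x; rewrite autM_E !conj1E; case: ifPn => xt; last by rewrite conj1E (negbTE xt).
rewrite !gmulfM !multV conj1E xt (conj1_avoid Hw Hu) invMg; by rewrite !mulgA.
Qed.

Lemma ract_conj1 (X : finType) (t : X) (u : freeGroup X) (Hu : avoids (pred1 t) u)
    (x : F (zlat X)) : ract F (conj1 Hu) x = x.
Proof. exact: ract_conj_aut. Qed.

Lemma avoids_true_false : avoids (pred1 true) (fg_gen false).
Proof. exact: avoids_gen. Qed.

Definition conj_bool : autfg bool := conj1 avoids_true_false.

Definition proj_false : {additive zlat bool -> zlat unit} :=
  zlift (fun b : bool => if b then 0 else zgen tt).

(** The universal conjugation: the letter [true] is conjugated by [false], which carries the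
    coefficient. [bclass_conj1] brings conjugations of a letter [t] with [f (zgen t) = 0] to this
    form. *)
Definition inner_class : {additive F (zlat unit) -> stable_barcoker F} :=
  bclass F bool \o bsym F conj_bool \o contra_map F proj_false.

Lemma inner_classE y :
  inner_class y = bclass F bool (bsym F conj_bool (contra_map F proj_false y)).
Proof. by []. Qed.

Section Word.
Variables (X Z : finType) (w : freeGroup X) (z : Z).

Lemma avoids_inr : avoids (pred1 (inr z : X + Z)) (fg_map inl w).
Proof. exact: avoids_map. Qed.

Definition conj_word := conj1 avoids_inr.

End Word.

(** On the letters [X + {j, t}], the shear [j |-> j * w] carries conjugation of [t]
    by [j] to conjugation of [t] by [j * w]. *)
Lemma bclass_conj_word (X : finType) (w : freeGroup X) (x : F (zlat X)) :
  bclass F (X + unit)%type (bsym F (conj_word w tt) (contra_map F (copair idfun \0) x))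
  = inner_class (contra_map F (point (fg_ab w)) x).
Proof.
pose c : {additive zlat bool -> zlat X} := zlift (fun b : bool => if b then 0 else fg_ab w).
have cE b : c (zgen b) = if b then 0 else fg_ab w by exact: zlift_gen.
have cG b : c (fg_ab (conj_bool (fg_gen b))) = c (zgen b).
  by case: b; rewrite /conj_bool conj1E/= ?fg_abE// addrAC subrr add0r.
have -> : inner_class (contra_map F (point (fg_ab w)) x)
    = bclass F bool (bsym F conj_bool (contra_map F c x)).
  rewrite /inner_class /=; congr (bclass F bool (bsym F _ _)).
  by apply: contra_zcompE => b; rewrite cE zlift_gen; case: b; rewrite ?raddf0 ?point_gen.
rewrite -(bclass_absorb pF (c := c))//.
pose j : X + bool := inr false; pose t : X + bool := inr true.
pose W : freeGroup (X + bool)%type := fg_map inl w.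
have jt : ~~ pred1 t j by [].
have HW : avoids (pred1 t) W by exact: avoids_map.
have Hj : avoids (pred1 t) (fg_gen j) by exact: avoids_gen.
have HjW := avoidsM Hj HW.
have Hr y : pred1 j y -> avoids (pred1 j) W by move=> _; exact: avoids_map.
pose h := mult_aut (fun _ _ => @avoids1 _ (pred1 j)) Hr.
have hj : h (fg_gen j) = (fg_gen j * W)%g by rewrite mult_aut_in ?mul1g/=.
have hout y : y != j -> h (fg_gen y) = fg_gen y by move=> yj; rewrite mult_aut_out.
have GE : aut_ext (@inr_inj X bool) conj_bool = conj1 Hj.
  apply: aut_extP => [b|y ny]; rewrite conj1E.
    rewrite /conj_bool conj1E; case: b => /=; last exact/esym/fg_map_gen.
    by rewrite !gmulfM multV !fg_map_gen.
  by case: y ny => // b; rewrite codom_f.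
have hG : (h^-1 * conj1 HjW * h)%g = aut_ext (@inr_inj X bool) conj_bool.
  rewrite GE -mulgA; apply: (mulgI h); rewrite !mulgA mulgV mul1g.
  apply: aut_gen_ext => y; rewrite !autM_E conj1E.
  have [->|yj] := eqVneq y j.
    by rewrite hj conj1_avoid// hj.
  rewrite hout// conj1E; case: eqP => [->|_]; last by rewrite hout.
  by rewrite !gmulfM multV hj hout.
have qh : ract F h (contra_map F (copair idfun \0) x) = contra_map F (copair idfun c) x.
  apply: ract_contra => y; have [->|yj] := eqVneq y j.
    by rewrite hj fg_abM fg_ab_gen raddfD copair_inr copair_map_inl copair_inr cE add0r.
  rewrite hout// fg_ab_gen; case: y yj => [i|[]]// _; first by rewrite !copair_inl.
  by rewrite !copair_inr cE.
(* Conjugation by [j * W] splits into conjugations by [W] and by [j]. In the latter the coefficient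
   vanishes on [j] and [t], so absorption with the zero map makes it a pullback along 0, which is
   zero as [F] is reduced. *)
rewrite -qh -hG bsymJ_fixed ?ract_conj1// (conj1M Hj HW) bsymM_fixed ?ract_conj1//.
rewrite raddfD -GE (bclass_absorb pF)//.
have -> : contra_map F (\0 : {additive zlat bool -> zlat X}) x = 0 by exact: reduced_zero.
rewrite !raddf0 addr0.
pose s (y : X + unit) : X + bool := match y with inl i => inl i | inr _ => t end.
have si : injective s by case=> [i|[]] [i'|[]] //= [->].
have e1 : aut_ext si (conj_word w tt) = conj1 HW.
  apply: aut_extP => [y|y ny]; rewrite !conj1E.
    case: y => [i|[]] /=; first by rewrite fg_map_gen.
    by rewrite !gmulfM multV !fg_map_gen fg_map_comp.
  by case: y ny => [i|[]]// ny; have := codom_f s (inr tt); rewrite (negbTE ny).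
have e2 : contra_map F (proj_inj s) (contra_map F (copair idfun \0) x)
    = contra_map F (copair idfun \0) x.
  apply: contra_zcompE => -[i|[]].
  - by rewrite (proj_inj_gen si (inl i)) !copair_inl.
  - by rewrite (proj_inj_gen si (inr tt)) !copair_inr.
  by rewrite proj_inj_notin ?raddf0 ?copair_inr//; apply/codomP => -[[]].
rewrite -e1 -e2; apply: esym; apply: bclass_ext; exact: ract_conj1.
Qed.

(** As [f] vanishes on [t], a transposition replaces [t] by a fresh letter without changing the
    coefficient elsewhere, and [bclass_conj_word] applies to the coefficient pulled back along
    [f]. *)
Lemma bclass_conj1 (Y : finType) (A : freeAbType) (f : {additive zlat Y -> A}) (t : Y)
    (w : freeGroup Y) (Hw : avoids (pred1 t) w) (x : F A) : f (zgen t) = 0 ->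
  bclass F Y (bsym F (conj1 Hw) (contra_map F f x))
  = inner_class (contra_map F (point (f (fg_ab w))) x).
Proof.
move=> ft.
have -> : contra_map F (point (f (fg_ab w))) x
    = contra_map F (point (fg_ab w)) (contra_map F f x).
  by apply/esym/contra_zcompE => i; rewrite !point_gen.
rewrite -bclass_conj_word -(bclass_ext (@inl_inj Y unit)) ?ract_conj1//.
pose h := perm_aut (tperm (inl t : Y + unit) (inr tt)).
have hE y : h (fg_gen y) = fg_gen (tperm (inl t : Y + unit) (inr tt) y) by exact: perm_autE.
have hw : h (fg_map inl w) = fg_map inl w.
  apply: (avoids_eq (f := h \o fg_map inl) (g := fg_map inl) Hw) => y yt.
  change (h (fg_map inl (fg_gen y)) = fg_map inl (fg_gen y)).
  by rewrite fg_map_gen hE tpermD//= eq_sym.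
have -> : bsym F (conj_word w tt) (contra_map F (copair idfun \0) (contra_map F f x))
  = bsym F (h^-1 * aut_ext (@inl_inj Y unit) (conj1 Hw) * h)%g
      (ract F h (contra_map F (copair f \0) x)).
  congr (bsym F _ _).
    rewrite -mulgA; apply: (mulgI h); rewrite !mulgA mulgV mul1g.
    apply: aut_gen_ext => y; rewrite !autM_E hE conj1E.
    case: tpermP => [->|->|/eqP yt /eqP ys].
    - by rewrite aut_ext_notin ?inr_notin_inl// hE tpermL.
    - by rewrite aut_ext_gen conj1E !eqxx !gmulfM !multV hw hE tpermR fg_map_gen.
    rewrite (negbTE ys) hE tpermD 1?eq_sym//.
    case: y yt ys => [y|[]]// yt _; rewrite aut_ext_gen conj1E ifN ?fg_map_gen//.
  rewrite -contra_comp (ract_contra (q' := copair f \0)); last first.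
    move=> y; rewrite hE fg_ab_gen; case: tpermP => [->|->|//]; by rewrite copair_inl copair_inr ft.
  by apply: contra_zext => -[y|[]] /=; rewrite ?copair_inl ?copair_inr ?raddf0.
rewrite bsymJ_fixed.
  congr (bclass F _ (bsym F _ _)); rewrite -contra_comp; apply: contra_zext => -[y|[]] /=.
    by rewrite proj_inj_gen ?copair_inl//; exact: inl_inj.
  by rewrite proj_inj_notin ?raddf0 ?copair_inr// inr_notin_inl.
apply: ract_contra => -[y|[]]; last by rewrite aut_ext_notin ?inr_notin_inl// fg_ab_gen.
rewrite aut_ext_gen copair_map_inl conj1E copair_inl; case: eqP => _; rewrite !fg_abE//.
by rewrite addrAC subrr add0r.
Qed.

(** If [G] commutes with the shear [y |-> y * l y], absorbing [X] turns the class
    into one whose coefficient is pulled back along [0]. *)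
Lemma bclass_shear0 (X Y : finType) (G : autfg Y) (l : Y -> freeGroup X) (x : F (zlat X)) :
  (forall y, fg_lift (fun y => fg_gen (inr y : X + Y) * fg_map inl (l y))%g (G (fg_gen y))
             = (fg_map inr (G (fg_gen y)) * fg_map inl (l y))%g) ->
  bclass F Y (bsym F G (contra_map F (zlift (fun y => fg_ab (l y))) x)) = 0.
Proof.
move=> hG; set h0 := fg_lift _ in hG; set f := zlift _.
have fE y : f (zgen y) = fg_ab (l y) by exact: zlift_gen.
pose p : {additive zlat (X + Y)%type -> zlat X} := copair idfun \0.
have fh w : f (fg_ab w) = p (fg_ab (h0 w)).
  apply: (fg_ab_natural (g := fun w => p (fg_ab (h0 w)))) w => [u v|y].
    by rewrite gmulfM fg_abM raddfD.
  rewrite /h0 fg_lift_gen fg_abM raddfD fg_ab_gen [p (zgen _)]copair_inr.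
  by rewrite [p (fg_ab _)]copair_map_inl fE add0r.
have fG y : f (fg_ab (G (fg_gen y))) = f (zgen y).
  by rewrite fh hG fg_abM raddfD [p (fg_ab _)]copair_map_inr [p (fg_ab _)]copair_map_inl fE add0r.
rewrite -(bclass_absorb pF (c := f))//.
pose P (y : X + Y) := if y is inr _ then true else false.
pose r (y : X + Y) : freeGroup (X + Y)%type := if y is inr y then fg_map inl (l y) else 1%g.
have Hr y : P y -> avoids P (r y) by case: y => // y _; exact: avoids_map.
pose h := mult_aut (fun _ _ => @avoids1 _ P) Hr.
have hinl i : h (fg_gen (inl i)) = fg_gen (inl i) by rewrite mult_aut_out.
have hinr y : h (fg_gen (inr y)) = (fg_gen (inr y) * fg_map inl (l y))%g.
  by rewrite mult_aut_in// mul1g.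
have hh0 w : h (fg_map inr w) = h0 w.
  apply: (fg_ext (f := h \o fg_map inr) (g := h0)) => y.
  change (h (fg_map inr (fg_gen y)) = h0 (fg_gen y)).
  by rewrite fg_map_gen hinr /h0 fg_lift_gen.
have GE w : aut_ext (@inr_inj X Y) G (fg_map inl w) = fg_map inl w.
  apply: (fg_ext (f := aut_ext (@inr_inj X Y) G \o fg_map inl) (g := fg_map inl)) => y.
  change (aut_ext (@inr_inj X Y) G (fg_map inl (fg_gen y)) = fg_map inl (fg_gen y)).
  by rewrite fg_map_gen aut_ext_notin ?inl_notin_inr.
have hGh : (h^-1 * aut_ext (@inr_inj X Y) G * h)%g = aut_ext (@inr_inj X Y) G.
  rewrite -mulgA; apply: (mulgI h); rewrite !mulgA mulgV mul1g.
  apply: aut_gen_ext => -[i|y]; rewrite !autM_E.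
    by rewrite hinl -(fg_map_gen inl) GE fg_map_gen hinl.
  by rewrite hinr gmulfM GE !aut_ext_gen hh0 hG.
have <- : ract F h (contra_map F p x) = contra_map F (copair idfun f) x.
  apply: ract_contra => -[i|y]; first by rewrite hinl fg_ab_gen !copair_inl.
  by rewrite hinr fg_abM raddfD fg_ab_gen copair_inr copair_map_inl copair_inr fE add0r.
rewrite -{1}hGh bsymJ_fixed.
  by rewrite (bclass_absorb pF)// (reduced_zero rF) // !raddf0.
apply: ract_contra => -[i|y]; first by rewrite aut_ext_notin ?inl_notin_inr// fg_ab_gen.
by rewrite aut_ext_gen copair_map_inr copair_inr.
Qed.

End InnerClasses.
Global Opaque conj1 point inner_class.

(** * The diagonal decomposition *)

Section ConjSpan.
Variables (F : contraFunctor) (rF : reduced_functor F) (pF : polynomial_functor F).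

Definition inner_span (w : stable_barcoker F) := exists y, w = inner_class F y.

Lemma inner_span0 : inner_span 0.
Proof. by exists 0; rewrite raddf0. Qed.

Lemma inner_spanB v w : inner_span v -> inner_span w -> inner_span (v - w).
Proof. by move=> [x ->] [y ->]; exists (x - y); rewrite raddfB. Qed.

Lemma inner_spanN v : inner_span v -> inner_span (- v).
Proof. by rewrite -sub0r; apply: inner_spanB; exact: inner_span0. Qed.

Lemma inner_spanD v w : inner_span v -> inner_span w -> inner_span (v + w).
Proof. by move=> Pv /inner_spanN Pw; rewrite -(opprK w); exact: inner_spanB. Qed.

(** Since [u] avoids [P], the letters of [P] can be conjugated one after the other; each step
    contributes an inner class by [bclass_conj1]. *)
Lemma inner_span_conj (Y : finType) (A : freeAbType) (f : {additive zlat Y -> A})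
    (P : pred Y) (u : freeGroup Y) (Hu : forall y, P y -> avoids P u) (x : F A) :
  (forall y, P y -> f (zgen y) = 0) ->
  inner_span (bclass F Y (bsym F (conj_aut Hu) (contra_map F f x))).
Proof.
have [n leP] := ubnP #|P|; elim: n P Hu leP => // n IH P Hu leP fP.
have [t Pt|P0] := pickP P; last first.
  rewrite (_ : conj_aut Hu = 1%g) ?bsym1 ?raddf0; first exact: inner_span0.
  by apply: aut_gen_ext => y; rewrite conj_aut_out ?P0.
pose P' : pred Y := predD1 P t.
have Hu' y : P' y -> avoids P' u.
  by move=> _; apply: avoids_sub (Hu t Pt) => z /andP[].
have Ht : avoids (pred1 t) u by apply: avoids_sub (Hu t Pt) => z /eqP ->.
have -> : conj_aut Hu = (conj1 Ht * conj_aut Hu')%g.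
  apply: aut_gen_ext => y; rewrite autM_E; have [->|yt] := eqVneq y t.
    by rewrite conj_aut_in// conj_aut_out ?conj1E /P' /= eqxx.
  have [Py|Py] := boolP (P y).
    rewrite !conj_aut_in /P' /= ?yt// !gmulfM multV conj1E (negbTE yt).
    by rewrite !conj1_avoid.
  by rewrite !conj_aut_out ?conj1E ?(negbTE yt)// /P' /= (negbTE Py) andbF.
rewrite bsymM_fixed ?ract_conj1// raddfD; apply: inner_spanD.
  by rewrite bclass_conj1 ?fP//; eexists.
apply: IH => [|y /andP[_]]; last exact: fP.
by rewrite (cardD1 t) [t \in _]Pt in leP.
Qed.

End ConjSpan.

(** The generators are described by their values on letters, so that an automorphism qualifies by
    inspection of letters alone. *)
Inductive elem (X : finType) : autfg X -> Prop :=
| elem_transv (a : autfg X) i j : i != j -> a (fg_gen i) = (fg_gen i * fg_gen j)%g ->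
    (forall k, k != i -> a (fg_gen k) = fg_gen k) -> elem a
| elem_inv (a : autfg X) i : a (fg_gen i) = (fg_gen i)^-1%g ->
    (forall k, k != i -> a (fg_gen k) = fg_gen k) -> elem a
| elem_perm (a : autfg X) (p : {perm X}) : (forall k, a (fg_gen k) = fg_gen (p k)) -> elem a
| elemM a b : elem a -> elem b -> elem (a * b)%g
| elemV a : elem a -> elem a^-1%g.

Section InvAut.
Variables (X : choiceType) (P : pred X).

Definition inv_fun x : freeGroup X := if P x then (fg_gen x)^-1%g else fg_gen x.

Lemma inv_funK x : fg_lift inv_fun (inv_fun x) = fg_gen x.
Proof.
by rewrite {2}/inv_fun; case: ifP => Px; rewrite ?multV fg_lift_gen /inv_fun Px ?invgK.
Qed.

Definition inv_aut : autfg X := fg_aut inv_funK inv_funK.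

Lemma inv_autE x : inv_aut (fg_gen x) = if P x then (fg_gen x)^-1%g else fg_gen x.
Proof. exact: fg_autE. Qed.

End InvAut.
Global Opaque inv_aut.

Section Diagonal.
Variables (X : finType) (m : nat).
Local Notation Y := (X * 'I_m)%type.

Definition diag_fun (f : {multiplicative freeGroup X -> freeGroup X}) :
    {multiplicative freeGroup Y -> freeGroup Y} :=
  fg_lift (fun y => fg_map (fun i => (i, y.2)) (f (fg_gen y.1))).

Lemma diag_fun_gen f i s : diag_fun f (fg_gen (i, s)) = fg_map (fun i => (i, s)) (f (fg_gen i)).
Proof. exact: fg_lift_gen. Qed.

Lemma diag_fun_map f s w : diag_fun f (fg_map (fun i => (i, s)) w) = fg_map (fun i => (i, s)) (f w).
Proof.
apply: (fg_ext (f := diag_fun f \o fg_map (fun i => (i, s)))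
  (g := fg_map (fun i => (i, s)) \o f)) => i.
by apply: etrans (congr1 _ (fg_map_gen _ i)) _; rewrite diag_fun_gen.
Qed.

Lemma diag_funK (f g : {multiplicative freeGroup X -> freeGroup X}) :
  cancel f g -> cancel (diag_fun f) (diag_fun g).
Proof.
move=> fK; apply: (fg_ext (f := diag_fun g \o diag_fun f) (g := idfun)) => -[i s].
by apply: etrans (congr1 _ (diag_fun_gen f i s)) _; rewrite diag_fun_map fK fg_map_gen.
Qed.

Definition diag_aut (a : autfg X) : autfg Y :=
  MkAut (diag_funK (autK a)) (diag_funK (autVK a)).

Lemma diag_aut_gen (a : autfg X) i s :
  diag_aut a (fg_gen (i, s)) = fg_map (fun i => (i, s)) (a (fg_gen i)).
Proof. exact: diag_fun_gen. Qed.

Lemma diag_autM a b : diag_aut (a * b)%g = (diag_aut a * diag_aut b)%g.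
Proof.
apply: aut_gen_ext => -[i s]; rewrite autM_E !diag_aut_gen.
by rewrite [RHS]diag_fun_map.
Qed.

Definition proj_blocks (S : {set 'I_m}) : {additive zlat Y -> zlat X} :=
  zlift (fun y => if y.2 \in S then zgen y.1 else 0).

Lemma proj_blocks_gen S y : proj_blocks S (zgen y) = if y.2 \in S then zgen y.1 else 0.
Proof. exact: zlift_gen. Qed.

Lemma proj_blocks_map S s w :
  proj_blocks S (fg_ab (fg_map (fun i => (i, s)) w)) = if s \in S then fg_ab w else 0.
Proof.
rewrite -ab_mapE; move: (fg_ab w) => v.
pose q : {additive zlat X -> zlat X} :=
  if s \in S then idfun : {additive zlat X -> zlat X} else \0 : {additive zlat X -> zlat X}.
have -> : (if s \in S then v else 0) = q v by rewrite /q; case: ifP.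
move: v; apply: (zlat_ext (f := proj_blocks S \o ab_map (fg_map (fun i => (i, s))))) => i.
change (proj_blocks S (ab_map (fg_map (fun i => (i, s))) (zgen i)) = q (zgen i)).
by rewrite ab_map_gen fg_map_gen fg_ab_gen proj_blocks_gen /q; case: ifP.
Qed.

Lemma proj_blocks_diag S (a : autfg X) v :
  proj_blocks S (ab_map (diag_aut a) v) = ab_map a (proj_blocks S v).
Proof.
apply: (zlat_ext (f := proj_blocks S \o ab_map (diag_aut a))
  (g := ab_map a \o proj_blocks S)) => -[i s].
change (proj_blocks S (ab_map (diag_aut a) (zgen (i, s)))
  = ab_map a (proj_blocks S (zgen (i, s)))).
rewrite ab_map_gen diag_aut_gen proj_blocks_map proj_blocks_gen/=.
by case: ifP => _; rewrite ?raddf0 ?ab_map_gen.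
Qed.

End Diagonal.
Global Opaque proj_blocks diag_aut.

Section Decomposition.
Variables (F : contraFunctor) (X : finType) (m : nat) (S : {set 'I_m}) (s : 'I_m).
Hypothesis sS : s \in S.
Local Notation Y := (X * 'I_m)%type.

Definition act_blocks (y : Y) := (y.2 \in S) && (y.2 != s).

Lemma avoids_block_gen (y : Y) : act_blocks y -> avoids act_blocks (fg_gen (y.1, s)).
Proof. by move=> _; apply: avoids_gen; rewrite /act_blocks eqxx andbF. Qed.

(** Chosen so that the projection to the block [s], pulled back along it, becomes the sum of the
    projections to the blocks in [S]. *)
Definition blend : autfg Y := mult_aut (fun _ _ => @avoids1 _ act_blocks) avoids_block_gen.

Lemma blendE i s' : blend (fg_gen (i, s'))
  = if (s' \in S) && (s' != s) then (fg_gen (i, s') * fg_gen (i, s))%g else fg_gen (i, s').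
Proof.
have [h|h] := boolP (act_blocks (i, s')).
  by rewrite mult_aut_in// mul1g; move: h; rewrite /act_blocks/= => ->.
by rewrite mult_aut_out//; move: h; rewrite /act_blocks/= => /negbTE ->.
Qed.

Local Opaque blend.

Lemma block_inj : injective (fun i : X => (i, s)).
Proof. by move=> i j []. Qed.

Local Notation rho1 := (aut_ext block_inj).
Local Notation p1 := (contra_map F (proj_blocks X [set s])).

Lemma notin_block i s' : (s' != s) -> (i, s') \notin codom (fun i : X => (i, s)).
Proof. by move=> ss; apply/codomP => -[j [_ e]]; rewrite e eqxx in ss. Qed.

Lemma proj_inj_block : proj_inj (fun i : X => (i, s)) =1 proj_blocks X [set s].
Proof.
apply: zlat_ext => -[i s']; rewrite proj_blocks_gen /= inE.
case: eqP => [->|/eqP ss]; first by rewrite (proj_inj_gen block_inj).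
by rewrite proj_inj_notin// notin_block.
Qed.

Lemma ract_rho1 g x : ract F (rho1 g) (p1 x) = p1 (ract F g x).
Proof.
rewrite -(contra_ext _ proj_inj_block) -(contra_ext _ proj_inj_block).
by apply: ract_map => a v; exact: proj_inj_ext.
Qed.

Lemma ract_diag g x : ract F (diag_aut m g) (contra_map F (proj_blocks X S) x)
  = contra_map F (proj_blocks X S) (ract F g x).
Proof. by apply: ract_map => a v; exact: proj_blocks_diag. Qed.

Lemma ract_blend x : ract F blend (p1 x) = contra_map F (proj_blocks X S) x.
Proof.
apply: ract_contra => -[i s']; rewrite blendE.
have [h|h] := boolP (_ && _).
  case/andP: h => s'S s's; rewrite !fg_abE raddfD !proj_blocks_gen /= !inE eqxx.
  by rewrite s'S (negbTE s's) add0r.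
rewrite fg_ab_gen !proj_blocks_gen /= inE; case: eqP h => [->|_]; first by rewrite sS.
by rewrite andbT => /negbTE ->.
Qed.

(** The discrepancy between the diagonal action, conjugated by [blend], and the
    action on the single block [s]. *)
Definition defect (g : autfg X) : autfg Y :=
  ((rho1 g)^-1 * (blend * diag_aut m g * blend^-1))%g.

Lemma ract_conj_diag g x : ract F (blend * diag_aut m g * blend^-1)%g (p1 x) = p1 (ract F g x).
Proof.
by rewrite (ractM (blend * diag_aut m g)%g) (ractM blend) ract_blend ract_diag -ract_blend ractK.
Qed.

Lemma ract_defect g x : ract F (defect g) (p1 x) = p1 x.
Proof.
rewrite ractM -{1}(ractVK g x) -ract_rho1 ractK.
by rewrite ract_conj_diag ractVK.
Qed.

Lemma defectM g g' : defect (g * g')%g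
  = ((rho1 g')^-1 * defect g * rho1 g' * defect g')%g.
Proof. by rewrite /defect aut_extM diag_autM invMg !mulgA mulgK !mulgKV. Qed.

Lemma defect_diag g : (rho1 g * defect g)%g = (blend * diag_aut m g * blend^-1)%g.
Proof. by rewrite /defect mulKVg. Qed.

Local Opaque defect.

(** By [defectM], [defect g] enters conjugated by [rho1 g']. This conjugation moves its coefficient
    exactly as [ract F g'] does, and leaves no boundary term because the coefficient is fixed by
    [defect g]. *)
Lemma defect_map_subproof g g' x :
  (bsym F (defect (g * g')%g) \o p1 \o ract F (g * g')%g : {additive _ -> _}) x
  = (bsym F (defect g) \o p1 \o ract F g : {additive _ -> _}) x
  + (bsym F (defect g') \o p1 \o ract F g' : {additive _ -> _}) (ract F g x).
Proof.
change (bsym F (defect (g * g')%g) (p1 (ract F (g * g')%g x))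
  = bsym F (defect g) (p1 (ract F g x)) + bsym F (defect g') (p1 (ract F g' (ract F g x)))).
rewrite (ractM g g').
rewrite defectM.
rewrite -(ract_rho1 g').
rewrite (bsymM ((rho1 g')^-1 * defect g * rho1 g')%g).
rewrite (bsymJ_fixed (rho1 g') (ract_defect g _)); congr (_ + _).
rewrite (ractM ((rho1 g')^-1 * defect g)%g) (ractM (rho1 g')^-1%g) ractK.
by rewrite ract_defect.
Qed.

Definition defect_map : {additive barcoker F X -> barcoker F Y} :=
  barcoker_lift defect_map_subproof.

Lemma defect_mapE g x : defect_map (bsym F g x) = bsym F (defect g) (p1 (ract F g x)).
Proof. by rewrite [LHS]barcoker_liftE. Qed.

Definition diag_map : {additive barcoker F X -> barcoker F Y} :=
  barcoker_map F (@diag_autM X m) (@proj_blocks_diag X m S).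

(** The diagonal action conjugated by [blend] is [rho1 g * defect g], which yields the first two
    terms on symbols. Undoing the conjugation costs the boundary term of [bsymJ], the third one. *)
Lemma diag_map_decomp z : diag_map z
  = stab_map F block_inj z + defect_map z + bsym F blend (p1 (cbd z)).
Proof.
apply: (barcoker_ext (f := diag_map)
  (f' := stab_map F block_inj \+ defect_map \+ (bsym F blend \o p1 \o cbd))) => g x.
change (diag_map (bsym F g x) = stab_map F block_inj (bsym F g x)
  + defect_map (bsym F g x) + bsym F blend (p1 (cbd (bsym F g x)))).
rewrite stab_mapE defect_mapE cbdE [LHS]barcoker_mapE -ract_blend.
rewrite (contra_ext _ proj_inj_block).
have -> : bsym F (rho1 g) (p1 x) + bsym F (defect g) (p1 (ract F g x))
    = bsym F (blend * diag_aut m g * blend^-1)%g (p1 x).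
  by rewrite -ract_rho1 -bsymM defect_diag.
rewrite raddfB -ract_conj_diag -bsymJ; congr (bsym F _ _).
by rewrite !mulgA mulVg mul1g mulgKV.
Qed.

End Decomposition.

(** * Defects of the elementary generators *)

Section DefectGenerators.
Variables (F : contraFunctor) (rF : reduced_functor F) (pF : polynomial_functor F).
Variables (X : finType) (m : nat) (S : {set 'I_m}) (s : 'I_m).
Hypothesis sS : s \in S.
Local Notation Y := (X * 'I_m)%type.
Local Notation p1 := (contra_map F (proj_blocks X [set s])).
Local Notation rho1 := (aut_ext (@block_inj X m s)).
Local Notation bl := (blend X S s).
Local Notation df := (defect S s).

(** Multiplying the definition of [defect] by [rho1 a] and [blend] clears both inverses, so that
    letters can be compared directly. *)
Lemma defect_eq (a : autfg X) (k : autfg Y) :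
  (forall y, rho1 a (k (bl (fg_gen y))) = bl (diag_aut m a (fg_gen y))) -> df a = k.
Proof.
move=> h; apply: (mulgI (rho1 a)); rewrite defect_diag; apply: (mulIg bl).
by rewrite mulgKV; apply/esym/aut_gen_ext => y; rewrite !autM_E h.
Qed.

Lemma rho1_in (a : autfg X) i : rho1 a (fg_gen (i, s)) = fg_map (fun i => (i, s)) (a (fg_gen i)).
Proof. exact: (aut_ext_gen (@block_inj X m s)). Qed.

Lemma rho1_out (a : autfg X) i s' : s' != s -> rho1 a (fg_gen (i, s')) = fg_gen (i, s').
Proof. by move=> ss; rewrite aut_ext_notin// notin_block. Qed.

(** The shear of [bclass_shear0] multiplies the block [s] by letters of [X], and its coefficient is
    [p1 x]. [G] commutes with it since [G] fixes this block and keeps it out of the images of the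
    other letters. *)
Lemma block_shear0 (G : autfg Y) (x : F (zlat X)) :
  (forall i, G (fg_gen (i, s)) = fg_gen (i, s)) ->
  (forall i s', s' != s -> avoids (fun y : Y => y.2 == s) (G (fg_gen (i, s')))) ->
  bclass F Y (bsym F G (p1 x)) = 0.
Proof.
move=> Gs Gn; pose l (y : Y) : freeGroup X := if y.2 == s then fg_gen y.1 else 1%g.
rewrite -(bclass_shear0 rF pF (G := G) (l := l) x).
  congr (bclass F Y (bsym F G _)); apply: contra_zext => y.
  by rewrite proj_blocks_gen zlift_gen inE /l; case: ifP => _; rewrite ?fg_abE.
move=> -[i s']; have [->|ss] := eqVneq s' s; first by rewrite Gs fg_lift_gen fg_map_gen.
rewrite {2}/l /= (negbTE ss) mult1 mulg1.
apply: (avoids_eq (Gn _ _ ss)) => -[j t] /= ts.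
by rewrite fg_lift_gen fg_map_gen /l /= (negbTE ts) mult1 mulg1.
Qed.

(** The defect applies [p] in all blocks except [s], which it fixes, so its class is zero by
    [block_shear0]. *)
Lemma good_perm (a : autfg X) (p : {perm X}) x : (forall k, a (fg_gen k) = fg_gen (p k)) ->
  inner_span (bclass F Y (bsym F (df a) (p1 x))).
Proof.
move=> ap; pose qf (y : Y) := if y.2 == s then y else (p y.1, y.2).
have qi : injective qf.
  move=> [i u] [j v]; rewrite /qf /=; case: eqP => [->|us]; case: eqP => [->|vs].
  - by [].
  - by case=> _ /esym.
  - by case=> _ e; case: us.
  by case=> /perm_inj -> ->.
pose G := perm_aut (perm qi).
have GE y : G (fg_gen y) = fg_gen (qf y) by rewrite perm_autE permE.
have -> : df a = G.
  apply: defect_eq => -[i s']; rewrite diag_aut_gen ap fg_map_gen !blendE.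
  have [->|ss] := eqVneq s' s; first by rewrite andbF GE /qf eqxx rho1_in ap fg_map_gen.
  case: ifP => _; last by rewrite GE /qf /= (negbTE ss) (rho1_out _ _ ss).
  rewrite gmulfM !GE /qf /= (negbTE ss) eqxx gmulfM (rho1_out _ _ ss).
  by rewrite rho1_in ap fg_map_gen.
rewrite block_shear0 => [|i|i s' ss]; first exact: inner_span0.
  by rewrite GE /qf eqxx.
by rewrite GE /qf /= (negbTE ss); apply: avoids_gen.
Qed.

(** The defect is [C * I]: [I] inverts the letters [(i, s')] outside the block [s], and has zero
    class; [C] conjugates those with [s'] in [S] by the letter [(i, s)], and gives an inner
    class. *)
Lemma good_inv (a : autfg X) i x : a (fg_gen i) = (fg_gen i)^-1%g ->
  (forall k, k != i -> a (fg_gen k) = fg_gen k) ->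
  inner_span (bclass F Y (bsym F (df a) (p1 x))).
Proof.
move=> ai ak; pose P (y : Y) := (y.1 == i) && act_blocks S s y.
have Pu y : P y -> avoids P (fg_gen (i, s)).
  by move=> _; apply: avoids_gen; rewrite /P /act_blocks /= !eqxx !andbF.
pose C := conj_aut Pu; pose I := inv_aut (fun y : Y => (y.1 == i) && (y.2 != s)).
have IE y : I (fg_gen y) = if (y.1 == i) && (y.2 != s) then (fg_gen y)^-1%g else fg_gen y.
  exact: inv_autE.
have Cout y : ~~ P y -> C (fg_gen y) = fg_gen y by exact: conj_aut_out.
have Cin y : P y -> C (fg_gen y) = (fg_gen (i, s) * fg_gen y * (fg_gen (i, s))^-1)%g.
  exact: conj_aut_in.
have PsF k : ~~ P (k, s) by rewrite /P /act_blocks /= eqxx !andbF.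
have -> : df a = (C * I)%g.
  apply: defect_eq => -[k s']; rewrite diag_aut_gen autM_E blendE.
  have [->|ss] := eqVneq s' s.
    rewrite andbF IE /= eqxx andbF Cout// rho1_in.
    have [->|ki] := eqVneq k i; first by rewrite ai multV fg_map_gen multV blendE eqxx andbF.
    by rewrite ak// fg_map_gen blendE eqxx andbF.
  have [->|ki] := eqVneq k i; last first.
    have Pk : ~~ P (k, s') by rewrite /P /= (negbTE ki).
    rewrite ak// fg_map_gen blendE ss andbT; case: ifP => s'S; last first.
      by rewrite IE /= (negbTE ki) Cout// (rho1_out _ _ ss).
    rewrite gmulfM !IE /= (negbTE ki) /= gmulfM !Cout// gmulfM (rho1_out _ _ ss) rho1_in.
    by rewrite ak// fg_map_gen.
  have IB : I (fg_gen (i, s')) = (fg_gen (i, s'))^-1%g by rewrite IE /= eqxx ss.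
  have IA : I (fg_gen (i, s)) = fg_gen (i, s) by rewrite IE /= !eqxx.
  have rA : rho1 a (fg_gen (i, s)) = (fg_gen (i, s))^-1%g.
    by rewrite rho1_in ai multV fg_map_gen.
  have rB := rho1_out a i ss.
  rewrite ai multV fg_map_gen multV blendE ss andbT; case: ifP => s'S.
    have PB : P (i, s') by rewrite /P /act_blocks /= eqxx s'S ss.
    rewrite gmulfM IB IA gmulfM multV (Cin _ PB) (Cout _ (PsF i)).
    by rewrite !gmulfM !multV !gmulfM !multV rA rB !invMg !invgK !mulgA mulgK.
  have PB : ~~ P (i, s') by rewrite /P /act_blocks /= s'S andbF.
  by rewrite IB multV (Cout _ PB) multV rB.
rewrite bsymM_fixed ?ract_conj_aut// raddfD; apply: inner_spanD.
  apply: inner_span_conj => // y /andP[_ /andP[_ ys]].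
  by rewrite proj_blocks_gen inE (negbTE ys).
rewrite block_shear0 => [|k|k s' ss]; first exact: inner_span0.
  by rewrite IE /= eqxx andbF.
by rewrite IE /=; case: ifP => _; [apply: avoidsV|]; apply: avoids_gen.
Qed.

(** The defect is the conjugate by [C] of [T], the transvection in all blocks except [s]. Both fix
    the coefficient, so the two symbols of [C] cancel, and [T] has zero class by [block_shear0]. *)
Lemma good_transv (a : autfg X) i j x : i != j -> a (fg_gen i) = (fg_gen i * fg_gen j)%g ->
  (forall k, k != i -> a (fg_gen k) = fg_gen k) ->
  inner_span (bclass F Y (bsym F (df a) (p1 x))).
Proof.
move=> ij ai ak; pose P (y : Y) := (y.1 == j) && act_blocks S s y.
(* [rho1 a] sends [u] to the letter [(i, s)]: this is what the criterion of [defect_eq] demands at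
   the letters [(i, s')] with [s'] in [S]. *)
have [u uE] : exists u : freeGroup Y, u = (fg_gen (i, s) * (fg_gen (j, s))^-1)%g.
  by eexists.
have PsF k : ~~ P (k, s) by rewrite /P /act_blocks /= eqxx !andbF.
have Au : avoids P u by rewrite uE; apply: avoidsM; [|apply: avoidsV]; apply: avoids_gen.
have Pu y : P y -> avoids P u by [].
pose C := conj_aut Pu.
have Cout y : ~~ P y -> C (fg_gen y) = fg_gen y by exact: conj_aut_out.
have Cin y : P y -> C (fg_gen y) = (u * fg_gen y * u^-1)%g by exact: conj_aut_in.
have Cu : C u = u by exact: conj_aut_avoid.
pose Q (y : Y) := (y.1 == i) && (y.2 != s).
have Hr y : Q y -> avoids Q (fg_gen (j, y.2)).
  by move=> _; apply: avoids_gen; rewrite /Q /= eq_sym (negbTE ij).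
pose T := mult_aut (fun _ _ => @avoids1 _ Q) Hr.
have Tin y : Q y -> T (fg_gen y) = (fg_gen y * fg_gen (j, y.2))%g.
  by move=> Qy; rewrite mult_aut_in// mul1g.
have Tout y : ~~ Q y -> T (fg_gen y) = fg_gen y by exact: mult_aut_out.
have QsF k : ~~ Q (k, s) by rewrite /Q /= eqxx !andbF.
have CVin y : P y -> C^-1%g (fg_gen y) = (u^-1 * fg_gen y * u)%g.
  move=> Py; apply: (can_inj (autKg C)); rewrite autVKg !gmulfM multV Cu Cin//.
  by rewrite !mulgA mulVg mul1g mulgKV.
have CVout y : ~~ P y -> C^-1%g (fg_gen y) = fg_gen y.
  by move=> Py; apply: (can_inj (autKg C)); rewrite autVKg Cout.
have -> : df a = (C * T * C^-1)%g.
  apply: defect_eq => -[k s']; rewrite diag_aut_gen !autM_E blendE.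
  have rS t : t != i -> rho1 a (fg_gen (t, s)) = fg_gen (t, s).
    by move=> ti; rewrite rho1_in ak// fg_map_gen.
  have rI : rho1 a (fg_gen (i, s)) = (fg_gen (i, s) * fg_gen (j, s))%g.
    by rewrite rho1_in ai gmulfM !fg_map_gen.
  have ji : j != i by rewrite eq_sym.
  have [->|ss] := eqVneq s' s.
    rewrite andbF (CVout _ (PsF k)) (Tout _ (QsF k)) (Cout _ (PsF k)).
    have [->|ki] := eqVneq k i; last by rewrite rS// ak// fg_map_gen blendE eqxx andbF.
    by rewrite rI ai gmulfM !fg_map_gen gmulfM !blendE eqxx !andbF.
  have rB t := rho1_out a t ss.
  have QF t : t != i -> ~~ Q (t, s') by rewrite /Q /= => /negbTE ->.
  have QI : Q (i, s') by rewrite /Q /= eqxx ss.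
  have TI := Tin _ QI.
  rewrite andbT; have [s'S|s'S] := boolP (s' \in S); last first.
    have Pn t : ~~ P (t, s') by rewrite /P /act_blocks /= (negbTE s'S) andbF.
    rewrite CVout//; have [->|ki] := eqVneq k i; last first.
      by rewrite (Tout _ (QF _ ki)) (Cout _ (Pn k)) rB ak// fg_map_gen blendE (negbTE s'S).
    rewrite TI ai !gmulfM !fg_map_gen !blendE (negbTE s'S) /= !Cout//.
    by rewrite !rB.
  have Pj : P (j, s') by rewrite /P /act_blocks /= eqxx s'S ss.
  have Pn t : t != j -> ~~ P (t, s') by rewrite /P /= => /negbTE ->.
  rewrite !gmulfM (CVout _ (PsF k)) (Tout _ (QsF k)) (Cout _ (PsF k)).
  have [->|kj] := eqVneq k j.
    have Tu : T u = u by rewrite uE gmulfM multV (Tout _ (QsF i)) (Tout _ (QsF j)).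
    have -> : C (T (C^-1%g (fg_gen (j, s')))) = fg_gen (j, s').
      rewrite (CVin _ Pj) !gmulfM !multV Tu (Tout _ (QF _ ji)) Cu (Cin _ Pj).
      by rewrite !mulgA mulVg mul1g mulgKV.
    by rewrite rB rS// ak// fg_map_gen blendE s'S ss.
  rewrite (CVout _ (Pn _ kj)).
  have [->|ki] := eqVneq k i; last first.
    rewrite (Tout _ (QF _ ki)) (Cout _ (Pn _ kj)) rB rS//.
    by rewrite ak// !fg_map_gen blendE s'S ss.
  rewrite TI gmulfM (Cin _ Pj) (Cout _ (Pn _ ij)) uE !(gmulfM, multV) rI rS// !rB.
  rewrite ai !gmulfM !fg_map_gen !blendE s'S ss /=.
  by rewrite mulgK !mulgA mulgKV.
have pT : ract F T (p1 x) = p1 x.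
  apply: ract_contra => -[k s']; have [Qk|Qk] := boolP (Q (k, s')); last by rewrite Tout ?fg_ab_gen.
  rewrite (Tin _ Qk) fg_abM !fg_ab_gen raddfD !proj_blocks_gen !inE /=.
  by case/andP: Qk => /= _ /negbTE ->; rewrite addr0.
have pC : ract F C (p1 x) = p1 x by exact: ract_conj_aut.
have -> : bsym F (C * T * C^-1)%g (p1 x) = bsym F T (p1 x).
  have pCT : ract F (C * T)%g (p1 x) = p1 x by rewrite (ractM C T) pC pT.
  rewrite (bsymM (C * T)%g C^-1%g) pCT (bsymM C T) pC addrAC -{2}pC -(bsymM C C^-1%g).
  by rewrite mulgV bsym1 add0r.
rewrite block_shear0 => [|k|k s' ss]; first exact: inner_span0.
  by rewrite Tout.
have sg t : avoids (fun y : Y => y.2 == s) (fg_gen (t, s')) by exact: avoids_gen.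
have [Qk|Qk] := boolP (Q (k, s')); last by rewrite Tout.
by rewrite (Tin _ Qk); apply: avoidsM.
Qed.

Lemma good_elem (a : autfg X) : elem a ->
  forall x, inner_span (bclass F Y (defect_map F X sS (bsym F a x))).
Proof.
elim=> [{}a i j ij ai ak x|{}a i ai ak x|{}a p ap x|b c _ hb _ hc x|b _ hb x].
- by rewrite defect_mapE; apply: good_transv ij ai ak.
- by rewrite defect_mapE; apply: good_inv ai ak.
- by rewrite defect_mapE; apply: good_perm ap.
- by rewrite bsymM !raddfD; apply: inner_spanD.
have -> : bsym F b^-1%g x = - bsym F b (ract F b^-1%g x).
  apply/eqP; rewrite -addr_eq0 addrC -{2}(ractVK b x) -(bsymM b b^-1%g).
  by rewrite mulgV bsym1.
by rewrite !raddfN; apply: inner_spanN.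
Qed.

End DefectGenerators.

Inductive elem_span (F : contraFunctor) (X : finType) : barcoker F X -> Prop :=
| elem_span0 : elem_span 0
| elem_spanD (g : autfg X) x d : elem g -> elem_span d -> elem_span (bsym F g x + d).

(** Up to inner classes, all the diagonal maps to [X * 'I_m] with nonempty [S]
    have the same effect on the stable class of a cycle. *)
Lemma elem_span_inner (F : contraFunctor) (rF : reduced_functor F) (pF : polynomial_functor F)
    (X : finType) (d : barcoker F X) :
  elem_span d -> cbd d = 0 -> inner_span (bclass F X d).
Proof.
move=> ed d0; have [m m0 dev] := polynomial_deviation pF.
pose R (S : {set 'I_m}) := diag_map F X S d.
have R_sum : \sum_(S : {set 'I_m}) R S *~ (-1) ^+ #|S| = 0.
  pose D := \sum_(S : {set 'I_m}) R S *~ (-1) ^+ #|S|.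
  rewrite -/D /D /R {D R d0}; elim: ed => [|g x d' _ _ IH].
    by rewrite big1// => S _; rewrite raddf0 mul0rz.
  under eq_bigr do rewrite raddfD mulrzDl.
  rewrite big_split /= IH addr0.
  pose b (s : 'I_m) : {additive zlat (X * 'I_m)%type -> zlat X} :=
    zlift (fun y => if y.2 == s then zgen y.1 else 0).
  have qS S v : proj_blocks X S v = (\0 : {additive _ -> _}) v + \sum_(s in S) b s v.
    pose q0 : {additive zlat (X * 'I_m)%type -> zlat X} := zlift (fun=> 0).
    have -> : (\0 : {additive zlat (X * 'I_m)%type -> zlat X}) v = q0 v.
      by apply: (zlat_ext (f := \0)) => y; rewrite zlift_gen.
    rewrite -(zlift_sum (f := fun y => proj_blocks X S (zgen y))).
      by apply: (zlat_ext (f := proj_blocks X S)) => y; rewrite zlift_gen.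
    move=> [i s]; rewrite proj_blocks_gen add0r /=; case: ifP => sS.
      rewrite (bigD1 s)//= eqxx big1 ?addr0// => s' /andP[_ ss'].
      by rewrite eq_sym (negbTE ss').
    by rewrite big1// => s' s'S; case: eqP => // e; rewrite e s'S in sS.
  have := dev _ _ _ b (fun S => proj_blocks X S) x qS.
  move=> /(congr1 (bsym F (diag_aut m g))); rewrite raddf_sum raddf0 => e; apply: etrans e.
  by apply: eq_bigr => S _; rewrite raddfMz [in LHS]barcoker_mapE.
(* The projection for the empty set is zero, hence so is [R set0], and the difference is minus the
   class of [d]. *)
suff : inner_span (bclass F (X * 'I_m)%type (R set0) - bclass F X d).
  have -> : R set0 = 0.
    rewrite /R; elim: ed {d0 R_sum R} => [|g x d' _ _ IH]; first by rewrite raddf0.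
    rewrite raddfD IH addr0 [LHS]barcoker_mapE (reduced_zero rF) ?raddf0// => v.
    apply: (zlat_ext (f := proj_blocks X set0) (g := \0)) => y.
    by rewrite proj_blocks_gen inE.
  by rewrite raddf0 sub0r => /inner_spanN; rewrite opprK.
apply: (alternating_sum_sub (P := @inner_span F) (f := bclass F (X * 'I_m)%type \o R) m0).
- exact: inner_span0.
- exact: inner_spanB.
- move: R_sum => /(congr1 (bclass F (X * 'I_m)%type)); rewrite raddf_sum raddf0 => e.
  by apply: etrans e; apply: eq_bigr => S _; rewrite raddfMz.
(* On the cycle [d] the boundary term vanishes and the stabilized term has the class of [d]. The
   remaining defect is additive in the symbols of [d], which need not be cycles one by one. *)
move=> S /set0Pn[s sS] /=; rewrite /R (diag_map_decomp sS) d0 !raddf0 addr0 raddfD.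
rewrite bclass_stab// addrC addKr.
elim: ed => [|g x d' eg _ IH]; first by rewrite !raddf0; exact: inner_span0.
by rewrite !raddfD; apply: inner_spanD => //; exact: good_elem.
Qed.

(** * Stable generation by elementary automorphisms *)

Section ElementaryTheory.
Variable X : finType.
Implicit Types (a b : autfg X).

Lemma elem1 : elem (1%g : autfg X).
Proof. by apply: (elem_perm (p := 1%g)) => k; rewrite perm1. Qed.

Lemma elem_perm_aut (p : {perm X}) : elem (perm_aut p).
Proof. by apply: (elem_perm (p := p)) => k; rewrite perm_autE. Qed.

Lemma elem_mulrE a b : elem b -> elem (a * b)%g -> elem a.
Proof. by move=> eb eab; rewrite -(mulgK b a); apply: elemM => //; apply: elemV. Qed.

Lemma elem_mullE a b : elem a -> elem (a * b)%g -> elem b.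
Proof. by move=> ea eab; rewrite -(mulKg a b); apply: elemM => //; apply: elemV. Qed.

(** Pieces of [w] could involve [i]. The induction therefore runs over all words [u] with [k u] as
    multiplier, where [k] kills the letter [i]; finally [k w = w]. *)
Lemma elem_mulr a i (w : freeGroup X) : avoids (pred1 i) w ->
  a (fg_gen i) = (fg_gen i * w)%g -> (forall k, k != i -> a (fg_gen k) = fg_gen k) -> elem a.
Proof.
pose k := fg_lift (fun x => if x == i then 1%g else fg_gen x : freeGroup X).
have kE x : k (fg_gen x) = if x == i then 1%g else fg_gen x by exact: fg_lift_gen.
have ka u : avoids (pred1 i) (k u).
  move=> f hf; apply: (fg_ext (f := f \o k) (g := k)) => x.
  change (f (k (fg_gen x)) = k (fg_gen x)); rewrite kE.
  by case: ifPn => xi; rewrite ?mult1// hf.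
have tvM u v : avoids (pred1 i) u -> avoids (pred1 i) v ->
  (forall b, b (fg_gen i) = (fg_gen i * u)%g ->
     (forall k, k != i -> b (fg_gen k) = fg_gen k) -> elem b) ->
  (forall b, b (fg_gen i) = (fg_gen i * v)%g ->
     (forall k, k != i -> b (fg_gen k) = fg_gen k) -> elem b) ->
  (forall b, b (fg_gen i) = (fg_gen i * (u * v))%g ->
     (forall k, k != i -> b (fg_gen k) = fg_gen k) -> elem b).
  move=> hu hv eu ev b bi bk.
  have Hr w' : avoids (pred1 i) w' -> forall x, pred1 i x -> avoids (pred1 i) w' by [].
  pose m w' (h : avoids (pred1 i) w') := mult_aut (fun _ _ => @avoids1 _ (pred1 i)) (Hr w' h).
  have mi w' h : m w' h (fg_gen i) = (fg_gen i * w')%g by rewrite mult_aut_in ?mul1g/=.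
  have mk w' h x : x != i -> m w' h (fg_gen x) = fg_gen x by move=> xi; exact: mult_aut_out.
  rewrite (_ : b = (m u hu * m v hv)%g).
    by apply: elemM; [apply: eu => [|x]|apply: ev => [|x]]; rewrite ?mi//; apply: mk.
  apply: aut_gen_ext => x; rewrite autM_E; have [->|xi] := eqVneq x i.
    by rewrite bi mi gmulfM mi -mulgA; congr (_ * (_ * _))%g; rewrite (hv (m u hu))// => y; apply: mk.
  by rewrite bk// !mk.
have ev u : forall b, b (fg_gen i) = (fg_gen i * k u)%g ->
     (forall k, k != i -> b (fg_gen k) = fg_gen k) -> elem b.
  elim/fg_ind: u => [|x u IH|x u IH].
  - move=> b; rewrite mult1 mulg1 => bi bk; rewrite (_ : b = 1%g); first exact: elem1.
    by apply: aut_gen_ext => x; have [->|/bk] := eqVneq x i.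
  - rewrite gmulfM; apply: tvM => // b; rewrite kE; case: ifPn => [_|xi].
      rewrite mulg1 => bi bk; rewrite (_ : b = 1%g); first exact: elem1.
      by apply: aut_gen_ext => y; have [->|/bk] := eqVneq y i.
    by move=> bi bk; apply: (elem_transv (i := i) (j := x)); rewrite // eq_sym.
  rewrite gmulfM; apply: tvM => // b; rewrite multV kE; case: ifPn => [_|xi].
    rewrite invg1 mulg1 => bi bk; rewrite (_ : b = 1%g); first exact: elem1.
    by apply: aut_gen_ext => y; have [->|/bk] := eqVneq y i.
  move=> bi bk; rewrite -(invgK b); apply: elemV.
  apply: (elem_transv (i := i) (j := x)); first by rewrite eq_sym.
    apply: (can_inj (autKg b)); rewrite autVKg gmulfM bi bk//.
    by rewrite mulgKV.
  by move=> y yi; apply: (can_inj (autKg b)); rewrite autVKg bk.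
move=> hw ai ak; apply: (ev w) => //; rewrite ai; congr (_ * _)%g.
by rewrite hw// => x /= xi; rewrite kE (negbTE xi).
Qed.

Lemma elem_inv_aut (P : pred X) : elem (inv_aut P).
Proof.
have [n leP] := ubnP #|P|; elim: n P leP => // n IH P leP.
have [t Pt|P0] := pickP P; last first.
  rewrite (_ : inv_aut P = 1%g); first exact: elem1.
  by apply: aut_gen_ext => y; rewrite inv_autE P0.
rewrite (_ : inv_aut P = (inv_aut (pred1 t) * inv_aut (predD1 P t))%g).
  apply: elemM; last by apply: IH; rewrite (cardD1 t) [t \in _]Pt in leP.
  by apply: (elem_inv (i := t)) => [|k kt]; rewrite inv_autE/= ?eqxx// (negbTE kt).
apply: aut_gen_ext => y; rewrite autM_E !inv_autE /=.
have [->|yt] := eqVneq y t; first by rewrite inv_autE /= eqxx Pt.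
by case: (P y); rewrite ?multV inv_autE /= (negbTE yt).
Qed.

(** Inverting the letter [i] before and after exchanges left multiplication by [w] with right
    multiplication by its inverse. *)
Lemma elem_mull a i (w : freeGroup X) : avoids (pred1 i) w ->
  a (fg_gen i) = (w * fg_gen i)%g -> (forall k, k != i -> a (fg_gen k) = fg_gen k) -> elem a.
Proof.
move=> hw ai ak; pose I := inv_aut (pred1 i).
have Ii : I (fg_gen i) = (fg_gen i)^-1%g by rewrite inv_autE /= eqxx.
have Ik x : x != i -> I (fg_gen x) = fg_gen x by move=> xi; rewrite inv_autE /= (negbTE xi).
have Iw : I w = w by rewrite hw.
have eI : elem I by exact: elem_inv_aut.
apply: (elem_mulrE eI); apply: (elem_mullE eI).
apply: (elem_mulr (i := i) (w := w^-1%g)); first exact: avoidsV.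
  by rewrite !autM_E Ii multV ai invMg gmulfM multV Ii multV Iw invgK.
by move=> x xi; rewrite !autM_E Ik// ak// Ik.
Qed.

(** The multipliers avoid [P], so letters can be treated one at a time, and the left factor apart
    from the right one. *)
Lemma elem_mult_aut (P : pred X) (l r : X -> freeGroup X)
    (Hl : forall x, P x -> avoids P (l x)) (Hr : forall x, P x -> avoids P (r x)) :
  elem (mult_aut Hl Hr).
Proof.
have [n leP] := ubnP #|P|; elim: n P Hl Hr leP => // n IH P Hl Hr leP.
have [t Pt|P0] := pickP P; last first.
  rewrite (_ : mult_aut Hl Hr = 1%g); first exact: elem1.
  by apply: aut_gen_ext => y; rewrite mult_aut_out ?P0.
pose P' : pred X := predD1 P t.
have sub u : avoids P u -> avoids P' u by apply: avoids_sub => z /andP[].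
have Hl' y : P' y -> avoids P' (l y) by move=> /andP[_ /Hl/sub].
have Hr' y : P' y -> avoids P' (r y) by move=> /andP[_ /Hr/sub].
have sub1 u : avoids P u -> avoids (pred1 t) u by apply: avoids_sub => z /eqP ->.
have L1 y : pred1 t y -> avoids (pred1 t) (l y) by move=> /eqP ->; apply/sub1/Hl.
have R1 y : pred1 t y -> avoids (pred1 t) (r y) by move=> /eqP ->; apply/sub1/Hr.
have one (y : X) : pred1 t y -> avoids (pred1 t) 1%g by move=> _; exact: avoids1.
have -> : mult_aut Hl Hr = ((mult_aut L1 one * mult_aut one R1) * mult_aut Hl' Hr')%g.
  apply: aut_gen_ext => y; rewrite !autM_E; have [->|yt] := eqVneq y t.
    rewrite mult_aut_in// mult_aut_out ?/P' /= ?eqxx//.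
    rewrite mult_aut_in /= ?eqxx// mul1g gmulfM mult_aut_in /= ?eqxx// mulg1.
    by rewrite mult_aut_avoid//; apply: R1 => /=.
  have fix1 u : P y -> avoids P u -> mult_aut L1 one (mult_aut one R1 u) = u.
    by move=> _ /sub1 h; rewrite !mult_aut_avoid.
  have [Py|Py] := boolP (P y); last first.
    by rewrite !mult_aut_out //= ?negb_and ?Py ?orbT.
  have P'y : P' y by rewrite /P' /= yt.
  rewrite (mult_aut_in Hl Hr Py) (mult_aut_in Hl' Hr' P'y) !gmulfM.
  rewrite (fix1 (l y) Py (Hl y Py)) (fix1 (r y) Py (Hr y Py)).
  by rewrite (mult_aut_out one R1)// mult_aut_out.
apply: elemM; last by apply: IH; rewrite (cardD1 t) [t \in _]Pt in leP.
apply: elemM.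
  apply: (elem_mull (i := t) (w := l t)); first by apply: L1; rewrite /= eqxx.
    by rewrite mult_aut_in /= ?eqxx// mulg1.
  by move=> k kt; rewrite mult_aut_out.
apply: (elem_mulr (i := t) (w := r t)); first by apply: R1; rewrite /= eqxx.
  by rewrite mult_aut_in /= ?eqxx// mul1g.
by move=> k kt; rewrite mult_aut_out.
Qed.

End ElementaryTheory.

(** A transposition after [p] corrects the value at [u]; it moves only [p u] and [v], which are not
    values prescribed by the rest of the list. *)
Lemma perm_extend (T : finType) (s : seq (T * T)) :
  uniq (map fst s) -> uniq (map snd s) ->
  exists p : {perm T}, forall q, q \in s -> p q.1 = q.2.
Proof.
elim: s => [|[u v] s IH] /=; first by exists 1%g.
move=> /andP[us /IH{}IH] /andP[vs /IH[p ps]].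
exists (p * tperm (p u) v)%g => q; rewrite inE => /predU1P[->|qs] /=.
  by rewrite permM tpermL.
rewrite permM ps// tpermD//; last first.
  by apply: contraNneq vs => ->; apply: map_f.
apply: contraNneq us => e; have -> : u = q.1 by apply: (@perm_inj _ p); rewrite ps.
exact: map_f.
Qed.

(** * Moves on labelled graphs *)

Section LabelledGraphs.
Variables (X : finType) (M : nat).
Local Notation Y := (X + 'I_M)%type.
Implicit Types (g : autfg Y) (U : {set 'I_M}) (a b : Y -> option 'I_M)
  (w : Y -> seq (X * bool)).

Definition vtx (o : option 'I_M) : freeGroup Y := if o is Some v then fg_gen (inr v) else 1%g.

Definition wrd (u : seq (X * bool)) : freeGroup Y :=
  (\prod_(l <- u) eval_letter (fun x => fg_gen (inl x : Y)) l)%g.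

Definition live U (y : Y) := if y is inr v then v \in U else true.

Definition live_vtx U (o : option 'I_M) := if o is Some v then v \in U else true.

(** [g] sends the live generators to the edges of a graph with vertices [None]
    (the base point) and [U], the edge [y] going from [a y] to [b y] with label
    [w y], and it fixes the other generators. Folding this graph by elementary
    automorphisms, as Stallings does, reduces its number of vertices. *)
Definition is_graph g U a b w :=
  (forall v, v \notin U -> g (fg_gen (inr v)) = fg_gen (inr v)) /\
  (forall y, live U y -> [/\ live_vtx U (a y), live_vtx U (b y)
     & g (fg_gen y) = (vtx (a y) * wrd (w y) * (vtx (b y))^-1)%g]).

Lemma avoids_vtx (P : pred Y) o : (forall v, o = Some v -> ~~ P (inr v)) -> avoids P (vtx o).
Proof. by case: o => [v|] h; [apply/avoids_gen/h | exact: avoids1]. Qed.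

Lemma avoids_wrd (P : pred Y) u : (forall x, ~~ P (inl x)) -> avoids P (wrd u).
Proof.
move=> h f hf; elim: u => [|[x e] u IH]; rewrite /wrd ?big_nil ?mult1// big_cons gmulfM -/(wrd u) IH.
by congr (_ * _)%g; rewrite /eval_letter /=; case: e; rewrite ?multV hf.
Qed.

Lemma wrd_cons l u : wrd (l :: u) = (wrd [:: l] * wrd u)%g.
Proof. by rewrite /wrd big_cons big_seq1. Qed.

Lemma wrd_nil : wrd [::] = 1%g.
Proof. by rewrite /wrd big_nil. Qed.

Lemma wrd1 x e : wrd [:: (x, e)] = if e then (fg_gen (inl x))^-1%g else fg_gen (inl x).
Proof. by rewrite /wrd big_seq1. Qed.

Lemma fg_gen_neq1 (y : Y) : fg_gen y != 1%g.
Proof. by []. Qed.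

Lemma aut_gen_neq1 g (y : Y) : g (fg_gen y) <> 1%g.
Proof. by rewrite -(mult1 g) => /(can_inj (autK g)) /eqP; apply/negP/fg_gen_neq1. Qed.

Lemma live_neq U y d : d \notin U -> live U y -> y != inr d.
Proof. by move=> dU ly; apply: contraNneq dU => e; rewrite e in ly. Qed.

Lemma vtx_avoid U (d : 'I_M) o : d \notin U -> live_vtx U o -> avoids (pred1 (inr d : Y)) (vtx o).
Proof. by move=> dU lo; apply: avoids_vtx => v e; rewrite e in lo; apply: contraNneq dU => -[<-]. Qed.

(** Subdivision after the first letter of the label. The index [d] names the new vertex, and the
    spare generator [inr d] becomes the edge carrying the rest [u] of the label: [L] gives its image
    that form, and [T] cuts this edge off [y]. *)
Lemma split_edge g U a b w (y : Y) l u (d : 'I_M) :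
  is_graph g U a b w -> live U y -> w y = l :: u -> d \notin U ->
  exists g' a' b' w', [/\ is_graph g' (d |: U) a' b' w', elem g' -> elem g
    & w' =1 fun z => if z == y then [:: l] else if z == inr d then u else w z].
Proof.
move=> [gd ge] ly wy dU; have [ay bY gy] := ge y ly.
have yd := live_neq dU ly.
pose L := mult_aut (fun _ _ => @avoids1 _ (pred1 (inr d : Y)))
  (r := fun=> (wrd u * (vtx (b y))^-1)%g) (fun _ _ => avoidsM
    (@avoids_wrd (pred1 (inr d : Y)) u (fun=> isT)) (avoidsV (vtx_avoid dU bY))).
have Ld : L (fg_gen (inr d)) = (fg_gen (inr d) * (wrd u * (vtx (b y))^-1))%g.
  by rewrite mult_aut_in ?mul1g /= ?eqxx.
have La z : avoids (pred1 (inr d : Y)) z -> L z = z by exact: mult_aut_avoid.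
have Lw v : L (wrd v) = wrd v by apply/La/avoids_wrd.
have Lv o : live_vtx U o -> L (vtx o) = vtx o by move=> lo; apply/La/(vtx_avoid dU lo).
have yd' : ~~ pred1 y (inr d : Y) by rewrite /= eq_sym.
pose T := mult_aut (fun _ _ => @avoids1 _ (pred1 y)) (r := fun=> (fg_gen (inr d))^-1%g)
  (fun _ _ => avoidsV (avoids_gen yd')).
have Ty : T (fg_gen y) = (fg_gen y * (fg_gen (inr d))^-1)%g by rewrite mult_aut_in ?mul1g /= ?eqxx.
have Tn z : z != y -> T (fg_gen z) = fg_gen z by move=> zy; exact: mult_aut_out.
exists (L * g * T)%g, (fun z => if z == inr d then Some d else a z),
  (fun z => if z == y then Some d else if z == inr d then b y else b z),
  (fun z => if z == y then [:: l] else if z == inr d then u else w z).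
split=> //; last first.
  have eL : elem L by exact: elem_mult_aut.
  have eT : elem T by exact: elem_mult_aut.
  by move=> e; exact: elem_mullE eL (elem_mulrE eT e).
have liveU z : live U z -> live (d |: U) z by case: z => //= v vU; rewrite inE vU orbT.
have vtxU o : live_vtx U o -> live_vtx (d |: U) o by case: o => //= v vU; rewrite inE vU orbT.
split=> [v|z].
  rewrite !inE negb_or => /andP[vd vU]; rewrite !autM_E Tn ?gd//; last first.
    by apply: contraTneq ly => <-.
  by rewrite La//; apply: avoids_gen; apply: contra vd => /eqP[->].
have [->|zy] := eqVneq z y => [_|lz].
  rewrite (negbTE yd); split; [exact: vtxU | by rewrite /= !inE eqxx |].
  rewrite !autM_E Ty gmulfM multV gd// gmulfM gy multV Ld wy wrd_cons.
  rewrite !gmulfM multV !Lw !Lv// !invMg invgK !mulgA.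
  by rewrite mulgKV mulgK.
rewrite !autM_E Tn//; have [->|zd] := eqVneq z (inr d).
  split; [by rewrite /= !inE eqxx | exact: vtxU |].
  by rewrite gd// Ld mulgA.
have lz' : live U z by case: z lz zd {zy} => //= v; rewrite !inE => /predU1P[->|//]; rewrite eqxx.
have [az bz ->] := ge z lz'; split; try exact: vtxU.
by rewrite !gmulfM multV Lw !Lv.
Qed.

(** Merging [d] with the start of [y]. After [L] and [I], the image of [y] is the bare letter
    [inr d]. [T] uses [y] to clear this letter from the other edges, and the transposition [p] makes
    [inr d] the generator that is fixed from now on. *)
Lemma contract_edge g U a b w (y : Y) (d : 'I_M) :
  is_graph g U a b w -> live U y -> w y = [::] -> b y = Some d ->
  exists g' a' b' w', [/\ is_graph g' (U :\ d) a' b' w', elem g' -> elem g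
    & forall z, exists z', w' z = w z'].
Proof.
move=> [gd ge] ly wy bd; have [ay bY gy] := ge y ly.
have dU : d \in U by rewrite bd in bY.
have ad : a y <> Some d.
  by move=> ad; apply: (@aut_gen_neq1 g y); rewrite gy wy wrd_nil ad bd mulg1 mulgV.
have avd o : o <> Some d -> avoids (pred1 (inr d : Y)) (vtx o).
  by move=> od; apply: avoids_vtx => v ov; apply/eqP => -[vd]; rewrite vd in ov.
pose L := mult_aut (fun _ _ => @avoids1 _ (pred1 (inr d : Y)))
  (r := fun=> vtx (a y)) (fun _ _ => avd _ ad).
have Ld : L (vtx (Some d)) = (vtx (Some d) * vtx (a y))%g.
  by rewrite mult_aut_in ?mul1g /= ?eqxx.
have Lw v : L (wrd v) = wrd v by rewrite mult_aut_avoid//; exact: avoids_wrd.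
have Lv o : o <> Some d -> L (vtx o) = vtx o by move=> od; rewrite mult_aut_avoid//; apply/avd.
pose I := inv_aut (pred1 y).
have Iy : I (fg_gen y) = (fg_gen y)^-1%g by rewrite inv_autE /= eqxx.
have In z : z != y -> I (fg_gen z) = fg_gen z by move=> zy; rewrite inv_autE /= (negbTE zy).
pose P z := live U z && (z != y).
have Py : ~~ P y by rewrite /P eqxx andbF.
have Hl z : P z -> avoids P (if a z == Some d then (fg_gen y)^-1%g else 1%g).
  by move=> _; case: ifP => _; [apply/avoidsV/avoids_gen | exact: avoids1].
have Hr z : P z -> avoids P (if b z == Some d then fg_gen y else 1%g).
  by move=> _; case: ifP => _; [apply/avoids_gen | exact: avoids1].
pose T := mult_aut Hl Hr; pose p := tperm y (inr d : Y).
pose nu o := if o == Some d then a y else o.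
have live_nu o : live_vtx U o -> live_vtx (U :\ d) (nu o).
  rewrite /nu; case: eqP => [_ _|od lo].
    move: (ay) (ad); case: (a y) => //= v vU vd.
    by rewrite !inE vU andbT; apply/eqP => e; case: vd; rewrite e.
  by case: o od lo => //= v vd vU; rewrite !inE vU andbT; apply/eqP => e; case: vd; rewrite e.
have g2 z : live U z -> z != y ->
  L (g (I (T (fg_gen z)))) = (vtx (nu (a z)) * wrd (w z) * (vtx (nu (b z)))^-1)%g.
  move=> lz zy; have [az bz gz] := ge z lz.
  have Ly : L (g (I (fg_gen y))) = vtx (Some d).
    rewrite Iy multV gy wy wrd_nil mulg1 bd multV gmulfM multV Ld Lv//.
    by rewrite invMg invgK mulgK.
  rewrite mult_aut_in ?/P ?lz//.
  have la : (L (g (I (if a z == Some d then (fg_gen y)^-1 else 1))) * L (vtx (a z)) = vtx (nu (a z)))%g.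
    rewrite /nu; case: eqP => [->|az']; last by rewrite !mult1 mul1g Lv.
    by rewrite !multV Ly Ld mulKg.
  have lb : ((L (vtx (b z)))^-1 * L (g (I (if b z == Some d then fg_gen y else 1))) = (vtx (nu (b z)))^-1)%g.
    rewrite /nu; case: eqP => [->|bz']; last by rewrite !mult1 mulg1 Lv.
    by rewrite Ly Ld invMg mulgKV.
  by rewrite !gmulfM In// gz !gmulfM multV Lw -la -lb !mulgA.
have g2y : L (g (I (T (fg_gen y)))) = fg_gen (inr d).
  rewrite mult_aut_out// Iy multV gy wy wrd_nil mulg1 bd multV gmulfM multV Ld Lv//.
  by rewrite invMg invgK mulgK.
exists (L * g * I * T * perm_aut p)%g, (nu \o a \o p), (nu \o b \o p), (w \o p); split.
- split=> [v|z lz].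
    rewrite !inE negb_and negbK => /orP[/eqP ->|vU].
      by rewrite !autM_E perm_autE /p tpermR g2y.
    have vd : inr v != inr d :> Y by apply: contraNneq vU => -[->].
    have vy : inr v != y by apply: contraTneq ly => <-.
    rewrite !autM_E perm_autE /p tpermD 1?eq_sym// mult_aut_out; last by rewrite /P /= (negbTE vU).
    by rewrite In// gd// (Lv (Some v))// => -[e]; rewrite e eqxx in vd.
  have zd : z != inr d by apply: contraTneq lz => -> /=; rewrite !inE eqxx.
  have pz : live U (p z) && (p z != y).
    rewrite /p; case: tpermP zd => [-> yd|->|/eqP zy _ _]; rewrite ?eqxx//.
      by rewrite /= dU eq_sym.
    by rewrite zy andbT; case: z lz {zy} => //= v; rewrite !inE => /andP[].
  case/andP: pz => lpz pzy; have [az bz _] := ge _ lpz.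
  by rewrite !autM_E perm_autE g2//; split=> //; exact: live_nu.
- have eL : elem L by exact: elem_mult_aut.
  have eT : elem T by exact: elem_mult_aut.
  have eI : elem I by exact: elem_inv_aut.
  by move=> e; exact: elem_mullE eL (elem_mulrE eI (elem_mulrE eT (elem_mulrE (elem_perm_aut p) e))).
- by move=> z; exists (p z).
Qed.

Lemma flip_edge g U a b w (y : Y) :
  is_graph g U a b w -> live U y -> w y = [::] ->
  is_graph (g * inv_aut (pred1 y))%g U (fun z => if z == y then b y else a z)
    (fun z => if z == y then a y else b z) w.
Proof.
move=> [gd ge] ly wy; split=> [v vU|z lz]; rewrite autM_E inv_autE /=.
  by rewrite ifN ?gd//; apply: contraTneq ly => <-.
have [->|zy] := eqVneq z y; last exact: ge.
by have [ay bY gy] := ge y ly; split=> //; rewrite multV gy wy wrd_nil !mulg1 invMg invgK.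
Qed.

End LabelledGraphs.

(** * Stallings folding *)

Section Folding.
Variables (X : finType) (M : nat).
Local Notation Y := (X + 'I_M)%type.
Implicit Types (g : autfg Y) (U : {set 'I_M}) (a b : Y -> option 'I_M)
  (w : Y -> seq (X * bool)).

Definition positive U w := forall z : Y, live U z -> exists x, w z = [:: (x, false)].

(** Imposed on the starts and on the ends of edges, this says that the graph is folded. *)
Definition deterministic U a w := forall y z : Y,
  live U y -> live U z -> w y = w z -> a y = a z -> y = z.

(** Extending the partial injections given by the edges with a fixed label to
    permutations of the vertices yields an action for which every [g y] fixes the
    base point, whereas the generator of a vertex [v] can be made to move it. *)
Lemma graph_connected g U a b w : is_graph g U a b w -> positive U w ->
  deterministic U a w -> deterministic U b w -> U = set0.
Proof.
move=> [gd ge] pw da db.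
pose E x := [seq (a z, b z) | z <- enum {: Y} & live U z && (w z == [:: (x, false)])].
have h x : exists p : {perm (option 'I_M)}, forall q, q \in E x -> p q.1 = q.2.
  have u : uniq [seq z <- enum {: Y} | live U z && (w z == [:: (x, false)])].
    by rewrite filter_uniq ?enum_uniq.
  apply: perm_extend; rewrite -map_comp map_inj_in_uniq// => y z.
    rewrite !mem_filter => /andP[/andP[ly /eqP wy] _] /andP[/andP[lz /eqP wz] _] /= e.
    by apply: da; rewrite ?wy ?wz.
  rewrite !mem_filter => /andP[/andP[ly /eqP wy] _] /andP[/andP[lz /eqP wz] _] /= e.
  by apply: db; rewrite ?wy ?wz.
pose s x := sval (cid (h x)); have sE x q : q \in E x -> s x q.1 = q.2 := svalP (cid (h x)) q.
clearbody s.
pose Phi := fg_lift (fun z : Y => match z with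
  | inl x => s x | inr v => if v \in U then tperm None (Some v) else 1%g end).
have Phi_gen z : Phi (fg_gen z) = match z with
  | inl x => s x | inr v => if v \in U then tperm None (Some v) else 1%g end by exact: fg_lift_gen.
have Phi_vtx o : live_vtx U o -> Phi (vtx X o) None = o.
  case: o => [v|] /=; last by rewrite mult1 perm1.
  by rewrite Phi_gen => ->; rewrite tpermL.
have stab z : Phi (g (fg_gen z)) None = None.
  have [lz|lz] := boolP (live U z); last first.
    case: z lz => //= v vU; rewrite gd// Phi_gen (negbTE vU); exact: perm1.
  have [az bz ->] := ge z lz; have [x wx] := pw z lz.
  rewrite !gmulfM multV wx wrd1 Phi_gen !permM Phi_vtx//.
  rewrite (sE x (a z, b z)); last by apply: map_f; rewrite mem_filter lz wx eqxx mem_enum.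
  by apply: (canLR (permK _)); rewrite Phi_vtx.
have stab_all u : Phi (g u) None = None.
  elim/fg_ind: u => [|z u IH|z u IH]; first by rewrite !mult1 perm1.
    by rewrite !gmulfM permM stab.
  rewrite !gmulfM !multV permM -[RHS]IH; congr (Phi (g u) _).
  by apply: (canLR (permK _)); rewrite stab.
apply/setP => v; rewrite inE; apply/negP => vU.
have := stab_all (g^-1%g (fg_gen (inr v))).
by rewrite autVKg Phi_gen vU tpermL.
Qed.

(** When only the base point is left, [g] sends each generator to a single letter, hence permutes
    the generators. *)
Lemma deterministic_elem g U a b w : is_graph g U a b w -> positive U w ->
  deterministic U a w -> deterministic U b w -> elem g.
Proof.
move=> gr pw da db; have U0 := graph_connected gr pw da db; subst U.
have [gd ge] := gr.
have vN o : live_vtx set0 o -> vtx X o = 1%g by case: o => //= v; rewrite inE.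
have [p pE] : exists p : Y -> Y, forall z, g (fg_gen z) = fg_gen (p z).
  suff h z : exists q : Y, g (fg_gen z) = fg_gen q.
    by exists (fun z => sval (cid (h z))) => z; exact: svalP (cid (h z)).
  case: z => [x|v]; last by exists (inr v); rewrite gd// inE.
  have [az bz ->] := ge (inl x) isT; have [x' ->] := pw (inl x) isT.
  by exists (inl x'); rewrite !vN// wrd1 mul1g invg1 mulg1.
have pi : injective p.
  move=> y z e; have : fg_gen y = fg_gen z by apply: (can_inj (autK g)); rewrite !pE e.
  by move=> /(congr1 val) [].
by apply: (elem_perm (p := perm pi)) => z; rewrite pE permE.
Qed.

Section Induction.
Variable n : nat.
Hypothesis IH : forall g U a b w, (#|U| < n)%N -> is_graph g U a b w ->
  (forall z, (size (w z) <= 1)%N) -> elem g.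

(** Contraction needs an end that is not the base point; if only the start qualifies, the edge is
    flipped. If neither does, [g] would send [y] to 1. *)
Lemma short_edge_elem g U a b w (y : Y) : (#|U| <= n)%N -> is_graph g U a b w ->
  (forall z, (size (w z) <= 1)%N) -> live U y -> w y = [::] -> elem g.
Proof.
move=> Un gr sw ly wy.
suff main g' a' b' d : is_graph g' U a' b' w -> b' y = Some d -> elem g'.
  case by_ : (b y) => [d|]; first exact: main gr by_.
  case ay : (a y) => [d|].
    apply: (elem_mulrE (elem_inv_aut (pred1 y))).
    by apply: (main _ _ _ d (flip_edge gr ly wy)); rewrite eqxx.
  have [_ /(_ y ly)[_ _]] := gr; rewrite ay by_ wy wrd_nil invg1 !mulg1 => gy.
  by case: (aut_gen_neq1 gy).
move=> gr' b'y; have dU : d \in U.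
  by have [_ /(_ y ly)[_ + _]] := gr'; rewrite b'y.
have [g1 [a1 [b1 [w1 [gr1 + w1E]]]]] := contract_edge gr' ly wy b'y; apply.
apply: (IH _ gr1) => [|z]; first by rewrite (cardsD1 d) dU in Un.
by have [z' ->] := w1E z.
Qed.

(** When two edges with equal labels share a start or an end, multiplying one by the inverse of the
    other leaves an edge without label, which can be contracted: this is a fold. When no fold is
    possible, [deterministic_elem] concludes. *)
Lemma positive_elem g U a b w : (#|U| <= n)%N -> is_graph g U a b w ->
  (forall z, (size (w z) <= 1)%N) -> positive U w -> elem g.
Proof.
move=> Un gr sw pw; have [gd ge] := gr.
have fold (y' : Y) l r (a' b' : option 'I_M) (Hl : forall z, pred1 y' z -> avoids (pred1 y') (l z))
    (Hr : forall z, pred1 y' z -> avoids (pred1 y') (r z)) : live U y' ->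
    live_vtx U a' -> live_vtx U b' ->
    (g (l y' * fg_gen y' * r y') = vtx X a' * (vtx X b')^-1)%g -> elem g.
  move=> ly' la' lb' ge'; apply: (elem_mulrE (elem_mult_aut Hl Hr)).
  apply: (@short_edge_elem _ U (fun z => if z == y' then a' else a z)
    (fun z => if z == y' then b' else b z) (fun z => if z == y' then [::] else w z) y') => //.
  - split=> [v vU|z lz]; rewrite autM_E.
      by rewrite mult_aut_out ?gd//; apply: contraTneq ly' => <-.
    have [->|zy] := eqVneq z y'; last by rewrite mult_aut_out//; exact: ge.
    by split=> //; rewrite mult_aut_in /= ?eqxx// ge' wrd_nil mulg1.
  - by move=> z; case: ifP.
  - by rewrite eqxx.
have [da|nda] := pselect (deterministic U a w); last first.
  apply: contra_notP nda => ng y y' ly ly' wyy ayy.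
  apply/eqP; apply: contra_notT ng => yy.
  have [a1 b1 e1] := ge y ly; have [a2 b2 e2] := ge y' ly'.
  have Hl z : pred1 y' z -> avoids (pred1 y') ((fg_gen y)^-1%g) by move=> _; apply/avoidsV/avoids_gen.
  apply: (fold y' (fun=> (fg_gen y)^-1%g) (fun=> 1%g) (b y) (b y') Hl (fun _ _ => @avoids1 _ _)) => //.
  rewrite mulg1 gmulfM multV e1 e2 wyy ayy !invMg invgK -!mulgA.
  by rewrite mulKg mulKg.
have [db|ndb] := pselect (deterministic U b w); first exact: deterministic_elem gr pw da db.
apply: contra_notP ndb => ng y y' ly ly' wyy byy.
apply/eqP; apply: contra_notT ng => yy.
have [a1 b1 e1] := ge y ly; have [a2 b2 e2] := ge y' ly'.
have Hr z : pred1 y' z -> avoids (pred1 y') ((fg_gen y)^-1%g) by move=> _; apply/avoidsV/avoids_gen.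
apply: (fold y' (fun=> 1%g) (fun=> (fg_gen y)^-1%g) (a y') (a y) (fun _ _ => @avoids1 _ _) Hr) => //.
by rewrite mul1g gmulfM multV e1 e2 wyy byy !invMg invgK !mulgA mulgKV mulgK.
Qed.

Lemma short_graph_step g U a b w : (#|U| <= n)%N -> is_graph g U a b w ->
  (forall z, (size (w z) <= 1)%N) -> elem g.
Proof.
move=> Un gr sw; have [gd ge] := gr.
have [/existsP[y /andP[ly /eqP wy]]|ns] := boolP [exists y, live U y && (w y == [::])].
  exact: short_edge_elem Un gr sw ly wy.
pose N (z : Y) := live U z && (if w z is [:: (_, e)] then e else false).
apply: (elem_mulrE (elem_inv_aut N)).
apply: (@positive_elem _ U (fun z => if N z then b z else a z)
  (fun z => if N z then a z else b z) (fun z => [seq (l.1, false) | l <- w z])) => //.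
- split=> [v vU|z lz]; rewrite autM_E inv_autE.
    by rewrite /N /= (negbTE vU) /= gd.
  have [az bz gz] := ge z lz; rewrite /N lz /=.
  case wz : (w z) (sw z) => [|[x e] [|l u]] // _ in gz *.
  case: e gz {wz} => gz; split=> //; rewrite ?multV gz//= !wrd1.
  by rewrite !invMg !invgK mulgA.
- by move=> z; rewrite size_map.
move=> z lz; case wz : (w z) (sw z) => [|[x e] [|l u]] // _; last by exists x.
by case/negP: ns; apply/existsP; exists z; rewrite lz wz.
Qed.

End Induction.

Lemma short_graph_elem g U a b w : is_graph g U a b w ->
  (forall z, (size (w z) <= 1)%N) -> elem g.
Proof.
have [n] := ubnP #|U|; elim: n g U a b w => // n IH g U a b w Un gr sw.
exact: (short_graph_step IH Un gr sw).
Qed.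

(** Each subdivision uses up one spare letter and lowers the total excess length of the labels by
    one, so the spare letters suffice until all labels have length at most one. *)
Lemma graph_elem g U a b w : is_graph g U a b w ->
  (\sum_(z | live U z) (size (w z)).-1 <= #|~: U|)%N -> elem g.
Proof.
have [n] := ubnP #|~: U|; elim: n g U a b w => // n IH g U a b w Un gr sw.
have [/existsP[y /andP[ly wy]]|ns] := boolP [exists y, live U y && (1 < size (w y))%N]; last first.
  apply: (@short_graph_elem g U a b (fun z => if live U z then w z else [::])).
    by have [gd ge] := gr; split=> // z lz; rewrite lz; exact: ge.
  move=> z; case: ifP => // lz; rewrite leqNgt; apply: contra ns => h.
  by apply/existsP; exists z; rewrite lz.
have [d dU] : exists d, d \in ~: U.
  apply/set0Pn; rewrite -card_gt0; apply: leq_trans sw.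
  by rewrite (bigD1 y)//= ltn_addr//; case: (w y) wy => [|l [|]].
case wE : (w y) wy => [|l u] //= u0; rewrite inE in dU.
have [g1 [a1 [b1 [w1 [gr1 + w1E]]]]] := split_edge gr ly wE dU; apply.
have yd := live_neq dU ly.
have cU : #|~: U| = #|~: (d |: U)|.+1.
  by rewrite (cardsD1 d (~: U)) !inE dU setCU setIC -setDE.
apply: (IH _ _ _ _ _ _ gr1); first by rewrite cU in Un.
rewrite -ltnS -cU; apply: leq_trans sw.
rewrite (bigD1 y)/=; last by case: (y) ly => //= v vU; rewrite inE vU orbT.
rewrite (bigD1 (inr d))/=; last by rewrite !inE eqxx eq_sym yd.
rewrite (bigD1 y ly)/= !w1E !eqxx wE (negbTE (_ : inr d != y)) 1?eq_sym//= add0n.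
rewrite -addSn leq_add//; first by case: (u) u0.
rewrite (eq_bigl (fun z => live U z && (z != y))) => [|z]; last first.
  have [->|zd] := eqVneq z (inr d); first by rewrite andbF /= (negbTE dU).
  rewrite andbT; congr (_ && _); case: z zd => //= v vd.
  by rewrite !inE; have -> : (v == d) = false by apply: contraNF vd => /eqP ->.
apply: leq_sum => z /andP[lz zy]; rewrite w1E (negbTE zy).
by rewrite (negbTE (live_neq dU lz)).
Qed.

End Folding.

(** The initial graph has only the base point, with a loop labelled by the word [g x] for each [x];
    the letters in ['I_M] are spare. Hence [M0] is the excess length of these words. *)
Lemma stably_elem (X : finType) (g : autfg X) : exists M0, forall M, (M0 <= M)%N ->
  elem (aut_ext (@inl_inj X 'I_M) g).
Proof.
exists (\sum_(x : X) (size (val (g (fg_gen x)))).-1)%N => M hM.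
pose w (z : X + 'I_M) := if z is inl x then val (g (fg_gen x)) else [::].
apply: (@graph_elem X M _ set0 (fun=> None) (fun=> None) w).
  split=> [v _|[x|v]]; last by rewrite /= inE.
    by rewrite aut_ext_notin// inr_notin_inl.
  by move=> _; split=> //; rewrite aut_ext_gen fg_mapE /= mul1g invg1 mulg1.
rewrite setC0 cardsT card_ord; apply: leq_trans hM.
rewrite big_mkcond big_sumType /= [X in (_ + X)%N]big1 ?addn0//.
by move=> v _; rewrite inE.
Qed.

(** * The determinant cocycle *)

Section QuadraticPart.
Variable n : nat.

(** The free group maps to this two-step nilpotent group by its Magnus
    expansion truncated in degree 3. *)
Definition magnus := ('rV[int]_n * 'M[int]_n)%type.
HB.instance Definition _ := Choice.on magnus.

Implicit Types p q : magnus.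

Definition magnus_mul p q : magnus := (p.1 + q.1, p.2 + q.2 + p.1^T *m q.1).
Definition magnus_one : magnus := (0, 0).
Definition magnus_inv p : magnus := (- p.1, - p.2 + p.1^T *m p.1).

Lemma magnus_mulA : associative magnus_mul.
Proof.
move=> p q r; rewrite /magnus_mul /= addrA; congr (_, _).
rewrite mulmxDr raddfD mulmxDl -!addrA; do 2!congr (_ + _); rewrite [RHS]addrCA.
by congr (_ + _); rewrite addrC -addrA.
Qed.

Lemma magnus_mul1 : left_id magnus_one magnus_mul.
Proof. by case=> v A; rewrite /magnus_mul /= !add0r trmx0 mul0mx addr0. Qed.

Lemma magnus_mulr1 : right_id magnus_one magnus_mul.
Proof. by case=> v A; rewrite /magnus_mul /= !addr0 mulmx0 addr0. Qed.

Lemma magnus_mulV : left_inverse magnus_one magnus_inv magnus_mul.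
Proof.
case=> v A; rewrite /magnus_mul /magnus_inv /= addNr raddfN mulNmx.
by rewrite addrAC addrK addNr.
Qed.

Lemma magnus_mulrV : right_inverse magnus_one magnus_inv magnus_mul.
Proof.
case=> v A; rewrite /magnus_mul /magnus_inv /= subrr mulmxN.
by rewrite addrA subrr add0r subrr.
Qed.

HB.instance Definition _ :=
  isGroup.Build magnus magnus_mulA magnus_mul1 magnus_mulr1 magnus_mulV magnus_mulrV.

Lemma magnusM p q : (p * q)%g = magnus_mul p q. Proof. by []. Qed.

Definition magnus_map : {multiplicative freeGroup 'I_n -> magnus} :=
  fg_lift (fun i => (delta_mx 0 i, 0) : magnus).

Definition quad (w : freeGroup 'I_n) : 'M[int]_n := (magnus_map w).2.

Lemma magnus_map1 w : (magnus_map w).1 = abelianize w.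
Proof.
elim/fg_ind: w => [|i w IH|i w IH]; first by rewrite mult1 abelianize1.
  by rewrite gmulfM magnusM /= IH abelianizeM abelianize_gen fg_lift_gen.
by rewrite gmulfM magnusM multV /= IH abelianizeM abelianizeV abelianize_gen fg_lift_gen.
Qed.

Lemma quad_gen i : quad (fg_gen i) = 0.
Proof. by rewrite /quad /magnus_map fg_lift_gen. Qed.

Lemma quadM u v : quad (u * v)%g = quad u + quad v + (abelianize u)^T *m abelianize v.
Proof. by rewrite /quad gmulfM magnusM /= !magnus_map1. Qed.

Lemma quad1 : quad 1%g = 0.
Proof. by rewrite /quad mult1. Qed.

Lemma quadV u : quad u^-1%g = - quad u + (abelianize u)^T *m abelianize u.
Proof. by rewrite /quad multV -!magnus_map1. Qed.

Implicit Types a b : autF n.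

(** A chain rule of second order: the linear part of [a] transports the quadratic part of [w], and
    the linear part of [w] picks up the quadratic parts of [a] on letters. *)
Lemma quad_aut a w : quad (a w) = (aut_mx a)^T *m quad w *m aut_mx a
  + \sum_l (abelianize w) 0 l *: quad (a (fg_gen l)).
Proof.
pose S (v : 'rV[int]_n) := \sum_l v 0 l *: quad (a (fg_gen l)).
have SD u v : S (u + v) = S u + S v.
  by rewrite /S -big_split; apply: eq_bigr => l _; rewrite mxE scalerDl.
have Sgen i : S (delta_mx 0 i) = quad (a (fg_gen i)).
  rewrite /S (bigD1 i)//= mxE !eqxx scale1r big1 ?addr0// => l li.
  by rewrite mxE (negbTE li) andbF scale0r.
have SN v : S (- v) = - S v by rewrite /S -sumrN; apply: eq_bigr => l _; rewrite mxE scaleNr.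
have S0 : S 0 = 0 by rewrite /S big1// => l _; rewrite mxE scale0r.
rewrite -/(S (abelianize w)).
have AA u v : (aut_mx a)^T *m ((abelianize u)^T *m abelianize v) *m aut_mx a
    = (abelianize (a u))^T *m abelianize (a v).
  by rewrite !aut_mxE trmx_mul !mulmxA.
have AC (x y z t k : 'M[int]_n) : x + y + (z + t) + k = x + z + k + (y + t).
  by rewrite (addrACA x y z t) (addrAC (x + z)).

have quadMa u v : quad (a u) = (aut_mx a)^T *m quad u *m aut_mx a + S (abelianize u) ->
  quad (a v) = (aut_mx a)^T *m quad v *m aut_mx a + S (abelianize v) ->
  quad (a (u * v)%g) = (aut_mx a)^T *m quad (u * v)%g *m aut_mx a + S (abelianize (u * v)%g).
  move=> hu hv; rewrite gmulfM !quadM hu hv abelianizeM SD !mulmxDr !mulmxDl AA.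
  exact: AC.
have hgen i : quad (a (fg_gen i)) = (aut_mx a)^T *m quad (fg_gen i) *m aut_mx a + S (abelianize (fg_gen i)).
  by rewrite quad_gen mulmx0 mul0mx add0r abelianize_gen Sgen.
elim/fg_ind: w => [|i w IH|i w IH].
- by rewrite mult1 quad1 abelianize1 S0 mulmx0 mul0mx addr0.
- exact: quadMa.
apply: quadMa => //; rewrite multV !quadV abelianizeV SN hgen mulmxDr mulmxDl AA.
by rewrite opprD mulmxN mulNmx addrAC.
Qed.

(** The logarithmic derivative at the augmentation ideal of the determinant of
    the Fox Jacobian, read modulo the square of that ideal. *)
Definition det_cocycle a : 'rV[int]_n :=
  \row_i \sum_l (quad (a (fg_gen l)) *m invmx (aut_mx a)) i l.

Lemma det_cocycleE a i :
  det_cocycle a 0 i = \sum_l (quad (a (fg_gen l)) *m invmx (aut_mx a)) i l.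
Proof. exact: mxE. Qed.

(** Of the two terms of [quad_aut], the first gives the action of [a] on the cocycle of [b]; in the
    second, the sum over [l] contracts [B] with its inverse and leaves the cocycle of [a]. *)
Lemma det_cocycleM a b : det_cocycle (a * b)%g = det_cocycle a + aut_ab a (det_cocycle b).
Proof.
apply/rowP => i; set B := aut_mx b; set A := aut_mx a.
have uA : A \in unitmx := aut_mx_unit a; have uB : B \in unitmx := aut_mx_unit b.
have invBA : invmx (aut_mx (a * b)%g) = invmx A *m invmx B.
  rewrite -aut_mxV invgM aut_mxM -!aut_mxV.
  by [].
rewrite [RHS]mxE !det_cocycleE.
have -> : \sum_l (quad ((a * b)%g (fg_gen l)) *m invmx (aut_mx (a * b)%g)) i l
  = \sum_l (A^T *m (quad (b (fg_gen l)) *m invmx B)) i l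
  + \sum_l \sum_m B l m * ((quad (a (fg_gen m)) *m invmx A) *m invmx B) i l.
  rewrite -big_split; apply: eq_bigr => l _ /=.
  rewrite invBA autM_E quad_aut mulmxDl mxE -/A; congr (_ + _).
    by rewrite !mulmxA mulmxK.
  rewrite mulmx_suml summxE; apply: eq_bigr => m _.
  have -> : B l m = abelianize (b (fg_gen l)) 0 m by rewrite /B mxE.
  by rewrite -scalemxAl [LHS]mxE mulmxA.
rewrite [RHS]addrC; congr (_ + _); last first.
  rewrite exchange_big /=; apply: eq_bigr => m _.
  rewrite -[in RHS](mulmxKV uB (quad (a (fg_gen m)) *m invmx A)) mxE.
  by apply: eq_bigr => l _; rewrite mulrC.
rewrite (eq_bigr (fun l => \sum_p A p i * (quad (b (fg_gen l)) *m invmx B) p l)); last first.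
  by move=> l _; rewrite mxE; apply: eq_bigr => p _; rewrite mxE.
rewrite exchange_big [RHS]mxE; apply: eq_bigr => p _ /=.
by rewrite det_cocycleE mulr_suml; apply: eq_bigr => l _; rewrite mulrC.
Qed.

(** The linear part of [a] is the identity, and its only quadratic part is $E_{st}-E_{ts}$, at the
    letter [t]; only $E_{st}$ meets column [t]. *)
Lemma det_cocycle_conj (a : autF n) (s t : 'I_n) : s != t ->
  a (fg_gen t) = (fg_gen s * fg_gen t * (fg_gen s)^-1)%g ->
  (forall k, k != t -> a (fg_gen k) = fg_gen k) -> det_cocycle a = delta_mx 0 s.
Proof.
move=> st at_ ak; have -> : det_cocycle a = \row_i \sum_l quad (a (fg_gen l)) i l.
  have -> : det_cocycle a = \row_i \sum_l (quad (a (fg_gen l)) *m invmx (aut_mx a)) i l by [].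
  suff -> : aut_mx a = 1%:M by rewrite invmx1; apply/rowP => i; rewrite !mxE; apply: eq_bigr => l _; rewrite mulmx1.
  apply/row_matrixP => l; rewrite rowK row1; have [->|lt] := eqVneq l t; last by rewrite ak// abelianize_gen.
  by rewrite at_ !abelianizeM abelianizeV !abelianize_gen addrAC subrr add0r.
apply/rowP => i; rewrite !mxE (bigD1 t)//= big1 => [|l lt]; last by rewrite ak// quad_gen mxE.
rewrite at_ !quadM quadV !quad_gen abelianizeM abelianizeV !abelianize_gen raddfD mulmxDl.
rewrite !trmx_delta !mulmxN !mul_delta_mx add0r oppr0 !add0r addr0.
rewrite !mxE !eqxx !andbT /= (negbTE (_ : t != s)) 1?eq_sym// !andbF !subr0.
have ts : t == s = false by rewrite eq_sym (negbTE st).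
by rewrite !big_ord1 !mxE ts !andbF !mulr0 oppr0 !addr0.
Qed.

End QuadraticPart.

Section CocycleStab.
Variable n : nat.
Implicit Types a : autF n.

Lemma aut_stabE a : aut_ext (@lift_inj n.+1 ord_max) a = aut_stab n a.
Proof.
apply: aut_extP => [i|y ny].
  rewrite -[fg_gen (lift _ i)](fg_map_gen (lift ord_max)) -!fg_incl_map.
  exact: fg_free_id_incl.
case: (unliftP ord_max y) ny => [j ->|->] ny; first by rewrite codom_f in ny.
exact: fg_free_id_last.
Qed.

Lemma abelianize_incl w (i : 'I_n.+1) : abelianize (fg_incl n w) 0 i
  = if unlift ord_max i is Some j then abelianize w 0 j else 0.
Proof.
have h (w' : freeGroup 'I_n) : forall i : 'I_n.+1, abelianize (fg_incl n w') 0 i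
    = if unlift ord_max i is Some j then abelianize w' 0 j else 0.
  elim/fg_ind: w' => [|k w' IH|k w' IH] {}i.
  - by rewrite mult1 !abelianize1 !mxE; case: unliftP => // j _; rewrite mxE.
  - rewrite gmulfM !abelianizeM mxE IH {1}fg_incl_map fg_map_gen !abelianize_gen !mxE.
    case: unliftP => [j ->|->]; last by rewrite (negbTE (neq_lift _ _)) andbF addr0.
    by rewrite !mxE (inj_eq (@lift_inj _ _)).
  rewrite gmulfM multV !abelianizeM mxE IH {1}fg_incl_map fg_map_gen !abelianizeV !abelianize_gen !mxE.
  case: unliftP => [j ->|->]; last by rewrite (negbTE (neq_lift _ _)) andbF subr0.
  by rewrite !mxE (inj_eq (@lift_inj _ _)).
exact: h.
Qed.

Lemma quad_incl w (i j : 'I_n.+1) : quad (fg_incl n w) i j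
  = if (unlift ord_max i, unlift ord_max j) is (Some i', Some j') then quad w i' j' else 0.
Proof.
pose E (A : 'M[int]_n) : 'M[int]_n.+1 := \matrix_(i, j)
  if (unlift ord_max i, unlift ord_max j) is (Some i', Some j') then A i' j' else 0.
have ED A B : E (A + B) = E A + E B.
  apply/matrixP => i' j'; rewrite !mxE; case: unliftP => [? _|_]; last by rewrite addr0.
  by case: unliftP => [? _|_]; rewrite ?mxE ?addr0.
have EN A : E (- A) = - E A.
  apply/matrixP => i' j'; rewrite !mxE; case: unliftP => [? _|_]; last by rewrite oppr0.
  by case: unliftP => [? _|_]; rewrite ?mxE ?oppr0.
have EM u v : (abelianize (fg_incl n u))^T *m abelianize (fg_incl n v)
    = E ((abelianize u)^T *m abelianize v).
  apply/matrixP => i' j'; rewrite !mxE big_ord1 mxE !abelianize_incl.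
  case: unliftP => [? _|_]; last by rewrite mul0r.
  by case: unliftP => [? _|_]; rewrite ?mulr0// mxE big_ord1 mxE.
have E0 : E 0 = 0.
  apply/matrixP => i' j'; rewrite !mxE; case: unliftP => [? _|_] //.
  by case: unliftP => [? _|_]; rewrite ?mxE.
suff -> : quad (fg_incl n w) = E (quad w) by rewrite mxE.
elim/fg_ind: w => [|k w IH|k w IH]; first by rewrite mult1 !quad1 E0.
  rewrite gmulfM !quadM EM IH !ED {1}fg_incl_map fg_map_gen !quad_gen E0.
  by [].
rewrite gmulfM !quadM EM IH !ED multV !quadV !ED EN EM {1}fg_incl_map fg_map_gen !quad_gen E0.
by rewrite oppr0.
Qed.

Lemma det_cocycle_stab a : proj_first n (det_cocycle (aut_stab n a)) = det_cocycle a.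
Proof.
apply/rowP => i; rewrite det_cocycleE mxE det_cocycleE (bigD1_ord ord_max)//=.
rewrite [X in X + _](_ : _ = 0) ?add0r; last first.
  rewrite [aut_stab_fun a _]fg_free_id_last quad_gen mul0mx; exact: mxE.
apply: eq_bigr => l _; rewrite -(fg_map_gen (lift (ord_max : 'I_n.+1)) l) -fg_incl_map.
rewrite [aut_stab_fun a _]fg_free_id_incl mxE (bigD1_ord ord_max)//= quad_incl.
rewrite unlift_none liftK mul0r add0r [RHS]mxE; apply: eq_bigr => j _.
rewrite quad_incl !liftK; congr (_ * _).
rewrite -!aut_mxV -multV [LHS]mxE [RHS]mxE.
rewrite -(fg_map_gen (lift (ord_max : 'I_n.+1)) j) -fg_incl_map.
by rewrite [aut_stab _ _ _]fg_free_id_incl abelianize_incl liftK.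
Qed.

End CocycleStab.

(** * Row vectors as lattices on numbered letters *)

Section Rows.
Variable n : nat.

Definition to_row : {additive zlat 'I_n -> 'rV[int]_n} := zlift (fun i => delta_mx 0 i).

Definition of_row_fun (v : 'rV[int]_n) : zlat 'I_n := [ffun i => v 0 i].
Lemma of_row_is_zmod_morphism : zmod_morphism of_row_fun.
Proof. by move=> u v; apply/ffunP => i; rewrite !ffunE !mxE. Qed.
HB.instance Definition _ := GRing.isZmodMorphism.Build 'rV[int]_n (zlat 'I_n)
  of_row_fun of_row_is_zmod_morphism.
Definition of_row : {additive 'rV[int]_n -> zlat 'I_n} := of_row_fun.

Lemma to_row_gen i : to_row (zgen i) = delta_mx 0 i.
Proof. exact: zlift_gen. Qed.

Lemma of_row_delta i : of_row (delta_mx 0 i) = zgen i.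
Proof. by apply/ffunP => j; rewrite !ffunE mxE eqxx eq_sym; case: (_ == _). Qed.

Lemma to_rowK : cancel to_row of_row.
Proof.
apply: (zlat_ext (f := of_row \o to_row) (g := idfun)) => i.
by change (of_row (to_row (zgen i)) = zgen i); rewrite to_row_gen of_row_delta.
Qed.

Lemma of_rowK : cancel of_row to_row.
Proof.
move=> v; suff : of_row (to_row (of_row v)) = of_row v.
  move=> /ffunP e; apply/rowP => i; move: (e i); rewrite !ffunE; exact.
exact: to_rowK.
Qed.

Lemma row_ext (A : zmodType) (f g : {additive 'rV[int]_n -> A}) :
  (forall i, f (delta_mx 0 i) = g (delta_mx 0 i)) -> f =1 g.
Proof.
move=> e v; rewrite -(of_rowK v); move: (of_row v).
apply: (zlat_ext (f := f \o to_row) (g := g \o to_row)) => i.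
by change (f (to_row (zgen i)) = g (to_row (zgen i))); rewrite to_row_gen.
Qed.

Lemma of_row_abelianize w : of_row (abelianize w) = fg_ab w.
Proof.
rewrite -[RHS]to_rowK; apply: congr1; apply/esym.
apply: (fg_ab_natural (g := @abelianize n)) => [u v|i]; first exact: abelianizeM.
by rewrite to_row_gen abelianize_gen.
Qed.

Lemma ab_map_of_row (a : autF n) v : ab_map a (of_row v) = of_row (aut_ab a v).
Proof.
apply: (row_ext (f := ab_map a \o of_row) (g := of_row \o aut_ab a)) => i.
change (ab_map a (of_row (delta_mx 0 i)) = of_row (delta_mx 0 i *m aut_mx a)).
by rewrite of_row_delta ab_map_gen -rowE rowK of_row_abelianize.
Qed.

Lemma aut_ab_to_row (a : autF n) v : aut_ab a (to_row v) = to_row (ab_map a v).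
Proof. by rewrite -[in RHS](to_rowK v) ab_map_of_row of_rowK. Qed.

End Rows.
Arguments to_row {n}.
Arguments of_row {n}.
Global Opaque to_row of_row.

Lemma proj_inj_of_row n v :
  proj_inj (lift (ord_max : 'I_n.+1)) (of_row v) = of_row (proj_first n v).
Proof.
apply: (row_ext (f := proj_inj (lift (ord_max : 'I_n.+1)) \o @of_row n.+1)
  (g := @of_row n \o proj_first n)) => i.
change (proj_inj (lift (ord_max : 'I_n.+1)) (of_row (delta_mx 0 i))
  = of_row (proj_first n (delta_mx 0 i))).
rewrite of_row_delta; case: (unliftP ord_max i) => [j ->|->].
  rewrite (proj_inj_gen (@lift_inj _ _)) -of_row_delta; apply: congr1.
  by apply/rowP => k; rewrite !mxE (inj_eq (@lift_inj _ _)).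
rewrite proj_inj_notin; last by apply/codomP => -[k e]; move: (neq_lift ord_max k); rewrite -e eqxx.
rewrite (_ : proj_first n _ = 0) ?raddf0//.
by apply/rowP => k; rewrite !mxE eq_sym (negbTE (neq_lift _ _)) andbF.
Qed.

(** * The comparison map *)

Section CoendSymbols.
Variable F : contraFunctor.
Local Notation CF := (coend F inclFunctor).

Definition ctens n (x : F 'rV[int]_n) (y : 'rV[int]_n) : CF :=
  quot_pi (@coend_rel F inclFunctor) (dsum_inj (coend_summand F inclFunctor) n (tens x y)).

Lemma ctensDl n (x x' : F 'rV[int]_n) y : ctens (x + x') y = ctens x y + ctens x' y.
Proof. by rewrite /ctens tensDl !raddfD. Qed.

Lemma ctensDr n (x : F 'rV[int]_n) y y' : ctens x (y + y') = ctens x y + ctens x y'.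
Proof. by rewrite /ctens -raddfD -raddfD -tensDr. Qed.

Lemma ctens_natural m n (f : {additive 'rV[int]_m -> 'rV[int]_n}) (x : F 'rV[int]_n) y :
  ctens (contra_map F f x) y = ctens x (f y).
Proof. by apply/quot_piP/subgroup_gen_in; exists m, n, f, x, y. Qed.

Definition ctensl_fun n (y : 'rV[int]_n) (x : F 'rV[int]_n) := ctens x y.

Lemma ctensl_is_zmod_morphism n y : zmod_morphism (@ctensl_fun n y).
Proof.
by move=> x x'; apply: (addIr (ctens x' y)); rewrite /ctensl_fun -ctensDl !subrK.
Qed.
HB.instance Definition _ n y := GRing.isZmodMorphism.Build (F 'rV[int]_n) CF
  (@ctensl_fun n y) (ctensl_is_zmod_morphism y).

Definition ctensl n y : {additive F 'rV[int]_n -> CF} := @ctensl_fun n y.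

Lemma ctensr_is_zmod_morphism n (x : F 'rV[int]_n) : zmod_morphism (ctens x).
Proof. by move=> y y'; apply: (addIr (ctens x y')); rewrite -ctensDr !subrK. Qed.
HB.instance Definition _ n (x : F 'rV[int]_n) := GRing.isZmodMorphism.Build 'rV[int]_n CF
  (ctens x) (ctensr_is_zmod_morphism x).

Definition ctensr n (x : F 'rV[int]_n) : {additive 'rV[int]_n -> CF} := ctens x.

Lemma coend_ext (W : zmodType) (f g : {additive CF -> W}) :
  (forall n x y, f (@ctens n x y) = g (ctens x y)) -> f =1 g.
Proof.
move=> e q; rewrite -(quot_piK q); move: (X in quot_pi _ X) => z.
pose pi := quot_pi (@coend_rel F inclFunctor).
apply: (dsum_ext (f := f \o pi) (g := g \o pi)) => n t.
rewrite -(quot_piK t); move: (X in quot_pi _ X) => u.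
pose pn : {additive _ -> _} := pi \o dsum_inj (coend_summand F inclFunctor) n
  \o quot_pi (@tensor_rel (F 'rV[int]_n) 'rV[int]_n).
apply: (dsum_ext (f := f \o pn) (g := g \o pn)) => -[x y] k.
have -> : dsum_inj (fun=> int) (x, y) k = tensor_gen x y *~ k.
  by rewrite /tensor_gen -raddfMz intz.
by rewrite !raddfMz; congr (_ *~ _); exact: e.
Qed.

(** The coend relation moves the twist of [det_cocycle h] by [g] across the tensor sign, where it
    becomes the action of [g] on the coefficient. *)
Lemma chain_coend_subproof n (g h : autF n) (x : F (zlat 'I_n)) :
  (ctensl (det_cocycle (g * h)%g) \o contra_map F of_row) x
  = (ctensl (det_cocycle g) \o contra_map F of_row) x
  + (ctensl (det_cocycle h) \o contra_map F of_row) (ract F g x).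
Proof.
change (ctens (contra_map F of_row x) (det_cocycle (g * h)%g)
  = ctens (contra_map F of_row x) (det_cocycle g)
  + ctens (contra_map F of_row (ract F g x)) (det_cocycle h)).
rewrite det_cocycleM ctensDr -ctens_natural; congr (_ + ctens _ _).
rewrite ractE -!contra_comp; apply: contra_ext => v; exact/esym/ab_map_of_row.
Qed.

Definition chain_coend n : {additive barcoker F 'I_n -> CF} :=
  barcoker_lift (@chain_coend_subproof n).

Lemma chain_coendE n g x : chain_coend n (bsym F g x)
  = ctens (contra_map F of_row x) (det_cocycle g).
Proof. by rewrite [LHS]barcoker_liftE. Qed.

Lemma chain_coend_stab n d :
  chain_coend n.+1 (stab_map F (@lift_inj n.+1 ord_max) d) = chain_coend n d.
Proof.
apply: (barcoker_ext (f := chain_coend n.+1 \o stab_map F (@lift_inj n.+1 ord_max))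
  (f' := chain_coend n)) => g x.
change (chain_coend n.+1 (stab_map F (@lift_inj n.+1 ord_max) (bsym F g x))
  = chain_coend n (bsym F g x)).
rewrite stab_mapE !chain_coendE aut_stabE -(det_cocycle_stab g) -ctens_natural.
congr (ctens _ _); rewrite -!contra_comp; apply: contra_ext => v.
exact: proj_inj_of_row.
Qed.

Definition stable_coend : {additive stable_barcoker F -> CF} :=
  seqcolim_lift chain_coend_stab.

Lemma stable_coendE n d : stable_coend (stable_inj F n d) = chain_coend n d.
Proof. by rewrite stable_injE [LHS]seqcolim_liftE. Qed.

End CoendSymbols.
Global Opaque chain_coend stable_coend.

(** * From bar homology to symbols *)

Section HomologyClasses.
Variable F : contraFunctor.

Section Level.
Variable n : nat.
Local Notation M := (autF_module n F).

Definition bar_class : {additive bar1 M -> barcoker F 'I_n} :=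
  dsum_lift (fun g : autF n => bsym F g \o contra_map F to_row).

Lemma bar_class_inj g x : bar_class (bar1_inj M g x) = bsym F g (contra_map F to_row x).
Proof. exact: dsum_lift_inj. Qed.

Lemma gactV_E (g : autF n) (x : F 'rV[int]_n) :
  gact M g^-1%g x = contra_map F (aut_ab g) x.
Proof. by rewrite /= invgK. Qed.

Lemma ract_to_row (g : autF n) (x : F 'rV[int]_n) :
  ract F g (contra_map F to_row x) = contra_map F to_row (contra_map F (aut_ab g) x).
Proof.
rewrite ractE -!contra_comp; apply: contra_ext => v; exact/esym/aut_ab_to_row.
Qed.

Lemma bar_class_d2 c : bar_class (bar_d2 M c) = 0.
Proof.
apply: (dsum_ext (f := bar_class \o bar_d2 M) (g := \0)) => -[g h] x.
change (bar_class (bar_d2 M (bar2_inj M (g, h) x)) = 0).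
rewrite bar_d2E raddfD raddfB !bar_class_inj gactV_E -ract_to_row (bsymM g h).
by rewrite opprD addrCA subrr addr0 addNr.
Qed.

Lemma bar_class_cbd z : cbd (bar_class z) = contra_map F to_row (bar_d1 M z).
Proof.
apply: (dsum_ext (f := cbd \o bar_class) (g := contra_map F to_row \o bar_d1 M)) => g x.
change (cbd (bar_class (bar1_inj M g x)) = contra_map F to_row (bar_d1 M (bar1_inj M g x))).
by rewrite bar_class_inj cbdE ract_to_row bar_d1E gactV_E raddfB.
Qed.

Definition bar2_range : set (bar1 M) := [set z | exists c, z = bar_d2 M c]%classic.

Lemma bar2_rangeE z : subgroup_gen bar2_range z -> exists c, z = bar_d2 M c.
Proof.
elim=> [|//|u v _ [c ->] _ [c' ->]]; first by exists 0; rewrite raddf0.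
by exists (c - c'); rewrite raddfB.
Qed.

(** By [fM] the class modulo boundaries satisfies the relations of [barcoker], so it is recovered
    from [bar_class] by the map [f]; thus [bar_class] kills boundaries only. *)
Lemma bar_class_eq0 z : bar_class z = 0 -> exists c, z = bar_d2 M c.
Proof.
have fM (g h : autF n) (x : F (zlat 'I_n)) :
  (quot_pi bar2_range \o bar1_inj M (g * h)%g \o contra_map F of_row : {additive _ -> _}) x
  = (quot_pi bar2_range \o bar1_inj M g \o contra_map F of_row : {additive _ -> _}) x
  + (quot_pi bar2_range \o bar1_inj M h \o contra_map F of_row : {additive _ -> _}) (ract F g x).
  change (quot_pi bar2_range (bar1_inj M (g * h)%g (contra_map F of_row x))
    = quot_pi bar2_range (bar1_inj M g (contra_map F of_row x))
    + quot_pi bar2_range (bar1_inj M h (contra_map F of_row (ract F g x)))).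
  rewrite -raddfD; apply/quot_piP; rewrite -opprB; apply/subgroup_genN/subgroup_gen_in.
  exists (bar2_inj M (g, h) (contra_map F of_row x)); rewrite bar_d2E gactV_E.
  have -> : contra_map F of_row (ract F g x) = contra_map F (aut_ab g) (contra_map F of_row x).
    by rewrite ractE -!contra_comp; apply: contra_ext => v; exact: ab_map_of_row.
  by rewrite -addrA addrC.
pose f : {additive barcoker F 'I_n -> quot bar2_range} := barcoker_lift fM.
have fE u : f (bar_class u) = quot_pi bar2_range u.
  apply: (dsum_ext (f := f \o bar_class) (g := quot_pi bar2_range)) => g x.
  change (f (bar_class (bar1_inj M g x)) = quot_pi bar2_range (bar1_inj M g x)).
  rewrite bar_class_inj [LHS]barcoker_liftE.
  change (quot_pi bar2_range (bar1_inj M g (contra_map F of_row (contra_map F to_row x)))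
    = quot_pi bar2_range (bar1_inj M g x)).
  do 2!apply: congr1; rewrite -[RHS](contra_id (A := 'rV[int]_n)).
  by apply: contra_compE => v; exact: of_rowK.
move=> z0; apply: bar2_rangeE; rewrite -(subr0 z); apply/quot_piP.
by rewrite -fE z0 !raddf0.
Qed.

Definition cycle_val : {additive kernel (bar_d1 M) -> bar1 M} := val.

Lemma H1_class_subproof z : bar_boundary z -> (bar_class \o cycle_val) z = 0.
Proof. by move=> [c zc]; apply: etrans (congr1 _ zc) _; exact: bar_class_d2. Qed.

Definition H1_class : {additive H1 M -> barcoker F 'I_n} := quot_lift H1_class_subproof.

Lemma H1_classE z : H1_class (quot_pi _ z) = bar_class (val z).
Proof. exact: quot_liftE. Qed.

Lemma H1_class_inj z : H1_class z = 0 -> z = 0.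
Proof.
rewrite -(quot_piK z); move: (X in quot_pi _ X) => c; rewrite H1_classE => /bar_class_eq0[u cu].
rewrite -(raddf0 (quot_pi (@bar_boundary _ M))); apply/quot_piP; rewrite subr0.
by apply: subgroup_gen_in; exists u.
Qed.

End Level.
Lemma H1_class_stab n (x : H1 (autF_module n F)) :
  H1_class n.+1 (H1_stab n F x) = stab_map F (@lift_inj n.+1 ord_max) (H1_class n x).
Proof.
rewrite -(quot_piK x); move: (X in quot_pi _ X) => z.
rewrite /H1_stab /H1_map quot_mapE !H1_classE.
pose st : {additive bar1 (autF_module n F) -> bar1 (autF_module n.+1 F)} :=
  @bar1_map _ _ (autF_module n F) (autF_module n.+1 F) (aut_stab n) (contra_map F (proj_first n)).
change (bar_class n.+1 (st (val z)) = stab_map F (@lift_inj n.+1 ord_max) (bar_class n (val z))).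
move: (val z).
apply: (dsum_ext (f := bar_class n.+1 \o st)
  (g := stab_map F (@lift_inj n.+1 ord_max) \o bar_class n)) => g y.
change (bar_class n.+1 (st (bar1_inj (autF_module n F) g y))
  = stab_map F (@lift_inj n.+1 ord_max) (bar_class n (bar1_inj (autF_module n F) g y))).
rewrite /st bar1_mapE !bar_class_inj stab_mapE aut_stabE; congr (bsym F _ _).
rewrite -!contra_comp; apply: contra_ext => v.
change (proj_first n (to_row v) = to_row (proj_inj (lift (ord_max : 'I_n.+1)) v)).
by rewrite -[in RHS](to_rowK v) proj_inj_of_row of_rowK.
Qed.

Definition H1_stable_class : {additive stable_H1 F -> stable_barcoker F} :=
  seqcolim_map H1_class_stab.

Lemma H1_stable_classE n x :
  H1_stable_class (seqcolim_inj (fun n => H1_stab n F) n x) = stable_inj F n (H1_class n x).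
Proof. by rewrite stable_injE; exact: seqcolim_map_inj. Qed.

(** An element that dies in the colimit of the targets is already zero at a finite stage, where
    [H1_class] is injective. *)
Lemma H1_stable_class_inj q : H1_stable_class q = 0 -> q = 0.
Proof.
have [n [x ->]] := seqcolim_surj q; rewrite H1_stable_classE stable_injE.
move=> /seqcolim_inj_eq0[n0 h].
have push m : H1_class m (push_sum (fun n => H1_stab n F) (dsum_inj _ n x) m)
    = push_sum (V := fun n => barcoker F 'I_n) (fun n => stab_map F (@lift_inj n.+1 ord_max))
        (dsum_inj _ n (H1_class n x)) m.
  have hin k : H1_class k (dsum_inj (fun n => H1 (autF_module n F)) n x k)
      = dsum_inj (fun n => barcoker F 'I_n) n (H1_class n x) k.
    have [nk|nk] := eqVneq n k; first by subst k; rewrite !dsum_inj_eq.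
    by rewrite !dsum_inj_ne ?raddf0.
  elim: m => [|m IH]; first exact: hin.
  by rewrite [push_sum _ _ m.+1]/= [push_sum _ _ m.+1 in RHS]/= raddfD H1_class_stab IH hin.
pose m := maxn n n0.
rewrite -(seqcolim_inj_push _ x (leq_maxl n n0)) -/m.
suff -> : push_sum (fun n => H1_stab n F) (dsum_inj (fun n => H1 (autF_module n F)) n x) m = 0.
  by rewrite raddf0.
by apply: H1_class_inj; rewrite push h// leq_maxr.
Qed.

End HomologyClasses.

Section TensorLift.
Variables (A B W : zmodType) (g : A -> B -> W).
Hypothesis gDl : forall x x' y, g (x + x') y = g x y + g x' y.
Hypothesis gDr : forall x y y', g x (y + y') = g x y + g x y'.

Definition tensor_free_lift : {additive tensor_free A B -> W} :=
  dsum_lift (fun p : A * B => *~%R (g p.1 p.2)).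

Lemma tensor_free_liftE x y : tensor_free_lift (tensor_gen x y) = g x y.
Proof. by rewrite /tensor_free_lift dsum_lift_inj; exact: mulr1z. Qed.

Lemma tensor_lift_subproof z : tensor_rel z -> tensor_free_lift z = 0.
Proof.
by case=> [[x [x' [y ->]]]|[x [y [y' ->]]]];
  rewrite raddfB raddfD !tensor_free_liftE ?gDl ?gDr subrr.
Qed.

Definition tensor_lift : {additive tensor A B -> W} := quot_lift tensor_lift_subproof.

Lemma tensor_liftE x y : tensor_lift (tens x y) = g x y.
Proof. by rewrite [LHS]quot_liftE tensor_free_liftE. Qed.

End TensorLift.

(** * Bijectivity of the comparison map *)

Section Inverse.
Variables (F : contraFunctor) (rF : reduced_functor F) (pF : polynomial_functor F).

(** Conjugation by a product of two letters is a product of conjugations, and these fix the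
    coefficient, so their symbols add up. *)
Lemma inner_class_pointD (A : freeAbType) (x : F A) (y y' : A) :
  inner_class F (contra_map F (point (y + y')) x)
  = inner_class F (contra_map F (point y) x) + inner_class F (contra_map F (point y') x).
Proof.
pose c : {additive zlat bool -> A} := zlift (fun b => if b then y' else y).
have cE b : c (zgen b) = if b then y' else y by exact: zlift_gen.
have pE (w : freeGroup bool) v : c (fg_ab w) = v ->
    contra_map F (point v) x = contra_map F (point (fg_ab w)) (contra_map F c x).
  by move=> cw; apply/esym/contra_zcompE => i; rewrite !point_gen cw.
have e1 : c (fg_ab (fg_gen false * fg_gen true)%g) = y + y' by rewrite !fg_abE raddfD !cE.
have e2 : c (fg_ab (fg_gen false)) = y by rewrite fg_ab_gen cE.
have e3 : c (fg_ab (fg_gen true)) = y' by rewrite fg_ab_gen cE.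
rewrite (pE _ _ e1) (pE _ _ e2) (pE _ _ e3).
rewrite -!(bclass_conj_word rF pF) -raddfD; congr (bclass F _ _).
have -> : conj_word (fg_gen false * fg_gen true)%g tt
    = (conj_word (fg_gen true) tt * conj_word (fg_gen false) tt)%g.
  have av w : avoids (pred1 (inr tt : bool + unit)) (fg_map inl w) by apply: avoids_map.
  apply: aut_gen_ext => z; rewrite autM_E !conj1E; case: ifP => zt; last by rewrite conj1E zt.
  rewrite !gmulfM multV (conj1_avoid _ (av (fg_gen false))) conj1E zt.
  by rewrite invMg !mulgA.
by rewrite bsymM_fixed ?ract_conj1// addrC.
Qed.

Lemma inner_tensor_subproofl n (x x' : F 'rV[int]_n) (y : 'rV[int]_n) :
  inner_class F (contra_map F (point y) (x + x'))
  = inner_class F (contra_map F (point y) x) + inner_class F (contra_map F (point y) x').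
Proof. by rewrite !raddfD. Qed.

Definition inner_tensor n : {additive coend_summand F inclFunctor n -> stable_barcoker F} :=
  tensor_lift (@inner_tensor_subproofl n) (@inner_class_pointD 'rV[int]_n).

Lemma inner_coend_subproof z : @coend_rel F inclFunctor z -> dsum_lift inner_tensor z = 0.
Proof.
move=> [m [n [f [x [y ->]]]]]; rewrite raddfB !dsum_lift_inj !tensor_liftE.
apply/eqP; rewrite subr_eq0; apply/eqP; congr (inner_class F _).
by apply: contra_zcompE => i; rewrite !point_gen.
Qed.

Definition inner_coend : {additive coend F inclFunctor -> stable_barcoker F} :=
  quot_lift inner_coend_subproof.

Lemma inner_coendE n (x : F 'rV[int]_n) y :
  inner_coend (ctens x y) = inner_class F (contra_map F (point y) x).
Proof. by rewrite [LHS]quot_liftE dsum_lift_inj tensor_liftE. Qed.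

(** The cocycle of [conj_bool] is the basis vector of the letter [false], and restricting the
    coefficient to this letter gives back [y]. *)
Lemma stable_coendK y : inner_coend (stable_coend F (inner_class F y)) = inner_class F y.
Proof.
rewrite {1}inner_classE bclassE stable_coendE stab_mapE chain_coendE.
rewrite (@det_cocycle_conj _ _ (enum_rank false) (enum_rank true)).
- rewrite inner_coendE; congr (inner_class F _); rewrite -!contra_comp.
  rewrite -[RHS](contra_id (A := zlat unit)); apply: contra_zext => -[].
  change (proj_false (proj_inj enum_rank (of_row (point (delta_mx 0 (enum_rank false)) (zgen tt))))
    = zgen tt).
  rewrite point_gen of_row_delta (proj_inj_gen (@enum_rank_inj _)).
  exact: zlift_gen.
- by rewrite (inj_eq (@enum_rank_inj _)).
- rewrite aut_ext_gen /conj_bool conj1E eqxx !gmulfM multV.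
  by rewrite !fg_map_gen.
move=> k kt; rewrite -(enum_valK k) aut_ext_gen /conj_bool conj1E ifN ?fg_map_gen//.
by apply: contra kt => /eqP e; rewrite -(enum_valK k) e.
Qed.

Lemma elem_span_add (X : finType) (d d' : barcoker F X) :
  elem_span d -> elem_span d' -> elem_span (d + d').
Proof.
elim=> [|g x e eg _ IH] ed'; first by rewrite add0r.
by rewrite -addrA; apply: elem_spanD => //; exact: IH.
Qed.

(** A chain has finitely many terms; the bound in [stably_elem] is good for all larger [M], so one
    number of extra letters serves them all. *)
Lemma stably_elem_span (X : finType) (d : barcoker F X) :
  exists M0, forall M, (M0 <= M)%N -> elem_span (stab_map F (@inl_inj X 'I_M) d).
Proof.
rewrite -(quot_piK d); move: (X in quot_pi _ X) => z; rewrite (dsum_decomp z).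
elim/big_ind: _ => [|z1 z2 [M1 h1] [M2 h2]|g _].
- by exists 0%N => M _; rewrite !raddf0; exact: elem_span0.
- exists (maxn M1 M2) => M; rewrite geq_max => /andP[/h1 e1 /h2 e2].
  by rewrite [quot_pi _ _]raddfD raddfD; exact: elem_span_add.
have [M0 h] := stably_elem g; exists M0 => M /h eg.
change (elem_span (stab_map F (@inl_inj X 'I_M) (quot_pi (@chain1_rel F X) (chain1_inj F g (z g))))).
rewrite -bsymE stab_mapE -[bsym _ _ _]addr0; apply: elem_spanD => //; exact: elem_span0.
Qed.

Definition H1_coend : {additive stable_H1 F -> coend F inclFunctor} :=
  stable_coend F \o H1_stable_class F.

Lemma H1_coend_cycle n z : H1_coend (seqcolim_inj (fun n => H1_stab n F) n (quot_pi _ z))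
  = chain_coend F n (bar_class F n (val z)).
Proof.
change (stable_coend F (H1_stable_class F (seqcolim_inj (fun n => H1_stab n F) n (quot_pi _ z)))
  = chain_coend F n (bar_class F n (val z))).
by rewrite H1_stable_classE H1_classE stable_coendE.
Qed.

(** On inner classes [inner_coend] is a left inverse of the comparison, so it is enough that the
    stable class of a cycle is inner: this is [elem_span_inner] once enough letters are added. *)
Lemma H1_coend_eq0 q : H1_coend q = 0 -> q = 0.
Proof.
move=> q0; apply: H1_stable_class_inj.
suff [y qy] : inner_span (H1_stable_class F q).
  by rewrite qy -stable_coendK -qy [stable_coend _ _]q0 raddf0.
have [n [x ->]] := seqcolim_surj q; rewrite -(quot_piK x); move: (X in quot_pi _ X) => z.
rewrite H1_stable_classE H1_classE; set d := bar_class _ _ _.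
have d0 : cbd d = 0.
  by rewrite bar_class_cbd kernelP raddf0.
rewrite -bclass_ord//; have [M h] := stably_elem_span d.
rewrite -(bclass_stab (@inl_inj 'I_n 'I_M) d0).
apply: elem_span_inner => //; first exact: h.
by rewrite stab_map_cbd d0 raddf0.
Qed.

(** Modulo the range [R], only tensors of [x] with a basis vector need to vanish. Such a tensor is
    the image of a cycle: the letter [i] conjugates a new last letter, and [x] is pulled back along
    [proj_first]. *)
Lemma H1_coend_surj c : exists q, H1_coend q = c.
Proof.
pose R : set (coend F inclFunctor) := [set c | exists q, H1_coend q = c]%classic.
have RE c' : subgroup_gen R c' -> R c'.
  elim=> [|//|u v _ [q <-] _ [q' <-]]; first by exists 0; rewrite raddf0.
  by exists (q - q'); rewrite raddfB.
apply: (RE); rewrite -(subr0 c); apply/quot_piP; rewrite raddf0.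
apply: (coend_ext (f := quot_pi R) (g := \0)) => n x y.
pose f : {additive 'rV[int]_n -> quot R} := quot_pi R \o ctensr x.
apply: (row_ext (f := f) (g := \0)) => i.
change (quot_pi R (ctens x (delta_mx 0 i)) = 0); rewrite -(raddf0 (quot_pi R)).
apply/quot_piP; rewrite subr0; apply: subgroup_gen_in.
have av : avoids (pred1 (ord_max : 'I_n.+1)) (fg_gen (lift ord_max i)).
  by apply: avoids_gen; rewrite /= eq_sym neq_lift.
pose g : autF n.+1 := conj1 av; pose x' := contra_map F (proj_first n) x.
have gx' : contra_map F (aut_ab g) x' = x'.
  rewrite -[RHS](contra_id (A := 'rV[int]_n.+1)); apply: contra_ext.
  apply: (row_ext (g := idfun)) => k.
  change ((delta_mx 0 k : 'rV[int]_n.+1) *m aut_mx g = delta_mx 0 k); rewrite -rowE rowK conj1E.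
  case: ifP => _; rewrite ?abelianizeM ?abelianizeV !abelianize_gen//.
  by rewrite addrAC subrr add0r.
have z0 : bar_d1 (autF_module n.+1 F) (bar1_inj (autF_module n.+1 F) g x') == 0.
  by rewrite bar_d1E gactV_E gx' subrr.
exists (seqcolim_inj (fun n => H1_stab n F) n.+1 (quot_pi _ (Kernel z0))).
rewrite H1_coend_cycle /= bar_class_inj chain_coendE.
rewrite (contra_compE (h := idfun)) ?contra_id; last by move=> v; exact: of_rowK.
rewrite (@det_cocycle_conj _ _ (lift ord_max i) ord_max).
- rewrite ctens_natural; congr (ctens _ _).
  by apply/rowP => k; rewrite !mxE (inj_eq (@lift_inj _ _)).
- by rewrite eq_sym neq_lift.
- by rewrite conj1E eqxx.
by move=> k kt; rewrite conj1E (negbTE kt).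
Qed.

Lemma H1_coend_bij : bijective H1_coend.
Proof.
pose inv c := sval (cid (H1_coend_surj c)).
have invK c : H1_coend (inv c) = c := svalP (cid (H1_coend_surj c)).
exists inv => // q; apply/eqP; rewrite -subr_eq0; apply/eqP/H1_coend_eq0.
by rewrite raddfB invK subrr.
Qed.

End Inverse.

(** [det_cocycle] depends on the automorphism alone, so on each symbol both sides apply [eta] to the
    left factor of the same tensor. *)
Lemma H1_coend_natural (F F' : contraFunctor) (eta : contraNat F F') (q : stable_H1 F) :
  H1_coend F' (stable_H1_map eta q) = coend_map eta inclFunctor (H1_coend F q).
Proof.
have [n [x ->]] := seqcolim_surj q; rewrite -(quot_piK x); move: (X in quot_pi _ X) => z.
rewrite /stable_H1_map seqcolim_map_inj /autF_H1_map /H1_map quot_mapE !H1_coend_cycle.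
pose et : {additive bar1 (autF_module n F) -> bar1 (autF_module n F')} :=
  @bar1_map _ _ (autF_module n F) (autF_module n F') idfun (eta _).
change (chain_coend F' n (bar_class F' n (et (val z)))
  = coend_map eta inclFunctor (chain_coend F n (bar_class F n (val z)))).
move: (val z).
apply: (dsum_ext (f := chain_coend F' n \o bar_class F' n \o et)
  (g := coend_map eta inclFunctor \o chain_coend F n \o bar_class F n)) => g y.
change (chain_coend F' n (bar_class F' n (et (bar1_inj (autF_module n F) g y)))
  = coend_map eta inclFunctor (chain_coend F n (bar_class F n (bar1_inj (autF_module n F) g y)))).
rewrite /et bar1_mapE !bar_class_inj !chain_coendE.
rewrite !(contra_compE (h := idfun)) ?contra_id; try by move=> v; exact: of_rowK.
rewrite /coend_map quot_mapE dsum_mapE; congr (quot_pi _ (dsum_inj _ _ _)).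
by rewrite /coend_summand_map tensor_mapE.
Qed.

Theorem proposition1 :
  exists phi : forall F : contraFunctor,
      reduced_functor F -> polynomial_functor F ->
      {additive stable_H1 F -> coend F inclFunctor},
    (forall (F : contraFunctor) (rF : reduced_functor F)
            (pF : polynomial_functor F),
        bijective (phi F rF pF)) /\
    (forall (F F' : contraFunctor) (rF : reduced_functor F) (pF : polynomial_functor F)
            (rF' : reduced_functor F') (pF' : polynomial_functor F') (eta : contraNat F F')
            (x : stable_H1 F),
        phi F' rF' pF' (stable_H1_map eta x)
        = coend_map eta inclFunctor (phi F rF pF x)).
Proof.
exists (fun F _ _ => H1_coend F); split=> [F rF pF|F F' _ _ _ _ eta x].
  exact: H1_coend_bij.
exact: H1_coend_natural.
Qed.
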